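(* Let $d\in\{2,3,\dots\}\cup\{\infty\}$, $\lambda=\frac{d-2}{2}$, and let $K\colon\mathbb{R}^d\times\mathbb{R}^d\to\mathbb{C}$ be a function. The following assertions are equivalent: (i) $K$ is a continuous positive definite kernel which is isotropic, i.e. $K(x,y)=K(Ux,Uy)$ for all $x,y\in\mathbb{R}^d$ and every linear isometry $U\in O(d)$. (ii) $K$ is a positive definite kernel and has the representation $K(x,y)=\kappa(\|x\|,\|y\|,\langle x,y\rangle)$ for a continuous function $\kappa\colon M\to\mathbb{C}$, where $M=\{(r,s,\gamma)\in[0,\infty)^2\times\mathbb{R}: |\gamma|\le rs\}$. (iii) $K$ has the representation $$K(x,y)=\begin{cases}\sum_{n=0}^\infty \alpha_n^{d}(\|x\|,\|y\|)\,\hat C_n^{\lambda}\bigl(\bigl\langle \tfrac{x}{\|x\|},\tfrac{y}{\|y\|}\bigr\rangle\bigr), & x\neq 0\text{ and }y\neq 0,\\ \alpha_0^{d}(\|x\|,\|y\|), & x=0\text{ or }y=0,\end{cases}$$ where $\alpha_n^{d}\colon[0,\infty)^2\to\mathbb{C}$, $n\in\mathbb{N}_0$, are unique, continuous, positive definite kernels on $[0,\infty)$ with the following properties: (a) for every $r\in[0,\infty)$ there is a neighborhood $U_r\subset[0,\infty)$ of $r$ such that $\sup_{s\in U_r}\sum_{n=N}^\infty\alpha_n^{d}(s,s)\to 0$ as $N\to\infty$; (b) for all $n\ge 1$ and all $r\in[0,\infty)$, $\alpha_n^{d}(r,0)=\alpha_n^{d}(0,r)=0$. Moreover (when these equivalent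 assertions hold), the unique kernels $\alpha_n^{d}$ are all real-valued if and only if $K$ is real-valued. For $d<\infty$, with $\kappa$ as in (ii), for all $r,s\in[0,\infty)$ and $n\in\mathbb{N}_0$, $$\alpha_n^{d}(r,s)=\frac{\int_{-1}^1\kappa(r,s,rs\rho)\,\hat C_n^{\lambda}(\rho)\,w(\rho)\,d\rho}{\|\hat C_n^{\lambda}\|_{w}^2},\qquad w(\rho)=(1-\rho^2)^{\lambda-\frac12},$$ where $\|f\|_w^2=\langle f,f\rangle_w$ and $\langle f,g\rangle_w=\int_{-1}^1 f(\rho)\overline{g(\rho)}w(\rho)\,d\rho$.
   Context: For $d=\infty$, $\mathbb{R}^\infty:=\ell^2$ is the real Hilbert space of square summable real sequences. $O(d)$ is the group of (bijective) linear isometries of $\mathbb{R}^d$ (for $d<\infty$, the orthogonal matrices). A positive definite kernel on a set $X$ is a function $K\colon X\times X\to\mathbb{C}$ such that $\sum_{i,j=1}^m c_i\overline{c_j}K(x_i,x_j)\ge 0$ for all $m\in\mathbb{N}$, $x_1,\dots,x_m\in X$, $c\in\mathbb{C}^m$ (strictness is not required). Normalized Gegenbauer polynomials: for $0<\lambda<\infty$, $\hat C_n^\lambda(t)=C_n^\lambda(t)/C_n^\lambda(1)$, where $C_n^\lambda$ is the Gegenbauer polynomial of degree $n$ and index $\lambda$, i.e. $\sum_{n\ge0}z^nC_n^\lambda(t)=(1-2tz+z^2)^{-\lambda}$ for $|z|<1$, $t\in[-1,1]$. For $\lambda=0$ ($d=2$), $\hat C_n^0=T_n$ is the Chebyshev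 polynomial of the first kind, $T_n(\cos\theta)=\cos(n\theta)$. For $\lambda=\infty$ ($d=\infty$), $\hat C_n^\infty(t)=t^n$ (with $0^0=1$). ''Unique'' means that there is exactly one family $(\alpha_n^d)_{n\in\mathbb{N}_0}$ of continuous positive definite kernels on $[0,\infty)$ satisfying the displayed representation together with (a) and (b). *)

(* Defs.v *)
From HB Require Import structures.
From mathcomp Require Import all_boot all_order all_algebra.
From mathcomp Require Import ring lra.
From mathcomp Require Export complex.
From mathcomp Require Import all_classical all_reals all_analysis.
Set Implicit Arguments.
Unset Strict Implicit.
Unset Printing Implicit Defensive.
Import Order.TTheory GRing.Theory Num.Theory.
Import numFieldNormedType.Exports.
Local Open Scope classical_set_scope.
Local Open Scope ring_scope.
Local Open Scope complex_scope.

HB.instance Definition _ (R : rcfType) := NormedModule.copy R[i] R[i]^o.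

Definition square_summable (R : realType) : {pred (nat -> R)} :=
  mem [set u : nat -> R | cvgn (series (fun n => u n ^+ 2))].

Record ell2 (R : realType) :=
  Ell2 { ell2_val :> nat -> R ; ell2P : ell2_val \in @square_summable R }.

Section ell2_theory.
Variable R : realType.

Lemma square_summableP (u : nat -> R) :
  reflect (cvgn (series (fun n => u n ^+ 2))) (u \in @square_summable R).
Proof. by apply: (iffP idP); rewrite inE. Qed.

Lemma square_summable_submod : submod_closed (@square_summable R).
Proof.
split=> [|a u v /square_summableP su /square_summableP sv].
  apply/square_summableP; rewrite (_ : series _ = fun=> 0); first exact: is_cvg_cst.
  by apply/funext => n; rewrite /series/= big1// => i _; rewrite expr0n.
apply/square_summableP.
have sw : cvgn (series (fun n => 2 * (a ^+ 2 * u n ^+ 2 + v n ^+ 2))).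
  pose f := 2 *: (a ^+ 2 *: (fun n => u n ^+ 2) + (fun n => v n ^+ 2)).
  suff : cvgn (series f) by [].
  by apply: is_cvg_seriesZ; apply: is_cvg_seriesD => //; apply: is_cvg_seriesZ.
apply: series_le_cvg sw => n; first exact: sqr_ge0.
  apply: mulr_ge0 => //; apply: addr_ge0; last exact: sqr_ge0.
  by apply: mulr_ge0; exact: sqr_ge0.
rewrite -[leLHS]/((a * u n + v n) ^+ 2) -subr_ge0.
have -> : 2 * (a ^+ 2 * u n ^+ 2 + v n ^+ 2) - (a * u n + v n) ^+ 2
        = (a * u n - v n) ^+ 2 by ring.
exact: sqr_ge0.
Qed.

HB.instance Definition _ :=
  GRing.isSubmodClosed.Build R (nat -> R) (@square_summable R)
    square_summable_submod.

HB.instance Definition _ := [isSub for @ell2_val R].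
HB.instance Definition _ := [Choice of ell2 R by <:].
HB.instance Definition _ := [SubChoice_isSubLmodule of ell2 R by <:].

Definition ell2_dot (u v : ell2 R) : R := limn (series (fun n => u n * v n)).

Lemma ell2_dot_cvg (u v : ell2 R) : cvgn (series (fun n => u n * v n)).
Proof.
have := ell2P u; have := ell2P v; have := ell2P (u + v).
move=> /square_summableP suv /square_summableP sv /square_summableP su.
have -> : (fun n => u n * v n) = 2^-1 *: ((fun n => (u + v) n ^+ 2) -
    (fun n => u n ^+ 2) - (fun n => v n ^+ 2)).
  apply/funext => n.
  rewrite -[RHS]/(2^-1 * ((u n + v n) ^+ 2 - u n ^+ 2 - v n ^+ 2)).
  by field.
by apply: is_cvg_seriesZ; apply: is_cvg_seriesB => //; apply: is_cvg_seriesB.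
Qed.

Lemma ell2_dotC (u v : ell2 R) : ell2_dot u v = ell2_dot v u.
Proof. by rewrite /ell2_dot; under eq_fun do rewrite mulrC. Qed.

Lemma ell2_dotDl (u v w : ell2 R) :
  ell2_dot (u + v) w = ell2_dot u w + ell2_dot v w.
Proof.
rewrite /ell2_dot -lim_seriesD; [|exact: ell2_dot_cvg..].
by congr (limn (series _)); apply/funext => n; exact: mulrDl.
Qed.

Lemma ell2_dotZl (a : R) (u w : ell2 R) :
  ell2_dot (a *: u) w = a * ell2_dot u w.
Proof.
rewrite /ell2_dot -[RHS]lim_seriesZ; last exact: ell2_dot_cvg.
by congr (limn (series _)); apply/funext => n; rewrite /= -mulrA.
Qed.

Lemma ell2_dot_ge0 (u : ell2 R) : 0 <= ell2_dot u u.
Proof.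
apply: limr_ge; first exact: ell2_dot_cvg.
by apply: nearW => n; apply: sumr_ge0 => i _; rewrite -expr2 sqr_ge0.
Qed.

Lemma ell2_dot_eq0 (u : ell2 R) : ell2_dot u u = 0 -> u = 0.
Proof.
move=> u0; apply/val_inj/funext => n /=.
have nd : nondecreasing_seq (series (fun n => u n * u n)).
  apply/nondecreasing_seqP => k; rewrite /series/= big_nat_recr//= lerDl.
  by rewrite -expr2 sqr_ge0.
have := nondecreasing_cvgn_le nd (@ell2_dot_cvg u u) n.+1.
rewrite -/(ell2_dot u u) u0 /series/= big_nat_recr//= => h.
have s0 : 0 <= \sum_(0 <= i < n) u i * u i.
  by apply: sumr_ge0 => i _; rewrite -expr2 sqr_ge0.
have := sqr_ge0 (u n); rewrite expr2 => un0.
have : u n * u n = 0 by lra.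
by move/eqP; rewrite mulf_eq0 orbb => /eqP.
Qed.

Lemma ell2_dot_CS (u v : ell2 R) :
  ell2_dot u v ^+ 2 <= ell2_dot u u * ell2_dot v v.
Proof.
have [v0|v0] := eqVneq (ell2_dot v v) 0.
  rewrite (ell2_dot_eq0 v0) ell2_dotC -[in leLHS](scale0r 0) ell2_dotZl.
  by rewrite mul0r expr0n -(scale0r 0) ell2_dotZl mul0r mulr0.
have vp : 0 < ell2_dot v v by rewrite lt_neqAle eq_sym v0 ell2_dot_ge0.
have := ell2_dot_ge0 (ell2_dot v v *: u + (- ell2_dot u v) *: v).
rewrite ell2_dotDl !ell2_dotZl ![ell2_dot _ (_ + _)]ell2_dotC !ell2_dotDl.
rewrite !ell2_dotZl (ell2_dotC v u).
set a := ell2_dot u u; set b := ell2_dot u v; set c := ell2_dot v v.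
have -> : c * (c * a + - b * b) + - b * (c * b + - b * c) =
  c * (a * c - b ^+ 2) by ring.
by rewrite pmulr_rge0// subr_ge0.
Qed.

Definition ell2_norm (u : ell2 R) : R := Num.sqrt (ell2_dot u u).

Lemma ell2_normD (u v : ell2 R) :
  ell2_norm (u + v) <= ell2_norm u + ell2_norm v.
Proof.
have uv0 : 0 <= ell2_norm u + ell2_norm v by rewrite addr_ge0 ?sqrtr_ge0.
rewrite /ell2_norm -[leRHS]ger0_norm// -sqrtr_sqr ler_wsqrtr// sqrrD.
rewrite !sqr_sqrtr ?ell2_dot_ge0// ell2_dotDl ![ell2_dot _ (_ + _)]ell2_dotC.
rewrite !ell2_dotDl (ell2_dotC v u) -sqrtrM ?ell2_dot_ge0//.
have : ell2_dot u v <= Num.sqrt (ell2_dot u u * ell2_dot v v).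
  by rewrite (le_trans (ler_norm _))// -sqrtr_sqr ler_wsqrtr// ell2_dot_CS.
rewrite mulr2n; lra.
Qed.

Lemma ell2_normZ (a : R) (u : ell2 R) : ell2_norm (a *: u) = `|a| * ell2_norm u.
Proof.
rewrite /ell2_norm ell2_dotZl ell2_dotC ell2_dotZl mulrA -expr2.
by rewrite sqrtrM ?sqr_ge0// sqrtr_sqr.
Qed.

Lemma ell2_norm_eq0 (u : ell2 R) : ell2_norm u = 0 -> u = 0.
Proof.
move/eqP; rewrite sqrtr_eq0 => u0; apply: ell2_dot_eq0.
by apply/eqP; rewrite eq_le u0 ell2_dot_ge0.
Qed.

HB.instance Definition _ := Lmodule_isNormed.Build R (ell2 R)
  ell2_normD ell2_normZ ell2_norm_eq0.

End ell2_theory.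

Inductive dimension := Fin of nat | Infinite.

Definition dim_ge2 (d : dimension) : bool :=
  if d is Fin n then (2 <= n)%N else true.

(* The topology of 'rV[R]_n comes from the sup norm, which is equivalent to
   the Euclidean norm; lengths and isometries below always refer to [euclid_norm]. *)
Definition euclidean (R : realType) (d : dimension) : normedModType R :=
  match d with Fin n => 'rV[R]_n | Infinite => ell2 R end.

Definition euclid_dot (R : realType) (d : dimension) : euclidean R d -> euclidean R d -> R :=
  match d with
  | Fin n => fun x y : 'rV[R]_n => \sum_(i < n) x 0 i * y 0 i
  | Infinite => @ell2_dot R
  end.

Definition euclid_norm (R : realType) (d : dimension) (x : euclidean R d) : R :=
  Num.sqrt (euclid_dot x x).

Definition dim_index (R : realType) (d : dimension) : \bar R :=
  match d with Fin n => ((n%:R - 2) / 2)%:E | Infinite => +oo%E end.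

Definition gegenbauer_gf (R : realType) (l : R) (C : nat -> {poly R}) : Prop :=
  forall z t : R, `|z| < 1 -> -1 <= t <= 1 ->
    series (fun n => z ^+ n * (C n).[t]) @ \oo -->
      (1 - 2 * t * z + z ^+ 2) `^ (- l).

(* The generating function determines every polynomial on [-1, 1], hence
   everywhere; existence for l > 0 is [gegenbauerP] below. *)
Definition gegenbauer (R : realType) (l : R) : nat -> {poly R} :=
  xget (fun=> 0) [set C | gegenbauer_gf l C].

(* Existence: with w = exp(i a), v = exp(-i a) and t = cos a, [gg_conv w v n] is
   the n-th coefficient of (1 - w z)^(-l) (1 - v z)^(-l), which satisfies the
   three-term recurrence and is bounded by its value at w = v = 1. *)
Section gegenbauer_coef.
Variables (F : numFieldType) (l : F).

Fixpoint gg_rising (n : nat) : F := if n is m.+1 then gg_rising m * (m%:R + l) / m.+1%:R else 1.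

Lemma gg_risingS n : n.+1%:R * gg_rising n.+1 = (n%:R + l) * gg_rising n.
Proof. by rewrite /= -/(gg_rising n); field; rewrite addrC natr1 pnatr_eq0. Qed.

Definition gg_conv (w v : F) n := \sum_(k < n.+1) (gg_rising k * w ^+ k) * (gg_rising (n - k)%N * v ^+ (n - k)%N).
Definition gg_wconv (w v : F) n := \sum_(k < n.+1) k%:R * (gg_rising k * w ^+ k) * (gg_rising (n - k)%N * v ^+ (n - k)%N).

Lemma gg_convC w v n : gg_conv w v n = gg_conv v w n.
Proof.
rewrite /gg_conv (reindex_inj rev_ord_inj)/=; apply: eq_bigr => i _.
by rewrite subSS subKn -1?ltnS// mulrC.
Qed.

Lemma gg_wconvD w v n : gg_wconv w v n + gg_wconv v w n = n%:R * gg_conv w v n.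
Proof.
rewrite /gg_wconv [X in _ + X](reindex_inj rev_ord_inj)/= -big_split/= /gg_conv mulr_sumr.
apply: eq_bigr => i _; rewrite subSS subKn -1?ltnS//.
have -> : n%:R = i%:R + (n - i)%:R :> F by rewrite -natrD subnKC// -ltnS.
by ring.
Qed.

Lemma gg_wconvS w v n : gg_wconv w v n.+1 = w * (gg_wconv w v n + l * gg_conv w v n).
Proof.
rewrite /gg_wconv big_ord_recl !mul0r add0r /gg_conv mulr_sumr -big_split mulr_sumr.
apply: eq_bigr => i _; rewrite lift0 subSS exprS.
have h := gg_risingS i.
have -> : i.+1%:R * (gg_rising i.+1 * (w * w ^+ i)) = (i.+1%:R * gg_rising i.+1) * (w * w ^+ i) by ring.
by rewrite h/=; ring.
Qed.

Lemma gg_convS w v t n : w * v = 1 -> w + v = 2 * t ->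
  n.+2%:R * gg_conv w v n.+2 =
  2 * t * (n.+1%:R + l) * gg_conv w v n.+1 - (n%:R + 2 * l) * gg_conv w v n.
Proof.
move=> wv tE; rewrite -!gg_wconvD [gg_wconv w v n.+2]gg_wconvS [gg_wconv v w n.+2]gg_wconvS (gg_convC v w).
have e1 := gg_wconvS w v n; have e2 := gg_wconvS v w n.
have e3 := gg_wconvD w v n.+1; have e4 := gg_wconvD w v n; rewrite (gg_convC v w) in e2.
have f1 : v * gg_wconv w v n.+1 = gg_wconv w v n + l * gg_conv w v n by rewrite e1 mulrA (mulrC v) wv mul1r.
have f2 : w * gg_wconv v w n.+1 = gg_wconv v w n + l * gg_conv w v n by rewrite e2 mulrA wv mul1r.
have -> : w * (gg_wconv w v n.+1 + l * gg_conv w v n.+1) + v * (gg_wconv v w n.+1 + l * gg_conv w v n.+1)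
  = (w + v) * (gg_wconv w v n.+1 + gg_wconv v w n.+1) + (w + v) * l * gg_conv w v n.+1
    - (v * gg_wconv w v n.+1) - w * gg_wconv v w n.+1 by ring.
rewrite f1 f2 tE e3.
have -> : gg_wconv v w n = n%:R * gg_conv w v n - gg_wconv w v n by rewrite -e4; ring.
by ring.
Qed.

Lemma gg_conv11S n : n.+1%:R * gg_conv 1 1 n.+1 = (n%:R + 2 * l) * gg_conv 1 1 n.
Proof. by rewrite mulrDl -!gg_wconvD !gg_wconvS; ring. Qed.

Lemma gg_conv0 w v : gg_conv w v 0 = 1.
Proof. by rewrite /gg_conv big_ord1/= !expr0; ring. Qed.

Lemma gg_conv1 w v : gg_conv w v 1 = l * (w + v).
Proof. by rewrite /gg_conv !big_ord_recl big_ord0/= /bump/= subn0 !expr1 !expr0; field. Qed.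

End gegenbauer_coef.

Section gegenbauer_coef_bound.
Variables (F : numFieldType) (l : F).
Hypothesis l0 : 0 <= l.

Lemma gg_rising_ge0 n : 0 <= gg_rising l n.
Proof.
elim: n => [|n IH]; first exact: ler01.
by rewrite /= divr_ge0// mulr_ge0// addr_ge0.
Qed.

Lemma gg_conv_norm w v n : `|w| = 1 -> `|v| = 1 -> `|gg_conv l w v n| <= gg_conv l 1 1 n.
Proof.
move=> w1 v1; rewrite (le_trans (ler_norm_sum _ _ _))//.
apply: ler_sum => i _; rewrite !normrM !normrX w1 v1.
by rewrite !expr1n !ger0_norm// gg_rising_ge0.
Qed.

End gegenbauer_coef_bound.

Section gegenbauer_exists.
Variables (R : realType) (l : R).
Hypothesis l0 : 0 < l.

Fixpoint gg_pair (n : nat) : {poly R} * {poly R} :=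
  if n is m.+1 then
    ((gg_pair m).2, m.+2%:R^-1 *: ((2 * (m.+1%:R + l)) *: ('X * (gg_pair m).2)
                              - (m%:R + 2 * l) *: (gg_pair m).1))
  else (1, (2 * l) *: 'X).
Definition gg_poly n := (gg_pair n).1.

Lemma gg_polyS t n : n.+2%:R * (gg_poly n.+2).[t] =
  2 * t * (n.+1%:R + l) * (gg_poly n.+1).[t] - (n%:R + 2 * l) * (gg_poly n).[t].
Proof.
rewrite /gg_poly/= hornerZ mulrA divff ?mul1r ?pnatr_eq0//.
by rewrite hornerD hornerN !hornerZ hornerM hornerX; ring.
Qed.

Lemma gg_polyE (w v : R[i]) t n : w * v = 1 -> w + v = (2 * t)%:C ->
  ((gg_poly n).[t])%:C = gg_conv l%:C w v n.
Proof.
move=> wv wt.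
suff : (gg_poly n).[t]%:C = gg_conv l%:C w v n /\ (gg_poly n.+1).[t]%:C = gg_conv l%:C w v n.+1 by case.
elim: n => [|n [IH1 IH2]].
  rewrite gg_conv0 gg_conv1 wt /gg_poly/= !hornerE; split => //.
  by rewrite -rmorphM/=; congr (_%:C); ring.
split => //.
have n0 : n.+2%:R != 0 :> R[i] by rewrite pnatr_eq0.
apply: (mulfI n0); rewrite (@gg_convS _ _ w v t%:C)//; last by rewrite wt rmorphM rmorph_nat.
rewrite -IH1 -IH2 -(rmorph_nat (real_complex R)) -rmorphM gg_polyS.
by rewrite rmorphB !rmorphM !rmorphD !rmorphM !rmorph_nat.
Qed.

Definition gg_bound n := gg_conv l 1 1 n.

Lemma gg_boundE n : (gg_bound n)%:C = gg_conv l%:C 1 1 n.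
Proof.
elim: n => [|n IH]; first by rewrite /gg_bound !gg_conv0.
have n0 : n.+1%:R != 0 :> R[i] by rewrite pnatr_eq0.
apply: (mulfI n0); rewrite gg_conv11S -IH -(rmorph_nat (real_complex R)) -rmorphM gg_conv11S.
by rewrite rmorphM rmorphD rmorphM !rmorph_nat.
Qed.

Lemma gg_poly_bound t n : -1 <= t <= 1 -> `|(gg_poly n).[t]| <= gg_bound n.
Proof.
move=> t1; pose s := Num.sqrt (1 - t ^+ 2).
have s2 : s ^+ 2 = 1 - t ^+ 2.
  by rewrite sqr_sqrtr// expr2; case/andP: t1 => *; nra.
pose w : R[i] := Complex t s; pose v : R[i] := Complex t (- s).
have nw : `|w| = 1 by rewrite normc_def/= s2 addrC subrK sqrtr1.
have nv : `|v| = 1 by rewrite normc_def/= sqrrN s2 addrC subrK sqrtr1.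
have wv : w * v = 1.
  by apply/eqP; rewrite eq_complex/=; apply/andP; split; apply/eqP; [have := s2; rewrite !expr2 => h|]; lra.
have wt : w + v = (2 * t)%:C.
  by apply/eqP; rewrite eq_complex/=; apply/andP; split; apply/eqP; lra.
have := @gg_conv_norm _ l%:C _ w v n nw nv.
rewrite -gg_boundE -(gg_polyE n wv wt) normc_def/= expr0n addr0 sqrtr_sqr => h.
by have := h _; rewrite !lecR; apply; exact: ltW.
Qed.

(* Radius of convergence at least 1. *)
Definition gg_tame (u : nat -> R) := forall r, 0 <= r < 1 ->
  exists M, forall n, `|u n| * r ^+ n <= M.

Lemma gg_bound_ge0 n : 0 <= gg_bound n.
Proof. by rewrite sumr_ge0// => i _; rewrite !expr1n !mulr1 mulr_ge0 ?gg_rising_ge0// ltW. Qed.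

Lemma gg_bound_tame : gg_tame gg_bound.
Proof.
move=> r /andP[r0 r1].
pose N := Num.bound (2 * l * r / (1 - r)).
have bd n : (N <= n)%N -> (n%:R + 2 * l) * r <= n.+1%:R.
  move=> Nn; have : 2 * l * r / (1 - r) < n%:R.
    rewrite (lt_le_trans (archi_boundP _))// ?ler_nat//.
    by apply: divr_ge0; [rewrite !mulr_ge0// ltW|rewrite subr_ge0 ltW].
  rewrite ltr_pdivrMr ?subr_gt0// => h; rewrite -natr1; nra.
have T0 k : 0 <= gg_bound k * r ^+ k by rewrite mulr_ge0 ?gg_bound_ge0 ?exprn_ge0.
exists (\sum_(0 <= k < N.+1) gg_bound k * r ^+ k) => n; rewrite ger0_norm ?gg_bound_ge0//.
have small k : (k <= N)%N -> gg_bound k * r ^+ k <= \sum_(0 <= k < N.+1) gg_bound k * r ^+ k.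
  move=> kN; rewrite (bigD1_seq k) ?mem_index_iota ?iota_uniq//= lerDl.
  by apply: sumr_ge0.
elim: n => [|n IH]; first exact: small.
have [nN|Nn] := leqP n.+1 N; first exact: small.
apply: le_trans IH; rewrite exprS mulrA ler_wpM2r ?exprn_ge0//.
have n0 : 0 < n.+1%:R :> R by rewrite ltr0n.
rewrite -(ler_pM2l n0) mulrA [_ * gg_bound _]gg_conv11S -/(gg_bound n).
rewrite mulrAC ler_wpM2r ?gg_bound_ge0// bd//.
Qed.

Lemma gg_poly_tame t : -1 <= t <= 1 -> gg_tame (fun n => (gg_poly n).[t]).
Proof.
move=> t1 r r01; have [M HM] := gg_bound_tame r01; exists M => n.
apply: le_trans (HM n); apply: ler_wpM2r; first by rewrite exprn_ge0//; case/andP: r01.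
by rewrite [leRHS]ger0_norm ?gg_bound_ge0// gg_poly_bound.
Qed.

Lemma gg_tame_diffs u : gg_tame u -> gg_tame (pseries_diffs u).
Proof.
move=> cu r /andP[r0 r1]; pose q := (1 + r) / 2.
have q01 : 0 <= q < 1 by rewrite /q; apply/andP; split; lra.
have [M HM] := cu _ q01.
have qp : 0 < q by rewrite /q; lra.
pose x := r / q.
have x0 : 0 <= x by rewrite divr_ge0// ltW.
have x1 : x < 1 by rewrite ltr_pdivrMr// mul1r /q; lra.
have M0 : 0 <= M by rewrite (le_trans _ (HM 0%N))// mulr_ge0.
have nx n : n.+1%:R * x ^+ n <= (1 - x)^-1.
  rewrite -[leRHS]mul1r ler_pdivlMr ?subr_gt0//.
  have h : n.+1%:R * x ^+ n <= \sum_(i < n.+1) x ^+ i.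
    rewrite -[n.+1 in leLHS]card_ord -sum1_card natr_sum mulr_suml.
    apply: ler_sum => i _; rewrite mul1r.
    by apply: ler_wiXn2l; rewrite ?(ltW x1)//; rewrite -ltnS.
  apply: (@le_trans _ _ ((\sum_(i < n.+1) x ^+ i) * (1 - x))).
    by rewrite ler_wpM2r// subr_ge0 ltW.
  rewrite mulrC -opprB mulNr -subrX1 opprB lerBlDr lerDl exprn_ge0//.
exists ((1 - x)^-1 * (M / q)) => n.
rewrite /pseries_diffs normrM ger0_norm//.
have -> : n.+1%:R * `|u n.+1| * r ^+ n = (n.+1%:R * x ^+ n) * (`|u n.+1| * q ^+ n).
  have -> : r = x * q by rewrite /x divfK// gt_eqF.
  by rewrite exprMn; ring.
apply: ler_pM => //; [by rewrite mulr_ge0// exprn_ge0|by rewrite mulr_ge0// exprn_ge0// ltW|].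
by rewrite ler_pdivlMr// -mulrA -exprSr.
Qed.

Lemma gg_tame_cvg u z : gg_tame u -> `|z| < 1 -> cvgn (pseries u z).
Proof.
move=> cu z1; pose q := (1 + `|z|) / 2.
have z0 := normr_ge0 z.
have q01 : 0 <= q < 1 by rewrite /q; apply/andP; split; lra.
have [M HM] := cu _ q01.
have qp : 0 < q by rewrite /q; lra.
pose x := `|z| / q.
have x0 : 0 <= x by rewrite divr_ge0// ltW.
have x1 : x < 1 by rewrite ltr_pdivrMr// mul1r /q; lra.
apply: normed_cvg.
apply: (@series_le_cvg _ _ (geometric M x)) => [n|n|n|].
- exact: normr_ge0.
- by rewrite /= mulr_ge0 ?exprn_ge0// (le_trans _ (HM 0%N))// mulr_ge0.
- rewrite /= normrM normrX.
  have -> : `|z| = q * x by rewrite /x mulrC divfK// gt_eqF.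
  by rewrite exprMn mulrA ler_wpM2r// exprn_ge0.
- by apply: is_cvg_geometric_series; rewrite ger0_norm.
Qed.

Section gegenbauer_ode.
Variable t : R.
Hypothesis t1 : -1 <= t <= 1.
Let u n := (gg_poly n).[t].
Let d := pseries_diffs u.
Let Q (x : R) : R := 1 - 2 * t * x + x ^+ 2.

Lemma gg_poly_diffs n : d n.+2 =
  2 * t * d n.+1 + 2 * t * l * u n.+2 - d n - 2 * l * u n.+1.
Proof.
rewrite /d /pseries_diffs [_.+3%:R * _]gg_polyS -/(u _) -/(u _).
by rewrite -[n.+2%:R]natr1; ring.
Qed.

Lemma gg_poly_partial x n :
  Q x * pseries d x n.+2 - 2 * l * (t - x) * pseries u x n.+2 =
  x ^+ n.+2 * ((x - 2 * t) * d n.+1 + d n + 2 * l * u n.+1).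
Proof.
elim: n => [|n IH].
  have u0 : u 0%N = 1 by rewrite /u /gg_poly/= hornerC.
  have u1 : u 1%N = 2 * l * t by rewrite /u /gg_poly/= hornerZ hornerX.
  have d0 : d 0%N = 2 * l * t by rewrite /d /pseries_diffs u1 mul1r.
  have d1 : d 1%N = 2 * t * (1 + l) * u 1%N - 2 * l.
    by rewrite /d /pseries_diffs [_ * _]gg_polyS -/(u _) -/(u _) u0; ring.
  rewrite /pseries /series/= !big_nat_recr//= !big_nil d1 d0 u1 u0 /Q.
  by ring.
rewrite /pseries /series/= big_nat_recr//= [X in _ - _ * X]big_nat_recr//=.
have h : forall a b a' b' c e : R, c * (a + a') - e * (b + b') = (c * a - e * b) + (c * a' - e * b').
  by move=> *; ring.
rewrite h; rewrite /pseries /series/= in IH; rewrite IH gg_poly_diffs /Q !exprS.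
by ring.
Qed.

Lemma gg_poly_ode x : `|x| < 1 ->
  Q x * limn (pseries d x) = 2 * l * (t - x) * limn (pseries u x).
Proof.
move=> x1; have cu : cvgn (pseries u x) by apply: gg_tame_cvg => //; exact: gg_poly_tame.
have cd : cvgn (pseries d x).
  by apply: gg_tame_cvg => //; apply: gg_tame_diffs; exact: gg_poly_tame.
apply/eqP; rewrite -subr_eq0; apply/eqP.
pose f n := Q x * pseries d x n - 2 * l * (t - x) * pseries u x n.
have f1 : f @ \oo --> Q x * limn (pseries d x) - 2 * l * (t - x) * limn (pseries u x).
  by apply: cvgB; apply: cvgMr.
have f0 : f @ \oo --> (x * (x - 2 * t)) * 0 + x ^+ 2 * 0 + x * (2 * l) * 0.
  rewrite -(cvg_shiftn 2) /=.
  have -> : (fun n => f (n + 2)%N) = (fun n => (x * (x - 2 * t)) * (d n.+1 * x ^+ n.+1)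
     + x ^+ 2 * (d n * x ^+ n) + x * (2 * l) * (u n.+1 * x ^+ n.+1)).
    by apply/funext => n; rewrite addn2 /f gg_poly_partial !exprS; ring.
  have ud := cvg_series_cvg_0 cd; have uu := cvg_series_cvg_0 cu.
  apply: cvgD; [apply: cvgD|]; apply: cvgMr => //.
    by rewrite -cvg_shiftS in ud.
  by rewrite -cvg_shiftS in uu.
by rewrite -[RHS](_ : (x * (x - 2 * t)) * 0 + x ^+ 2 * 0 + x * (2 * l) * 0 = 0); [exact: (cvg_unique _ f1 f0)|ring].
Qed.

Let H (x : R) : R := limn (pseries u x) * Q x `^ l.

Lemma Q_gt0 x : `|x| < 1 -> 0 < Q x.
Proof.
rewrite ltr_norml => /andP[x0 x1]; case/andP: t1 => ta tb.
have [x2|x2] := leP 0 x.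
  have h : 0 < (1 - x) ^+ 2 by rewrite exprn_gt0// subr_gt0.
  have h2 : 0 <= x * (1 - t) by rewrite mulr_ge0// subr_ge0.
  by rewrite expr2 in h; rewrite /Q expr2; lra.
have h : 0 < (1 + x) ^+ 2 by rewrite exprn_gt0//; lra.
have h2 : 0 <= (- x) * (1 + t) by rewrite mulr_ge0//; lra.
by rewrite expr2 in h; rewrite /Q expr2; lra.
Qed.

Lemma gg_poly_derive (x : R) : `|x| < 1 -> is_derive x (1 : R) H 0.
Proof.
move=> x1; have cbu := gg_poly_tame t1.
pose k : R := (1 + `|x|) / 2.
have x0 := normr_ge0 x.
have k1 : `|k| < 1 by rewrite ger0_norm /k; lra.
have xk : `|x| < `|k| by rewrite (@ger0_norm _ k) /k; lra.
have dF : is_derive x (1 : R) (fun x => limn (pseries u x)) (limn (pseries d x)).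
  apply: (@pseries_snd_diffs _ _ k) => //; apply: gg_tame_cvg => //.
  - by apply: gg_tame_diffs.
  - by do 2 apply: gg_tame_diffs.
have Q0 := Q_gt0 x1.
have dQ : is_derive x (1 : R) Q (2 * x - 2 * t).
  have -> : Q = (cst 1 - (2 * t) *: id) + (id ^+ 2) :> (R -> R) by apply/funext => y.
  have h := @is_deriveD R R R (cst 1 - (2 * t) *: id) (id ^+ 2) x (1 : R) _ _
    (is_deriveB (is_derive_cst (1 : R) x (1 : R))
                (is_deriveZ (2 * t) (is_derive_id x (1 : R))))
    (is_deriveX 2 (is_derive_id x (1 : R))).
  apply: is_derive_eq h _; rewrite sub0r /GRing.scale/=.
  by rewrite !mulr1 expr1 addrC.
have dP : is_derive x (1 : R) (fun y => Q y `^ l) (l * Q x `^ (l - 1) * (2 * x - 2 * t)).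
  apply: (@is_derive1_comp _ (fun y => y `^ l) Q).
  exact: is_derive1_powR.
have dH := is_deriveM dF dP.
apply: is_derive_eq dH _; rewrite /GRing.scale/=.
have -> : Q x `^ l = Q x `^ (l - 1) * Q x.
  by rewrite -[in X in _ = _ * X](powRr1 (ltW Q0)) -powRD ?subrK// gt_eqF// implybT.
have := gg_poly_ode x1; set A := limn _; set B := limn _ => e.
transitivity (Q x `^ (l - 1) * (Q x * A - 2 * l * (t - x) * B)); first by ring.
by rewrite e subrr mulr0.
Qed.

Lemma gg_poly_cst z : `|z| < 1 -> H z = H 0.
Proof.
move=> z1.
have ab a b : a <= b -> `|a| < 1 -> `|b| < 1 -> H a = H b.
  move=> leab a1 b1.
  have inab x : x \in `[a, b] -> `|x| < 1.
    by move: a1 b1; rewrite in_itv/= !ltr_norml => /andP[? ?] /andP[? ?] /andP[? ?]; apply/andP; split; lra.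
  have [||c _] := @MVT_segment _ H (fun=> 0) a b leab.
  - move=> x xab; apply: gg_poly_derive; apply: inab; exact: subset_itv_oo_cc xab.
  - by apply: derivable_within_continuous => x xab; have [] := gg_poly_derive (inab _ xab).
  - by rewrite mul0r => /eqP; rewrite subr_eq0 => /eqP.
by have [z0|z0] := leP 0 z; [symmetry|]; apply: ab; rewrite ?normr0// ltW.
Qed.

Lemma gg_poly_sum z : `|z| < 1 -> limn (pseries u z) = Q z `^ (- l).
Proof.
move=> z1; have := gg_poly_cst z1; rewrite {2}/H.
have -> : Q 0 = 1 by rewrite /Q; ring.
have -> : limn (pseries u 0) = 1.
  apply: cvg_lim => //; rewrite -(cvg_shiftn 1) /=.
  rewrite (_ : (fun _ => _) = cst 1); first exact: cvg_cst.
  apply/funext => n; rewrite /pseries /series/= addn1 big_nat_recl//= big1 ?addr0.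
    by rewrite /u /gg_poly/= hornerC expr0 mulr1.
  by move=> i _; rewrite expr0n mulr0.
rewrite powR1 mulr1 /H => h.
have q0 : 0 < Q z `^ l by rewrite powR_gt0// Q_gt0.
by rewrite powRN -[LHS](mulfK (lt0r_neq0 q0)) h mul1r.
Qed.

End gegenbauer_ode.

Lemma gg_poly_gf : gegenbauer_gf l gg_poly.
Proof.
move=> z t z1 t1; rewrite -gg_poly_sum//.
under eq_fun do rewrite mulrC.
by apply: gg_tame_cvg => //; exact: gg_poly_tame.
Qed.

End gegenbauer_exists.

Lemma gegenbauerP (R : realType) (l : R) :
  0 < l -> gegenbauer_gf l (gegenbauer l).
Proof.
move=> l0; apply: (@xgetPex _ _ [set C | gegenbauer_gf l C]).
by exists (gg_poly l); exact: gg_poly_gf.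
Qed.

Definition gegenbauer_hat (R : realType) (l : \bar R) (n : nat) (t : R) : R :=
  match l with
  | r%:E%E => if r == 0 then cos (n%:R * acos t)
            else (gegenbauer r n).[t] / (gegenbauer r n).[1]
  | +oo%E => t ^+ n
  | -oo%E => 0
  end.

Definition posdef_on (R : realType) (X : Type) (A : set X) (K : X -> X -> R[i]) :
    Prop :=
  forall (m : nat) (x : 'I_m -> X) (c : 'I_m -> R[i]), (forall i, A (x i)) ->
    0 <= \sum_(i < m) \sum_(j < m) c i * (c j)^* * K (x i) (x j).

Definition isotropic (R : realType) (d : dimension)
    (K : euclidean R d -> euclidean R d -> R[i]) : Prop :=
  forall U : {linear euclidean R d -> euclidean R d},
    bijective U -> (forall x, euclid_norm (U x) = euclid_norm x) ->
    forall x y, K x y = K (U x) (U y).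

Definition isotropic_pd_kernel (R : realType) (d : dimension)
    (K : euclidean R d -> euclidean R d -> R[i]) : Prop :=
  [/\ continuous (fun p : euclidean R d * euclidean R d => K p.1 p.2),
      posdef_on setT K & isotropic K].

Definition kappa_domain (R : realType) : set (R * R * R) :=
  [set p | [/\ 0 <= p.1.1, 0 <= p.1.2 & `|p.2| <= p.1.1 * p.1.2]].

Definition kappa_representation (R : realType) (d : dimension)
    (K : euclidean R d -> euclidean R d -> R[i]) (kappa : R -> R -> R -> R[i]) : Prop :=
  {within @kappa_domain R, continuous (fun p => kappa p.1.1 p.1.2 p.2)} /\
  forall x y, K x y = kappa (euclid_norm x) (euclid_norm y) (euclid_dot x y).

(* Kernels on [0, +oo[ are functions on R of which only the values at
   nonnegative arguments matter. *)
Definition halfline (R : realType) : set R := `[0, +oo[.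
Arguments halfline {R}.

Definition locally_uniform_tails (R : realType) (alpha : nat -> R -> R -> R[i]) :
    Prop :=
  forall r : R, 0 <= r -> exists U : set R,
    [/\ U `<=` halfline, within halfline (nbhs r) U &
        ereal_sup [set (\sum_(N <= n <oo) (complex.Re (alpha n s s))%:E)%E | s in U]
          @[N --> \oo] --> 0%E].

Definition series_representation (R : realType) (d : dimension)
    (K : euclidean R d -> euclidean R d -> R[i]) (alpha : nat -> R -> R -> R[i]) : Prop :=
  (forall x y, x != 0 -> y != 0 ->
     series (fun n => alpha n (euclid_norm x) (euclid_norm y) *
       (gegenbauer_hat (dim_index R d) n
          (euclid_dot ((euclid_norm x)^-1 *: x) ((euclid_norm y)^-1 *: y)))%:C) @ \oo --> K x y) /\
  (forall x y, x = 0 \/ y = 0 -> K x y = alpha 0%N (euclid_norm x) (euclid_norm y)).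

Definition schoenberg_kernels (R : realType) (d : dimension)
    (K : euclidean R d -> euclidean R d -> R[i]) (alpha : nat -> R -> R -> R[i]) : Prop :=
  [/\ forall n, {within halfline `*` halfline,
                 continuous (fun p => alpha n p.1 p.2)},
      forall n, posdef_on halfline (alpha n),
      series_representation K alpha,
      locally_uniform_tails alpha &
      forall n r, (1 <= n)%N -> 0 <= r ->
        alpha n r 0 = 0 /\ alpha n 0 r = 0].

Definition has_unique_schoenberg_kernels (R : realType) (d : dimension)
    (K : euclidean R d -> euclidean R d -> R[i]) : Prop :=
  exists2 alpha, schoenberg_kernels K alpha &
    forall beta, schoenberg_kernels K beta ->
      forall n r s, 0 <= r -> 0 <= s -> beta n r s = alpha n r s.

Definition cintegral (R : realType) (D : set R) (f : R -> R[i]) : R[i] :=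
  Complex (\int[lebesgue_measure]_(x in D) complex.Re (f x))
          (\int[lebesgue_measure]_(x in D) complex.Im (f x)).

(* [powR] vanishes at (0, l - 1/2) when l < 1/2, so that the weight is total;
   only the null set {-1, 1} is concerned. *)
Definition gegenbauer_weight (R : realType) (l rho : R) : R :=
  (1 - rho ^+ 2) `^ (l - 2^-1).

Definition gegenbauer_inner (R : realType) (l : R) (f g : R -> R[i]) : R[i] :=
  cintegral `[-1, 1]
    (fun rho => f rho * (g rho)^* * (gegenbauer_weight l rho)%:C).

(* Main.v *)
Require Import Defs.
From HB Require Import structures.
From mathcomp Require Import all_boot all_order all_algebra.
From mathcomp Require Import ring lra zify.
From mathcomp Require Import complex.
From mathcomp Require Import all_classical all_reals all_analysis measurable_realfun.
Set Implicit Arguments.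
Unset Strict Implicit.
Unset Printing Implicit Defensive.
Import Order.TTheory GRing.Theory Num.Theory.
Import numFieldNormedType.Exports.
Local Open Scope classical_set_scope.
Local Open Scope ring_scope.
Local Open Scope complex_scope.

(** Two pairs of vectors with equal norms and equal inner product are carried into each other by a
    product of two reflections ([euclid_isometry_exists]), so an isotropic K depends only on the
    Gram data of its arguments. Realising these data by vectors that depend continuously on them,
    the rows of the square root of the Gram matrix, makes kappa continuous
    ([isotropic_pd_kappa_representation]).

    For the series, take radii r_i and complex numbers c_i. The function G(t) = sum of c_i conj(c_j)
    kappa(r_i, r_j, r_i r_j t) is continuous, real and positive definite on the unit sphere, so by
    Schoenberg's theorem for spheres ([hat_expansion]) it has an expansion with nonnegative
    coefficients. Polarisation then expands each kappa(r, s, r s t) absolutely, with coefficients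
    alpha_n(r, s); since expansions are unique ([hat_coef_unique]), the coefficients of G are the
    quadratic forms of alpha_n, hence alpha_n is positive definite ([coefficient_posdef]). At t = 1
    the alpha_n sum to the continuous kernel kappa(r, s, r s). This kernel controls the increments
    of each alpha_n ([coefficient_gap_le]), which gives continuity, and Dini's theorem gives (a). If
    r s = 0, the expanded function is constant in t, which gives (b).

    Conversely, (a) and |alpha_n(r, s)| <= (alpha_n(r, r) + alpha_n(s, s)) / 2 make the series
    converge locally uniformly, so K is continuous; the Schur product theorem makes each term
    positive definite ([hat_psd]), and isotropy is visible on the terms. Any kernels as in (iii) are
    expansion coefficients of kappa(r, s, r s t) ([schoenberg_hat_coef]), whence uniqueness, the
    reality statement and the integral formula.

    Schoenberg's theorem on finite-dimensional spheres is proved without surface measure: a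
    cubature, built by slicing the sphere and Gauss quadrature, reproduces the mean of polynomials,
    and gives the reproducing property of the Gegenbauer polynomials. Testing positive definiteness
    of f on a Dirac mass plus a zonal polynomial density shows that the coefficients are nonnegative
    and summable ([zonal_coef_ge0], [zonal_coef_sum]); density of polynomials identifies the sum
    with f ([sphere_expansion]). For the sphere of l^2, the Bernstein polynomials of f have
    nonnegative coefficients, being quadratic forms of f on vertices of cubes
    ([bernstein_coef_ge0]), and this survives in the limit ([hilbert_expansion]). *)

Lemma natr1D_neq0 (R : numDomainType) (k : R) n : 0 <= k -> n.+1%:R + k != 0.
Proof. by move=> k0; rewrite gt_eqF// ltr_wpDr. Qed.

(** * Normalized Gegenbauer polynomials from their recurrence *)

Fixpoint ultraspherical_pair (R : fieldType) (k : R) (n : nat) : {poly R} * {poly R} :=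
  if n is m.+1 then
    let p := ultraspherical_pair k m in
    (p.2, (m.+1%:R + k)^-1 *: ((m.+1%:R *+ 2 + k) *: ('X * p.2) - m.+1%:R *: p.1))
  else (1, 'X).

(* The Gegenbauer polynomials of index k/2, normalized to be 1 at 1; k = 0 gives
   the Chebyshev polynomials. *)
HB.lock Definition ultraspherical (R : fieldType) (k : R) (n : nat) : {poly R} :=
  (ultraspherical_pair k n).1.

Section ultraspherical.
Variables (R : realFieldType) (k : R).
Hypothesis k0 : 0 <= k.
Local Notation C := (ultraspherical k).

Let nk n : n.+1%:R + k != 0. Proof. exact: natr1D_neq0. Qed.

Lemma ultrasphericalE0 : C 0 = 1. Proof. by rewrite unlock. Qed.
Lemma ultrasphericalE1 : C 1 = 'X. Proof. by rewrite unlock. Qed.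

Lemma ultrasphericalS n : (n.+1%:R + k) *: C n.+2 =
  (n.+1%:R *+ 2 + k) *: ('X * C n.+1) - n.+1%:R *: C n.
Proof. by rewrite unlock/= scalerA divff// scale1r. Qed.

Lemma horner_ultrasphericalS n t : (n.+1%:R + k) * (C n.+2).[t] =
  (n.+1%:R *+ 2 + k) * (t * (C n.+1).[t]) - n.+1%:R * (C n).[t].
Proof.
have /(congr1 (fun p => p.[t])) := ultrasphericalS n.
by rewrite hornerD hornerN !hornerZ hornerM hornerX.
Qed.

Lemma nat_ind2 (P : nat -> Prop) : P 0%N -> P 1%N ->
  (forall n, P n -> P n.+1 -> P n.+2) -> forall n, P n.
Proof.
move=> P0 P1 PS n; suff [] : P n /\ P n.+1 by [].
by elim: n => // n [? ?]; split => //; apply: PS.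
Qed.

Lemma ultraspherical1 n : (C n).[1] = 1.
Proof.
elim/nat_ind2: n => [||n h0 h1]; rewrite ?ultrasphericalE0 ?ultrasphericalE1 ?hornerC ?hornerX//.
apply: (mulfI (nk n)); rewrite horner_ultrasphericalS h0 h1; ring.
Qed.

Lemma size_ultraspherical n : size (C n) = n.+1.
Proof.
elim/nat_ind2: n => [||n h0 h1]; rewrite ?ultrasphericalE0 ?ultrasphericalE1 ?size_poly1 ?size_polyX//.
rewrite -(size_scale _ (nk n)) ultrasphericalS.
have a0 : n.+1%:R *+ 2 + k != 0 by rewrite gt_eqF// ltr_wpDr// pmulrn_lgt0.
have p0 : C n.+1 != 0 by rewrite -size_poly_gt0 h1.
by rewrite size_polyDl ?size_scale ?size_polyN ?size_scale ?pnatr_eq0// mulrC size_mulX// h1 ?h0.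
Qed.

Lemma ultraspherical_neq0 n : C n != 0.
Proof. by rewrite -size_poly_gt0 size_ultraspherical. Qed.

(** The two formulas are proved together, since differentiating the recurrence for C_{n+2} calls for
    the derivatives of both C_{n+1} and C_n. *)
Lemma ultraspherical_deriv n :
  (1 - 'X^2) * (C n.+1)^`() = n.+1%:R *: (C n - 'X * C n.+1) /\
  (1 - 'X^2) * (C n)^`() = (n%:R + k) *: ('X * C n - C n.+1).
Proof.
elim: n => [|n [IH1 IH2]].
  by rewrite ultrasphericalE0 ultrasphericalE1 derivX derivC; split; rewrite -!mul_polyC ?addr0 ?add0r ?expr2; ring.
have e := ultrasphericalS n.
split; last first.
  rewrite IH1 [RHS]scalerBr e -!mul_polyC mulr2n !polyCD. ring.
have nk' : (n.+1%:R + k)%:P != 0 :> {poly R} by rewrite polyC_eq0.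
apply: (mulfI nk').
have -> : (n.+1%:R + k)%:P * ((1 - 'X^2) * (C n.+2)^`()) =
  (1 - 'X^2) * ((n.+1%:R + k) *: C n.+2)^`() by rewrite derivZ -mul_polyC mulrCA.
rewrite e derivB !derivZ derivM derivX.
transitivity ((n.+1%:R *+ 2 + k)%:P * ((1 - 'X^2) * C n.+1 + 'X * ((1 - 'X^2) * (C n.+1)^`()))
   - n.+1%:R%:P * ((1 - 'X^2) * (C n)^`())); first by rewrite -!mul_polyC; ring.
rewrite IH1 IH2.
transitivity (n.+2%:R%:P * ((n.+1%:R + k) *: C n.+1 - 'X * ((n.+1%:R + k) *: C n.+2))); last first.
  by rewrite -!mul_polyC; ring.
rewrite e -!mul_polyC -(natr1 n.+1) -(natr1 n) mulr2n !polyCD polyC1; ring.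
Qed.

End ultraspherical.

(** * Orthogonality, from integration by parts against (1 - x^2)^((k - 1) / 2) *)

Section orthogonality.
Variables (R : realFieldType) (k : R) (L : {linear {poly R} -> R^o}).
Hypothesis k0 : 0 <= k.
Hypothesis LX : forall q, (1 + k) * L ('X * q) = L ((1 - 'X^2) * q^`()).
Local Notation C := (ultraspherical k).

(** [LX] together with [ultraspherical_deriv] relates L (X C_{n+1}) to L C_n, and the recurrence
    relates it to L C_{n+2} and L C_n; if L C_n = 0, the other two vanish. For C_2, where L C_0 = L
    1 is arbitrary, the two relations cancel exactly. *)
Lemma ultraspherical_int0 n : L (C n.+1) = 0.
Proof.
have k1 : 1 + k != 0 by rewrite gt_eqF// ltr_wpDr.
elim/nat_ind2: n => [||n h0 h1].
- rewrite ultrasphericalE1; apply: (mulfI k1).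
  by rewrite mulr0 -['X]mulr1 LX derivC mulr0 linear0.
- have := @ultrasphericalS _ _ k0 0 => /(congr1 L).
  have := LX (C 1%N); rewrite (@ultraspherical_deriv _ _ k0 0).1 !(linearZ, linearB)/=.
  rewrite /GRing.scale/= ultrasphericalE0 ultrasphericalE1.
  set a := L ('X * 'X); set b := L 1; set c := L _ => e1 e2.
  apply: (mulfI k1); rewrite mulr0 e2; lra.
have := @ultrasphericalS _ _ k0 n.+1 => /(congr1 L).
have := LX (C n.+2); rewrite (@ultraspherical_deriv _ _ k0 n.+1).1 !(linearZ, linearB)/=.
rewrite /GRing.scale/= h0.
set a := L ('X * _) => e1 e2.
have a0 : a = 0.
  have : (n.+3%:R + k) * a = 0 by rewrite -(natr1 n.+2); lra.
  by move/eqP; rewrite mulf_eq0 (negbTE (natr1D_neq0 _ k0))/= => /eqP.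
rewrite a0 in e2.
have : (n.+2%:R + k) * L (C n.+3) = 0 by rewrite e2; ring.
by move/eqP; rewrite mulf_eq0 (negbTE (natr1D_neq0 _ k0))/= => /eqP.
Qed.

Lemma ultraspherical_mulX n : exists a b : R,
  'X * C n.+1 = a *: C n.+2 + b *: C n.
Proof.
exists ((n.+1%:R *+ 2 + k)^-1 * (n.+1%:R + k)), ((n.+1%:R *+ 2 + k)^-1 * n.+1%:R).
rewrite -!scalerA (ultrasphericalS k0) scalerBr subrK scalerA mulVf ?scale1r//.
by rewrite gt_eqF// ltr_wpDr// pmulrn_lgt0.
Qed.

(** Two-step induction on m: the recurrence writes C_{m+2} with a factor X, and that factor is moved
    onto C_n, where it only shifts the degree by one. *)
Lemma ultraspherical_orth m n : (m < n)%N -> L (C m * C n) = 0.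
Proof.
elim/nat_ind2: m n => [||m h0 h1] [//|n] mn.
- by rewrite ultrasphericalE0 mul1r ultraspherical_int0.
- have [a [b e]] := ultraspherical_mulX n.
  rewrite ultrasphericalE1 e linearD !linearZ /= ultraspherical_int0; case: n mn {e} => // n _.
  by rewrite ultraspherical_int0 !scaler0 addr0.
have mk : m.+1%:R + k != 0 by rewrite gt_eqF// ltr_wpDr.
apply: (mulfI mk); rewrite mulr0 -[LHS]/(_ *: (L _ : R^o)) -linearZ -mul_polyC mulrA mul_polyC.
rewrite (ultrasphericalS k0).
have [a [b e]] := ultraspherical_mulX n.
have -> : ((m.+1%:R *+ 2 + k) *: ('X * C m.+1) - m.+1%:R *: C m) * C n.+1 =
  (m.+1%:R *+ 2 + k) *: (C m.+1 * ('X * C n.+1)) - m.+1%:R *: (C m * C n.+1).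
  by rewrite -!mul_polyC; ring.
rewrite e mulrDr -!scalerAr !(linearB, linearD, linearZ)/= !(linearD, linearZ)/=.
rewrite (h0 n.+1) ?(h1 n.+2) ?(h1 n) ?(scaler0,addr0,oppr0)//; lia.
Qed.

Lemma ultraspherical_basis (p : {poly R}) n : (size p <= n)%N ->
  exists a : nat -> R, p = \sum_(i < n) a i *: C i.
Proof.
elim: n p => [|n IH] p sp.
  by exists (fun=> 0); rewrite big_ord0; apply/eqP; rewrite -size_poly_leq0.
have ln : (C n)`_n != 0.
  by have := ultraspherical_neq0 k0 n; rewrite -lead_coef_eq0 lead_coefE size_ultraspherical.
pose c := p`_n / (C n)`_n.
have [|a e] := IH (p - c *: C n).
  apply/leq_sizeP => j nj; rewrite coefB coefZ; move: nj; rewrite leq_eqVlt => /predU1P[<-|nj].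
    by rewrite divfK// subrr.
  by rewrite !nth_default ?mulr0 ?subrr// ?size_ultraspherical// (leq_trans sp).
exists (fun i => if i == n then c else a i).
rewrite big_ord_recr/= eqxx -[LHS](subrK (c *: C n)) e; congr (_ + _).
by apply: eq_bigr => i _; rewrite ltn_eqF.
Qed.

Lemma ultraspherical_orth_size n (q : {poly R}) : (size q <= n)%N -> L (C n * q) = 0.
Proof.
move=> /ultraspherical_basis[a ->]; rewrite mulr_sumr linear_sum big1// => i _.
by rewrite -scalerAr linearZ/= mulrC ultraspherical_orth ?scaler0.
Qed.

End orthogonality.

(** * Gauss quadrature at the zeros of an orthogonal polynomial *)

Lemma nuniq_perm (T : eqType) (r : seq T) : ~~ uniq r ->
  exists t r', perm_eq r (t :: t :: r').
Proof.
elim: r => //= x r IH; rewrite negb_and negbK.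
have [xr _|_ /IH[t [r' h]]] := boolP (x \in r).
  by exists x, (rem x r); rewrite perm_cons perm_to_rem.
exists t, (x :: r'); rewrite (perm_trans (_ : perm_eq _ (x :: t :: t :: r')))//.
  by rewrite perm_cons.
by rewrite -[x :: _]/([:: x] ++ [:: t; t] ++ r') perm_catCA.
Qed.

Section quadrature.
Variable R : rcfType.

Lemma split_roots (p : {poly R}) : p != 0 -> exists (r : seq R) (q : {poly R}),
  p = q * \prod_(t <- r) ('X - t%:P) /\ forall x, ~~ root q x.
Proof.
have [n] := ubnP (size p); elim: n p => // n IH p; rewrite ltnS => sp p0.
have [nr|/existsNP[x /negP/negPn px]] := pselect (forall x, ~~ root p x).
  by exists [::], p; rewrite big_nil mulr1.
have /factor_theorem[g pE] := px.
have g0 : g != 0 by apply: contraNneq p0 => g0; rewrite pE g0 mul0r.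
have [|r [q [gE qr]]] := IH g _ g0.
  by move: sp; rewrite pE mulrC size_monicM ?monicXsubC// size_XsubC.
by exists (x :: r), q; rewrite big_cons mulrCA -gE mulrC.
Qed.

Lemma noroot_sign (q : {poly R}) x y : (forall x, ~~ root q x) -> 0 < q.[x] * q.[y].
Proof.
move=> nr.
have h a b : a <= b -> 0 < q.[a] * q.[b].
  move=> ab; rewrite ltNge; apply/negP => h.
  have sg c : q.[c] * q.[b] <= 0 -> exists2 e, e \in [:: 1; -1] & e * q.[c] <= 0 <= e * q.[b].
    move=> c0; have [b0|b0] := leP 0 q.[b].
      exists 1; rewrite ?inE ?eqxx// !mul1r b0 andbT.
      by move: c0; rewrite pmulr_lle0// lt_neqAle b0 eq_sym andbT; exact: nr.
    exists (-1); rewrite ?inE ?eqxx ?orbT// !mulN1r oppr_le0 oppr_ge0 (ltW b0) andbT.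
    by move: c0; rewrite nmulr_lle0.
  have [e e1 eab] := sg a h.
  have [|z _] := @poly_ivt R (e *: q) a b ab; first by rewrite !hornerZ.
  rewrite rootE hornerZ mulf_eq0 => /orP[/eqP e0|]; last exact/negP/nr.
  by move: e1; rewrite e0 !inE eq_sym oner_eq0/= eq_sym oppr_eq0 oner_eq0.
by have [/h//|/ltW/h] := leP x y; rewrite mulrC.
Qed.

Variables (L : {linear {poly R} -> R^o}) (P : {poly R}).
Hypothesis L_gt0 : forall p : {poly R}, p != 0 ->
  (forall t, -1 <= t <= 1 -> 0 <= p.[t]) -> 0 < L p.
Hypothesis P0 : P != 0.
Hypothesis P_orth : forall q : {poly R}, (size q < size P)%N -> L (P * q) = 0.

Lemma orth_sqr_gt0 (q : {poly R}) : q != 0 -> 0 < L (q * q).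
Proof.
by move=> q0; apply: L_gt0 => [|t _]; rewrite ?mulf_neq0// hornerM -expr2 sqr_ge0.
Qed.

(** In each bad case (a nonconstant factor without roots, a root outside [-1, 1], a double root)
    dividing P by the offending factor, up to sign, leaves a polynomial of lower degree whose
    product with P is nonnegative on [-1, 1] and nonzero; this contradicts [P_orth]. *)
Lemma orth_roots : exists r : seq R, exists c : R,
  [/\ c != 0, uniq r, all (fun t => -1 <= t <= 1) r & P = c *: \prod_(t <- r) ('X - t%:P)].
Proof.
have [r [Q [PE Qr]]] := split_roots P0.
set D := \prod_(t <- r) _ in PE.
have Dm : D \is monic by exact: monic_prod_XsubC.
have D0 : D != 0 by exact: monic_neq0.
have Q0 : Q != 0 by apply: contraNneq P0 => Q0; rewrite PE Q0 mul0r.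
have sP : size P = (size Q + size r)%N.
  by rewrite PE mulrC size_monicM// size_prod_XsubC addSn/= addnC.
have sQ : size Q = 1%N.
  apply/eqP; rewrite eqn_leq size_poly_gt0 Q0 andbT leqNgt; apply/negP => sQ.
  have : 0 < L (P * (Q.[0] *: D)).
    apply: L_gt0 => [|t _].
      by rewrite mulf_neq0// scaler_eq0 negb_or D0 andbT; exact: Qr.
    rewrite PE hornerM hornerZ hornerM.
    have -> : Q.[t] * D.[t] * (Q.[0] * D.[t]) = (Q.[t] * Q.[0]) * D.[t] ^+ 2 by ring.
    by rewrite mulr_ge0 ?sqr_ge0// ltW// noroot_sign.
  rewrite P_orth ?ltxx// (leq_ltn_trans (size_scale_leq _ _))// size_prod_XsubC sP.
  by lia.
have rootr t : t \in r -> exists2 g : {poly R}, P = ('X - t%:P) * g & (size g < size P)%N.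
  move=> tr; have /factor_theorem[g PEg] : root P t by rewrite PE rootM root_prod_XsubC tr orbT.
  have gP : P = ('X - t%:P) * g by rewrite mulrC.
  exists g => //; rewrite gP size_monicM ?monicXsubC// ?size_XsubC//.
  by apply: contraNneq P0 => g0; rewrite gP g0 mulr0.
have in1 : all (fun t => -1 <= t <= 1) r.
  apply/allP => t tr; have [g Pg sg] := rootr t tr.
  have g0 : g != 0 by apply: contraNneq P0 => g0; rewrite Pg g0 mulr0.
  apply/negPn/negP; rewrite negb_and -!ltNge => tN.
  have [s s0 sE] : exists2 s : R, s != 0 & forall u, -1 <= u <= 1 -> 0 <= s * (u - t).
    case/orP: tN => h; [exists 1|exists (-1)]; rewrite ?oppr_eq0 ?oner_eq0// => u /andP[? ?]; lra.
  have : 0 < L (P * (s *: g)).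
    apply: L_gt0 => [|u u1]; first by rewrite mulf_neq0// scaler_eq0 negb_or s0 g0.
    rewrite Pg !hornerM hornerXsubC hornerZ.
    have -> : (u - t) * g.[u] * (s * g.[u]) = (s * (u - t)) * g.[u] ^+ 2 by ring.
    by rewrite mulr_ge0 ?sqr_ge0// sE.
  by rewrite P_orth ?ltxx// (leq_ltn_trans (size_scale_leq _ _)).
have [c c0 QE] := size_poly1P _ (introT eqP sQ).
exists r, c; split => //; last by rewrite PE QE mul_polyC.
apply/negPn/negP => /nuniq_perm[t [r' rE]].
pose g := Q * \prod_(t <- r') ('X - t%:P).
have gP : P = ('X - t%:P) * (('X - t%:P) * g).
  by rewrite PE /D (perm_big _ rE)/= !big_cons /g; ring.
have g0 : g != 0 by apply: contraNneq P0 => g0; rewrite gP g0 !mulr0.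
have : 0 < L (P * g).
  have -> : P * g = (('X - t%:P) * g) * (('X - t%:P) * g) by rewrite gP; ring.
  by apply: orth_sqr_gt0; rewrite mulf_neq0// polyXsubC_eq0.
have sg : (size g < size P)%N.
  have h0 : ('X - t%:P) * g != 0 by rewrite mulf_neq0// polyXsubC_eq0.
  rewrite gP (size_monicM (monicXsubC t) h0) (size_monicM (monicXsubC t) g0) size_XsubC; exact: leqnSn.
by rewrite P_orth ?ltxx.
Qed.

(** Exactness below the degree of P is Lagrange interpolation at its roots. Orthogonality serves for
    the sign of the weights L(l_t) / l_t(t), which equal L(l_t^2) / l_t(t)^2. *)
Lemma gauss_quadrature : exists r : seq (R * R),
  [/\ all (fun p => 0 <= p.1) r, all (fun p => -1 <= p.2 <= 1) r &
      forall p : {poly R}, (size p < size P)%N -> L p = \sum_(z <- r) z.1 * p.[z.2]].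
Proof.
have [r [c [c0 ur r1 PE]]] := orth_roots.
pose l t := \prod_(s <- rem t r) ('X - s%:P) : {poly R}.
have lt t : t \in r -> (l t).[t] != 0.
  move=> tr; rewrite -[_ == _]/(root (l t) t) root_prod_XsubC.
  by rewrite mem_rem_uniq// inE eqxx.
have lPt t : t \in r -> P = c *: (('X - t%:P) * l t).
  by move=> tr; rewrite PE (perm_big _ (perm_to_rem tr)) big_cons.
have sP : size P = (size r).+1 by rewrite PE size_scale// size_prod_XsubC.
have sl t : t \in r -> size (l t) = size r.
  by move=> tr; rewrite size_prod_XsubC (perm_size (perm_to_rem tr)).
pose w t : R := L (l t) / (l t).[t].
exists [seq (w t, t) | t <- r]; split.
- apply/allP => _ /mapP[t tr ->]/=.
  have [d dE] : exists d : {poly R}, l t - (l t).[t]%:P = d * ('X - t%:P).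
    by apply/factor_theorem; rewrite rootE hornerD hornerN hornerC subrr.
  have sd : (size d < size P)%N.
    have [->|d0] := eqVneq d 0; first by rewrite size_poly0 size_poly_gt0.
    have : (size (d * ('X - t%:P))%R <= size r)%N.
      rewrite -dE (leq_trans (size_polyD _ _))// geq_max sl// leqnn size_polyN.
      by rewrite (leq_trans (size_polyC_leq1 _))//; case: (r) tr.
    by rewrite mulrC size_monicM ?monicXsubC// size_XsubC sP; exact: leqW.
  (* Up to the factor c, l_t^2 - l_t(t) l_t is P d with d of lower degree than P. *)
  have e : L (l t * l t) = (l t).[t] * L (l t).
    have : L (P * d) = 0 by exact: P_orth.
    have -> : P * d = c *: (l t * l t) - (c * (l t).[t]) *: l t.
      rewrite (lPt t tr) -!mul_polyC polyCM.
      transitivity (c%:P * (l t * (d * ('X - t%:P)))); first by ring.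
      by rewrite -dE; ring.
    rewrite linearB !linearZ/= /GRing.scale/= => h; apply: (mulfI c0).
    by apply/eqP; rewrite -subr_eq0 -[X in _ == X]h; apply/eqP; ring.
  have -> : w t = L (l t * l t) / (l t).[t] ^+ 2 by rewrite e /w; field; exact: lt.
  rewrite divr_ge0 ?sqr_ge0// ltW// orth_sqr_gt0//.
  by apply: contraNneq (lt t tr) => ->; rewrite horner0.
- by apply/allP => _ /mapP[t tr ->]/=; exact: (allP r1).
move=> p sp; rewrite big_map/=.
have pE : p = \sum_(t <- r) (p.[t] / (l t).[t]) *: l t.
  apply/eqP; rewrite -subr_eq0; apply/eqP.
  apply: (@roots_geq_poly_eq0 _ _ r) => //.
    apply/allP => s sr; rewrite rootE hornerD hornerN horner_sum.
    rewrite (bigD1_seq s)//= hornerZ divfK ?lt// big1_seq ?addr0 ?subrr//.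
    move=> t /andP[ts tr]; rewrite hornerZ.
    have /eqP-> : root (l t) s by rewrite root_prod_XsubC mem_rem_uniq// inE eq_sym ts.
    by rewrite mulr0.
  rewrite (leq_trans (size_polyD _ _))// geq_max size_polyN -ltnS -sP sp/=.
  rewrite (leq_trans (size_sum _ _ _))//; apply/bigmax_leqP_seq => t tr _.
  by rewrite (leq_trans (size_scale_leq _ _))// sl.
rewrite {1}pE linear_sum; apply: eq_big_seq => t tr; rewrite linearZ/= /GRing.scale/=.
by rewrite -mulrA mulrC [X in X * _]mulrC.
Qed.
End quadrature.

(** * Moments of the sphere, and cubature by slicing *)

Lemma horner_ext (R : realFieldType) (p q : {poly R}) : (forall x, p.[x] = q.[x]) -> p = q.
Proof.
move=> e; apply/eqP; rewrite -subr_eq0; apply/eqP.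
apply: (@roots_geq_poly_eq0 _ _ [seq i%:R | i <- iota 0 (size (p - q))]).
- by apply/allP => x _; rewrite rootE hornerD hornerN e subrr.
- by rewrite map_inj_uniq ?iota_uniq// => i j /eqP; rewrite eqr_nat => /eqP.
- by rewrite size_map size_iota.
Qed.

Lemma sum_even_ord (V : nmodType) n (F : nat -> V) : (forall j, odd j -> F j = 0) ->
  \sum_(j < n.*2.+1) F j = \sum_(i < n.+1) F i.*2.
Proof.
move=> F0; elim: n => [|n IH]; first by rewrite !big_ord1.
by rewrite doubleS 2!big_ord_recr/= IH [in RHS]big_ord_recr/= F0 ?addr0//= odd_double.
Qed.

(** The mean of the k-th power of a coordinate over the unit sphere of R^d; for k = 2i it is 1 3 ...
    (2i - 1) / (d (d + 2) ... (d + 2i - 2)). *)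
Definition sphere_moment (R : fieldType) (d k : nat) : R :=
  if odd k then 0 else \prod_(j < k./2) (j.*2.+1%:R / (j.*2 + d)%:R).

Definition dot (R : pzSemiRingType) d (x y : 'rV[R]_d) : R := \sum_(i < d) x 0 i * y 0 i.

Section dot.
Variables (R : comPzRingType) (d : nat).
Implicit Types x y z : 'rV[R]_d.

Lemma dotC x y : dot x y = dot y x.
Proof. by apply: eq_bigr => i _; rewrite mulrC. Qed.

Lemma dotDl x y z : dot (x + y) z = dot x z + dot y z.
Proof. by rewrite -big_split; apply: eq_bigr => i _; rewrite !mxE mulrDl. Qed.

Lemma dotZl a x z : dot (a *: x) z = a * dot x z.
Proof. by rewrite mulr_sumr; apply: eq_bigr => i _; rewrite !mxE mulrA. Qed.

End dot.

Section moments.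
Variables (R : realFieldType) (m : nat) (L : {linear {poly R} -> R^o}).
Hypothesis m1 : (0 < m)%N.
Hypothesis L1 : L 1 = 1.
Hypothesis LX : forall q, m%:R * L ('X * q) = L ((1 - 'X^2) * q^`()).

Let W a i : {poly R} := 'X^a * (1 - 'X^2) ^+ i.

Let W_rec a i : (i.*2 + m)%:R * L (W a.+2 i) = a.+1%:R * L (W a i.+1).
Proof.
have := LX (W a.+1 i).
have -> : (W a.+1 i)^`() = a.+1%:R%:P * W a i - (i.*2)%:R%:P * W a.+2 i.-1.
  rewrite /W derivM !(deriv_exp, derivB, derivC, derivX)/= sub0r expr1.
  rewrite !polyC_natr -muln2 natrM !exprSr expr0.
  rewrite -mulr_natr -[_ *+ i]mulr_natr.
  have h (x u v w p q : {poly R}) : 1 * u * p * w + u * x * (1 * x *- 2 * v * q) =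
    p * (u * w) - q * 2 * (u * x * x * v) by ring.
  exact: h.
have -> : (1 - 'X^2) * (a.+1%:R%:P * W a i - (i.*2)%:R%:P * W a.+2 i.-1) =
    a.+1%:R *: W a i.+1 - (i.*2)%:R *: W a.+2 i.
  rewrite -!mul_polyC /W; case: i => [|i]; rewrite ?double0 ?mul0r ?subr0 /=.
    rewrite expr0 expr1.
    have h (x u p : {poly R}) : x * (p * (u * 1)) = p * (u * x) by ring.
    exact: h.
  rewrite [_ ^+ i.+2]exprS [_ ^+ i.+1]exprS.
  have h (x u v w p q : {poly R}) : x * (p * (u * (x * w)) - q * (v * w)) =
    p * (u * (x * (x * w))) - q * (v * (x * w)) by ring.
  exact: h.
rewrite mulrA -exprS -/(W a.+2 i) !linearB !linearZ/= /GRing.scale/= => e.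
by rewrite natrD mulrDl e; ring.
Qed.

Let W_odd a i : odd a -> L (W a i) = 0.
Proof.
elim: i a => [|i IH] a oa.
  rewrite /W expr0 mulr1; elim/nat_ind2: a oa => // [_|n IH _]/=.
    have := LX 1; rewrite derivC mulr0 linear0 mulr1 => /eqP.
    by rewrite mulf_eq0 pnatr_eq0 -leqn0 leqNgt m1/= => /eqP.
  rewrite negbK => /IH h.
  have := W_rec n 0; rewrite /W expr0 expr1 mulr1 mulrBr mulr1 -exprD addn2 linearB/= h sub0r add0n.
  move=> e; have : (m + n.+1)%:R * L 'X^(n.+2) = 0 :> R by rewrite natrD mulrDl e; ring.
  by move/eqP; rewrite mulf_eq0 pnatr_eq0 addnS/= => /eqP.
have := W_rec a i; rewrite IH ?mulr0; last by rewrite /= negbK.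
by move/esym/eqP; rewrite mulf_eq0 pnatr_eq0/= => /eqP.
Qed.

Let LXn n : L 'X^n = sphere_moment R m.+1 n.
Proof.
rewrite /sphere_moment; case: ifPn => [on|].
  by have := W_odd 0 on; rewrite /W expr0 mulr1.
rewrite -[in X in _ -> X](odd_double_half n) => /negbTE->; rewrite add0n doubleK.
elim: n./2 => [|j IH]; first by rewrite big_ord0 expr0.
rewrite doubleS big_ord_recr -IH.
have := W_rec j.*2 0; rewrite /W expr0 expr1 mulr1 mulrBr mulr1 -exprD addn2 linearB/= add0n => e.
have h : (j.*2 + m.+1)%:R != 0 :> R by rewrite pnatr_eq0 addnS.
have hE (a b c : R) : a != 0 -> a * (b * (c / a)) = b * c by move=> ?; field.
apply: (mulfI h); rewrite [RHS]hE//.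
by rewrite -addSnnS natrD mulrDl e; ring.
Qed.

(** Induction on i with b free: [W_rec] trades a factor 1 - X^2 for X^2, keeping b + i fixed, and
    the rest is a comparison of binomial coefficients. *)
Let W_even b i : 'C((b + i).*2, i.*2)%:R * L (W b.*2 i) * sphere_moment R m i.*2 =
  'C(b + i, i)%:R * sphere_moment R m.+1 (b + i).*2.
Proof.
elim: i b => [|i IH] b.
  by rewrite addn0 !bin0 /W expr0 mulr1 LXn /sphere_moment/= big_ord0 mulr1.
have := IH b.+1; rewrite addSnnS; set n := (b + i.+1)%N => e.
have momS : sphere_moment R m i.+1.*2 = sphere_moment R m i.*2 * (i.*2.+1%:R / (i.*2 + m)%:R).
  by rewrite /sphere_moment !odd_double !doubleK big_ord_recr.
have im : (i.*2 + m)%:R != 0 :> R by rewrite pnatr_eq0 -lt0n addn_gt0 m1 orbT.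
have b1 : b.*2.+1%:R != 0 :> R by rewrite pnatr_eq0.
have i2 : i.*2.+2%:R != 0 :> R by rewrite pnatr_eq0.
have i1 : i.+1%:R != 0 :> R by rewrite pnatr_eq0.
have b1' : b.+1%:R != 0 :> R by rewrite pnatr_eq0.
have WE : L (W b.*2 i.+1) = (i.*2 + m)%:R / b.*2.+1%:R * L (W b.+1.*2 i).
  by rewrite doubleS; have := W_rec b.*2 i; move/(congr1 (fun x => x / b.*2.+1%:R)) => h; rewrite mulrAC h mulrC mulKf.
have B1 : 'C(n.*2, i.+1.*2)%:R * (i.*2.+2%:R * i.*2.+1%:R) = 'C(n.*2, i.*2)%:R * (b.*2.+2%:R * b.*2.+1%:R) :> R.
  rewrite -!natrM; congr (_%:R).
  have h1 := mul_bin_left n.*2 i.*2.+1; have h2 := mul_bin_left n.*2 i.*2.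
  have e1 : (n.*2 - i.*2.+1 = b.*2.+1)%N by rewrite /n; lia.
  have e2 : (n.*2 - i.*2 = b.*2.+2)%N by rewrite /n; lia.
  rewrite e1 in h1; rewrite e2 in h2.
  by rewrite doubleS mulnA [(_ * i.*2.+2)%N]mulnC h1 -mulnA [(_ * i.*2.+1)%N]mulnC h2; ring.
have B2 : 'C(n, i.+1)%:R * i.+1%:R = 'C(n, i)%:R * b.+1%:R :> R.
  rewrite -!natrM mulnC mul_bin_left mulnC; congr ((_ * _)%:R).
  by rewrite /n; lia.
rewrite momS WE.
apply: (mulIf i1); rewrite [RHS]mulrAC B2 [RHS]mulrAC -e.
have -> : 'C(n.*2, i.+1.*2)%:R = 'C(n.*2, i.*2)%:R * (b.*2.+2%:R * b.*2.+1%:R) / (i.*2.+2%:R * i.*2.+1%:R) :> R.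
  by rewrite -B1 mulfK// mulf_neq0// pnatr_eq0.
have -> : i.*2.+2%:R = 2 * i.+1%:R :> R by rewrite -doubleS -mul2n natrM.
have -> : b.*2.+2%:R = 2 * b.+1%:R :> R by rewrite -doubleS -mul2n natrM.
have hF (c u p q r s l y : R) : p != 0 -> q != 0 -> r != 0 -> s != 0 ->
  c * (2 * u * p) / (2 * q * r) * (s / p * l) * (y * (r / s)) * q = c * l * y * u.
  by move=> p0 q0 r0 s0; field; rewrite ?p0 ?q0 ?r0 ?s0 ?pnatr_eq0.
by apply: hF => //; rewrite pnatr_eq0.

Qed.

(** This matches the terms of degree 2i in the coordinates other than the first when (a^2 + c)^n, n
    = b + i, is compared with the slicewise mean of a 2n-th power in [cubatureS]. *)
Lemma moment_even b i :
  'C((b + i).*2, i.*2)%:R * L ('X^(b.*2) * (1 - 'X^2) ^+ i) * sphere_moment R m i.*2 =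
  'C(b + i, i)%:R * sphere_moment R m.+1 (b + i).*2.
Proof. exact: W_even. Qed.

Lemma moment_odd a i : odd a -> L ('X^a * (1 - 'X^2) ^+ i) = 0.
Proof. exact: W_odd. Qed.

Lemma momentE n : L 'X^n = sphere_moment R m.+1 n.
Proof. exact: LXn. Qed.

End moments.

(* A positive finitely supported measure on the unit sphere of R^d which agrees with
   the normalized surface measure on polynomials of degree at most N. *)
Definition cubature (R : realFieldType) d N (s : seq (R * 'rV[R]_d)) : Prop :=
  [/\ all (fun p => 0 <= p.1) s, all (fun p => dot p.2 p.2 == 1) s &
      forall k (x : 'rV[R]_d), (k <= N)%N ->
        \sum_(p <- s) p.1 * dot x p.2 ^+ k = sphere_moment R d k * dot x x ^+ k./2].

Section cubature_exists.
Variables (R : rcfType).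

Lemma cubature1 N : exists s : seq (R * 'rV[R]_1), cubature N s.
Proof.
exists [:: (2^-1, 1); (2^-1, -1)]; split.
- by rewrite /= invr_ge0 ler0n.
- by rewrite /= /dot !big_ord1 !mxE/= mulr1 mulrNN mulr1 eqxx.
move=> k x _; rewrite !big_cons big_nil/= /dot !big_ord1 !mxE/= mulr1 mulrN1 addr0.
rewrite /sphere_moment; have [ok|ek] := boolP (odd k).
  by rewrite exprNn -signr_odd ok expr1 mul0r; ring.
rewrite exprNn -signr_odd (negbTE ek) expr0 mul1r -mulrDl [X in _ = X * _]big1.
  rewrite mul1r -expr2 -exprM mul2n -[in LHS](odd_double_half k) (negbTE ek) add0n.
  by rewrite (_ : 2^-1 + _ = 1) ?mul1r//; field.
by move=> j _; rewrite addn1 divff// pnatr_eq0.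
Qed.

Definition sphere_point d (t : R) (z : 'rV[R]_d) : 'rV[R]_d.+1 :=
  \row_j (if unlift ord0 j is Some i then Num.sqrt (1 - t ^+ 2) * z 0 i else t).

Lemma dot_sphere_point d x t z : dot x (@sphere_point d t z) =
  x 0 ord0 * t + Num.sqrt (1 - t ^+ 2) * dot (\row_i x 0 (lift ord0 i)) z.
Proof.
rewrite /dot big_ord_recl mxE unlift_none mulr_sumr; congr (_ + _).
by apply: eq_bigr => i _; rewrite !mxE liftK mulrCA.
Qed.

(** The first coordinate is sampled by the quadrature r and the slice at height t, a sphere of
    radius sqrt(1 - t^2), by s. In the binomial expansion of the k-th power, odd powers of the
    square root meet odd moments, which vanish, so only polynomials in t reach the quadrature. *)
Lemma cubatureS d N (L : {linear {poly R} -> R^o}) (r : seq (R * R)) s :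
  (0 < d)%N -> L 1 = 1 -> (forall q, d%:R * L ('X * q) = L ((1 - 'X^2) * q^`())) ->
  all (fun p => 0 <= p.1) r -> all (fun p => -1 <= p.2 <= 1) r ->
  (forall p : {poly R}, (size p <= N.+1)%N -> L p = \sum_(z <- r) z.1 * p.[z.2]) ->
  @cubature R d N s ->
  cubature N [seq (u.1 * v.1, sphere_point u.2 v.2) | u <- r, v <- s].
Proof.
move=> d0 L1 LX r0 r1 rL [s0 s1 sk].
have sq t : -1 <= t <= 1 -> Num.sqrt (1 - t ^+ 2) ^+ 2 = 1 - t ^+ 2.
  by move=> t1; rewrite sqr_sqrtr// expr2; case/andP: t1 => ? ?; nra.
split.
- apply/allP => _ /allpairsP[[u v]/= [ur vs ->]]/=.
  by rewrite mulr_ge0// ?(allP r0)// (allP s0).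
- apply/allP => _ /allpairsP[[u v]/= [ur vs ->]]/=.
  rewrite dot_sphere_point mxE unlift_none.
  rewrite (_ : \row_i _ = Num.sqrt (1 - u.2 ^+ 2) *: v.2); last first.
    by apply/rowP => i; rewrite !mxE liftK.
  rewrite dotZl (eqP (allP s1 _ vs)) mulr1 -[_ * Num.sqrt _]expr2 sq; last exact: (allP r1).
  by rewrite expr2 addrC subrK.
move=> k x kN; rewrite big_allpairs_dep/=.
set x' := \row_i x 0 (lift ord0 i); set a := x 0 ord0; set c := dot x' x'.
have xx : dot x x = a ^+ 2 + c.
  rewrite /dot big_ord_recl expr2; congr (_ + _).
  by apply: eq_bigr => i _; rewrite !mxE.
(* The j-th binomial term, once the sum over the slice has been evaluated by [sk]. *)
pose F j := (a ^+ (k - j) * sphere_moment R d j * c ^+ j./2) *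
  (\sum_(u <- r) u.1 * (u.2 ^+ (k - j) * Num.sqrt (1 - u.2 ^+ 2) ^+ j)) *+ 'C(k, j).
transitivity (\sum_(j < k.+1) F j).
  under eq_big_seq => u ur.
    under eq_bigr => v _ do rewrite dot_sphere_point exprDn mulr_sumr.
    rewrite exchange_big/=.
    under eq_bigr => j _.
      under eq_bigr => v _.
        rewrite mulrnAr -/a -/x' !exprMn.
        have h (b v1 d1 e f g : R) : b * v1 * (d1 * e * (f * g)) = (d1 * (b * (e * f))) * (v1 * g) by ring.
        rewrite h; over.
      rewrite sumrMnl -mulr_sumr sk -/c; last by rewrite (leq_trans _ kN)// -ltnS.
      over.
    over.
  rewrite exchange_big/=; apply: eq_bigr => j _; rewrite /F.
  rewrite sumrMnl mulr_sumr; congr (_ *+ _); apply: eq_bigr => u _; ring.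
have Fodd j : odd j -> F j = 0.
  by move=> oj; rewrite /F /sphere_moment oj mulr0 !mul0r mul0rn.
have FE i : (i.*2 <= k)%N -> F i.*2 = a ^+ (k - i.*2) * c ^+ i *
    ('C(k, i.*2)%:R * L ('X^(k - i.*2) * (1 - 'X^2) ^+ i) * sphere_moment R d i.*2).
  move=> ik; rewrite /F rL; last first.
    rewrite (leq_trans (size_polyMleq _ _))// size_polyXn/=.
    rewrite (leq_trans (leq_add (leqnn _) (size_poly_exp_leq _ _)))//.
    have : (size (1 - 'X^2 : {poly R})%R <= 3)%N.
      by rewrite (leq_trans (size_polyD _ _))// geq_max size_poly1 size_polyN size_polyXn.
    by nia.
  rewrite doubleK -mulr_natr.
  have -> : \sum_(z <- r) z.1 * ('X^(k - i.*2) * (1 - 'X^2) ^+ i).[z.2] =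
    \sum_(u <- r) u.1 * (u.2 ^+ (k - i.*2) * Num.sqrt (1 - u.2 ^+ 2) ^+ i.*2).
    apply: eq_big_seq => z zr; rewrite hornerM hornerXn horner_exp hornerD hornerN hornerC hornerXn.
    by rewrite -mul2n exprM sq//; exact: (allP r1).
  by ring.
have [ok|ek] := boolP (odd k).
  rewrite [in RHS]/sphere_moment ok mul0r big1// => j _.
  have [oj|ej] := boolP (odd j); first exact: Fodd.
  rewrite -(odd_double_half j) (negbTE ej) add0n FE; last first.
    by rewrite -[in X in (_ <= X)%N](odd_double_half k) ok; have := ltn_ord j; lia.
  rewrite (moment_odd d0 LX) ?mulr0 ?mul0r ?mulr0//.
  by rewrite oddB ?odd_double ?ok//; have := ltn_ord j; lia.
have kE : k = k./2.*2 by rewrite -[LHS]odd_double_half (negbTE ek).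
rewrite [in LHS]kE sum_even_ord; last exact: Fodd.
rewrite xx exprDn mulr_sumr; apply: eq_bigr => i _.
have ik : (i <= k./2)%N by rewrite -ltnS.
rewrite FE; last by lia.
have -> : (k - i.*2 = (k./2 - i).*2)%N by rewrite {1}kE doubleB.
have := moment_even d0 L1 LX (k./2 - i) i; rewrite subnK// -kE => ->.
by rewrite -mulr_natr -mul2n exprM; ring.
Qed.

End cubature_exists.

(** * Means of products of zonal polynomials *)

(** For unit vectors x and y with c = <x, y>, 1 + 2 c t + t^2 is the squared norm of x + t y; the
    degree bound in c is what makes means of zonal products polynomials in <x, y>. *)
Lemma trinomial_coef (R : idomainType) m : exists g : nat -> {poly R},
  forall b, (size (g b) <= b.+1)%N /\
    forall c : R, ((1 + (2 * c) *: 'X + 'X^2) ^+ m)`_b = (g b).[c].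
Proof.
elim: m => [|m [g gE]].
  exists (fun b => (b == 0%N)%:R%:P) => b; split.
    by rewrite (leq_trans (size_polyC_leq1 _)).
  by move=> c; rewrite expr0 coef1 hornerC.
exists (fun b => g b + (if b is b'.+1 then 2 *: ('X * g b') else 0) +
                 (if b is b'.+2 then g b' else 0)) => b; split.
  rewrite (leq_trans (size_polyD _ _))// geq_max; apply/andP; split; last first.
    case: b => [|[|b]]; rewrite ?size_poly0// (leq_trans (gE b).1)//.
    by rewrite ltnS ltnW// ltnS leqnSn.
  rewrite (leq_trans (size_polyD _ _))// geq_max (gE b).1/=.
  case: b => [|b]; rewrite ?size_poly0// (leq_trans (size_scale_leq _ _))//.
  by rewrite (leq_trans (size_polyMleq _ _))// size_polyX; exact: (gE b).1.
move=> c; set P := (_ ^+ m.+1); pose Q := (1 + (2 * c) *: 'X + 'X^2) ^+ m.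
have QE i : Q`_i = (g i).[c] := (gE i).2 c.
have -> : P = Q + (2 * c) *: ('X * Q) + 'X^2 * Q.
  by rewrite /P exprS -/Q mulrDl mulrDl mul1r -scalerAl.
rewrite !coefD coefZ coefXM coefXnM !QE !hornerD; congr (_ + _ + _).
  by case: b => [|b] /=; rewrite ?horner0 ?mulr0// hornerZ hornerM hornerX mulrA.
by case: b => [|[|b]] /=; rewrite ?horner0// subSS subSS subn0.
Qed.

Section funk_hecke.
Variables (R : realFieldType) (d N : nat) (s : seq (R * 'rV[R]_d)).
Hypothesis cub : cubature N s.

Let s1 p : p \in s -> dot p.2 p.2 = 1.
Proof. by case: cub => _ s1 _ ps; apply/eqP/(allP s1). Qed.

(** Apply the cubature to the power a + b of <x + t y, .> and compare the coefficients of t^b: the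
    left side is the wanted mean times a binomial coefficient, the right side is given by
    [trinomial_coef]. *)
Lemma cubature_monomial a b : (a + b <= N)%N -> exists T : {poly R},
  (size T <= b.+1)%N /\ forall x y, dot x x = 1 -> dot y y = 1 ->
    \sum_(p <- s) p.1 * (dot x p.2 ^+ a * dot y p.2 ^+ b) = T.[dot x y].
Proof.
move=> abN; set k := (a + b)%N.
have [g gE] := trinomial_coef R k./2.
exists ((sphere_moment R d k / 'C(k, b)%:R) *: g b); split.
  by rewrite (leq_trans (size_scale_leq _ _))// (gE b).1.
move=> x y x1 y1; rewrite hornerZ -(gE b).2.
pose A : {poly R} := \sum_(p <- s) p.1 *: (((dot x p.2)%:P + dot y p.2 *: 'X) ^+ k).
have AE : A = sphere_moment R d k *: (1 + (2 * dot x y) *: 'X + 'X^2) ^+ k./2.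
  apply: horner_ext => t; rewrite /A horner_sum hornerZ horner_exp !hornerD !hornerZ hornerX hornerXn hornerC.
  case: cub => _ _ /(_ k (x + t *: y) abN).
  have -> : dot (x + t *: y) (x + t *: y) = 1 + 2 * dot x y * t + t ^+ 2.
    by rewrite dotDl ![dot _ (_ + _)]dotC !dotDl !dotZl ![dot _ (_ *: _)]dotC !dotZl x1 y1 (dotC y); ring.
  move=> <-; apply: eq_bigr => p _.
  by rewrite hornerZ horner_exp hornerD hornerC hornerZ hornerX dotDl dotZl [t * _]mulrC.
have := congr1 (fun p : {poly R} => p`_b) AE; rewrite coefZ => AEb.
have C0 : 'C(k, b)%:R != 0 :> R by rewrite pnatr_eq0 -lt0n bin_gt0 leq_addl.
rewrite mulrAC -AEb; apply: (mulIf C0); rewrite divfK//.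
rewrite /A coef_sum mulr_suml; apply: eq_bigr => p _; rewrite coefZ exprDn coef_sum.
have bk : (b < k.+1)%N by rewrite ltnS leq_addl.
rewrite (bigD1 (Ordinal bk))//= big1 ?addr0.
  rewrite -rmorphXn coefMn mul_polyC exprZn coefZ coefZ coefXn eqxx mulr1 addnK.
  by rewrite -mulr_natr; ring.
move=> j; rewrite -val_eqE/= => jb.
by rewrite -rmorphXn coefMn mul_polyC exprZn coefZ coefZ coefXn eq_sym (negbTE jb) !mulr0 mul0rn.
Qed.

Lemma cubature_zonal2 (p q : {poly R}) : (size p + size q <= N)%N -> exists T : {poly R},
  (size T <= size q)%N /\ forall x y, dot x x = 1 -> dot y y = 1 ->
    \sum_(z <- s) z.1 * (p.[dot x z.2] * q.[dot y z.2]) = T.[dot x y].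
Proof.
move=> pqN.
have /boolp.choice[T TE] (i : 'I_(size p) * 'I_(size q)) : exists T : {poly R},
  (size T <= i.2.+1)%N /\ forall x y, dot x x = 1 -> dot y y = 1 ->
    \sum_(p <- s) p.1 * (dot x p.2 ^+ i.1 * dot y p.2 ^+ i.2) = T.[dot x y].
  apply: cubature_monomial; rewrite (leq_trans _ pqN)// leq_add// ltnW//.
exists (\sum_(i : 'I_(size p) * 'I_(size q)) (p`_i.1 * q`_i.2) *: T i); split.
  rewrite (leq_trans (size_sum _ _ _))//; apply/bigmax_leqP => i _.
  by rewrite (leq_trans (size_scale_leq _ _))// (leq_trans (TE i).1).
move=> x y x1 y1; rewrite horner_sum.
under [RHS]eq_bigr => i _ do rewrite hornerZ -(TE i).2// mulr_sumr.
rewrite exchange_big/=; apply: eq_bigr => z _.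
rewrite !horner_coef big_distrlr/= pair_big/= mulr_sumr.
by apply: eq_bigr => i _; ring.
Qed.

Lemma cubature_zonal (L : {linear {poly R} -> R^o}) (p : {poly R}) x :
  (forall n, L 'X^n = sphere_moment R d n) -> (size p <= N.+1)%N -> dot x x = 1 ->
  \sum_(z <- s) z.1 * p.[dot x z.2] = L p.
Proof.
move=> LX pN x1; rewrite -{2}[p]coefK poly_def linear_sum/=.
under eq_bigr do rewrite horner_coef mulr_sumr.
rewrite exchange_big/=; apply: eq_bigr => i _; rewrite linearZ/= LX.
case: cub => _ _ /(_ i x); rewrite x1 expr1n mulr1 => <-; last first.
  by rewrite -ltnS (leq_trans (ltn_ord i)).
by rewrite /GRing.scale/= mulr_sumr; apply: eq_bigr => z _; ring.
Qed.

Variable L : {linear {poly R} -> R^o}.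
Hypothesis d0 : (0 < d)%N.
Hypothesis LXn : forall n, L 'X^n = sphere_moment R d n.
Hypothesis LX : forall q, d.-1%:R * L ('X * q) = L ((1 - 'X^2) * q^`()).
Hypothesis d1 : (1 < d)%N.
Hypothesis L_gt0 : forall p : {poly R}, p != 0 ->
  (forall t, -1 <= t <= 1 -> 0 <= p.[t]) -> 0 < L p.
Local Notation C := (ultraspherical (d%:R - 2 : R)).

Let k0 : 0 <= d%:R - 2 :> R. Proof. by rewrite subr_ge0 ler_nat. Qed.

Let LX' q : (1 + (d%:R - 2)) * L ('X * q) = L ((1 - 'X^2) * q^`()).
Proof.
rewrite -LX; congr (_ * _).
by rewrite -[in LHS](prednK d0) -natr1; ring.
Qed.

Let sqr0 (p : {poly R}) : L (p * p) = 0 -> p = 0.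
Proof.
move=> e; apply/eqP/negPn/negP => p0.
have : 0 < L (p * p) by apply: L_gt0 => [|t _]; rewrite ?mulf_neq0// hornerM -expr2 sqr_ge0.
by rewrite e ltxx.
Qed.

(** The sum is T(<x, y>) for a polynomial T of degree below n. Writing L(T^2) as a double sum and
    exchanging the sums turns it into L(C_n T') with T' of degree below n, which is 0 by
    orthogonality; hence T = 0 by definiteness of L. *)
Lemma funk_hecke_lt n (q : {poly R}) x y : (4 * n.+1 <= N)%N -> (size q <= n)%N ->
  dot x x = 1 -> dot y y = 1 ->
  \sum_(z <- s) z.1 * ((C n).[dot x z.2] * q.[dot y z.2]) = 0.
Proof.
move=> nN qn x1 y1.
have sC := size_ultraspherical k0 n.
have [|T [sT TE]] := @cubature_zonal2 (C n) q; first by rewrite sC; lia.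
have [|T' [sT' TE']] := @cubature_zonal2 q T; first by lia.
rewrite TE// (_ : T = 0) ?horner0//; apply: sqr0.
rewrite -(@cubature_zonal _ _ x)//; last first.
  by rewrite (leq_trans (size_polyMleq _ _))//; lia.
have -> : \sum_(z <- s) z.1 * (T * T).[dot x z.2] =
   \sum_(z <- s) z.1 * ((C n).[dot x z.2] * T'.[dot x z.2]).
  transitivity (\sum_(z <- s) \sum_(u <- s) z.1 * (u.1 * ((C n).[dot x u.2] * q.[dot z.2 u.2])) * T.[dot x z.2]).
    apply: eq_big_seq => z zs; rewrite hornerM -{1}TE ?s1// mulrA mulr_sumr mulr_suml.
    by apply: eq_bigr => u _; ring.
  rewrite exchange_big/=; apply: eq_big_seq => u us.
  have := TE' u.2 x (s1 us) x1; rewrite [dot u.2 x]dotC => <-.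
  rewrite !mulr_sumr; apply: eq_bigr => z _.
  by rewrite [dot z.2 u.2]dotC; ring.
have -> : \sum_(z <- s) z.1 * ((C n).[dot x z.2] * T'.[dot x z.2]) =
   \sum_(z <- s) z.1 * (C n * T').[dot x z.2] by apply: eq_bigr => z _; rewrite hornerM.
rewrite (@cubature_zonal L)//; last by rewrite (leq_trans (size_polyMleq _ _))// sC; lia.
by rewrite (ultraspherical_orth_size k0 LX')//; lia.
Qed.

(* Reproducing property of the zonal harmonics. *)
Lemma funk_hecke n x y : (4 * n.+1 <= N)%N -> dot x x = 1 -> dot y y = 1 ->
  \sum_(z <- s) z.1 * ((C n).[dot x z.2] * (C n).[dot y z.2]) =
  L (C n * C n) * (C n).[dot x y].
Proof.
move=> nN x1 y1.
have sC := size_ultraspherical k0 n.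
have [|T [sT TE]] := @cubature_zonal2 (C n) (C n); first by rewrite sC; lia.
have lC : (C n)`_n != 0.
  by have := ultraspherical_neq0 k0 n; rewrite -lead_coef_eq0 lead_coefE sC.
pose a := T`_n / (C n)`_n; pose r := T - a *: C n.
have sr : (size r <= n)%N.
  apply/leq_sizeP => j nj; rewrite coefB coefZ; move: nj; rewrite leq_eqVlt => /predU1P[<-|nj].
    by rewrite divfK// subrr.
  have Cj : (size (C n) <= j)%N by rewrite sC.
  by rewrite (nth_default 0 Cj) (nth_default 0 (leq_trans sT Cj)) mulr0 subrr.
(* r is T minus the multiple of C_n that cancels its top coefficient. Orthogonality gives L(r^2) =
   L(T r), and exchanging sums reduces this to [funk_hecke_lt] with q = r. *)
have r0 : r = 0.
  apply: sqr0.
  have -> : L (r * r) = L (T * r).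
    rewrite {1}/r mulrBl linearB/= -scalerAl linearZ/= (ultraspherical_orth_size k0 LX')//.
    by rewrite scaler0 subr0.
  rewrite -(@cubature_zonal _ _ x)//; last first.
    by rewrite (leq_trans (size_polyMleq _ _))//; rewrite sC in sT; lia.
  transitivity (\sum_(z <- s) \sum_(u <- s) z.1 * (u.1 * ((C n).[dot x u.2] * (C n).[dot z.2 u.2])) * r.[dot x z.2]).
    apply: eq_big_seq => z zs; rewrite hornerM -{1}TE ?s1// mulrA mulr_sumr mulr_suml.
    by apply: eq_bigr => u _; ring.
  rewrite exchange_big/= big1_seq// => u /andP[_ us].
  have := @funk_hecke_lt n r u.2 x nN sr (s1 us) x1.
  move/(congr1 (fun v => u.1 * (C n).[dot x u.2] * v)); rewrite mulr0 mulr_sumr => e.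
  rewrite -[RHS]e; apply: eq_bigr => z _; rewrite [dot z.2 u.2]dotC; ring.
have TC : T = a *: C n by apply/eqP; rewrite -subr_eq0; apply/eqP.
rewrite TE// TC hornerZ; congr (_ * _).
have := TE x x x1 x1; rewrite x1 TC hornerZ (ultraspherical1 k0) mulr1 => <-.
rewrite -(@cubature_zonal L _ x)//; last first.
  by rewrite (leq_trans (size_polyMleq _ _))// sC; lia.
by apply: eq_bigr => z _; rewrite hornerM.
Qed.

End funk_hecke.

(** * Integration against the Gegenbauer weight on [-1, 1] *)

Section weight.
Variables (R : realType) (l : R).
Local Notation I11 := `[(-1 : R), 1]%classic.
Local Notation mu := (@lebesgue_measure R).
Local Notation w := (gegenbauer_weight l).

(** For l = 0 the weight is unbounded near -1 and 1, so the fundamental theorem of calculus is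
    applied on the intervals [F n] = [- a n, a n], which exhaust ]-1, 1[, before passing to the
    limit. *)
Let a (n : nat) : R := 1 - n.+2%:R^-1.
Let F (n : nat) : set R := `[- a n, a n].

Let a01 n : 0 < a n < 1.
Proof.
rewrite /a subr_gt0 invf_lt1 ?ltr1n// ltrBlDr ltrDl invr_gt0 ltr0n//.
Qed.

Let FS n x : F n x -> -1 < x < 1.
Proof.
rewrite /F/= in_itv/= => /andP[x1 x2]; have /andP[? ?] := a01 n.
by apply/andP; split; lra.
Qed.

Let F_nd : nondecreasing_seq F.
Proof.
move=> i j ij; rewrite subsetEset /F; apply: subset_itv; rewrite bnd_simp.
  by rewrite lerN2 /a lerD2l lerN2 lef_pV2 ?posrE// ler_nat.
by rewrite /a lerD2l lerN2 lef_pV2 ?posrE// ler_nat.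
Qed.

Let F_cup : \bigcup_n F n = `]-1, 1[%classic.
Proof.
apply/seteqP; split => [x [n _ /FS]|x /=]; first by rewrite /= in_itv.
rewrite in_itv/= => /andP[x1 x2].
pose n := Num.bound (1 - `|x|)^-1.
have x3 : `|x| < 1 by rewrite ltr_norml x1 x2.
exists n => //; rewrite /F/= in_itv/= -ler_norml /a lerBrDr -lerBrDl.
rewrite -[leRHS]invrK lef_pV2 ?posrE ?invr_gt0 ?subr_gt0//.
rewrite (le_trans (ltW (archi_boundP _)))// ?invr_ge0 ?subr_ge0 ?(ltW x3)//.
by rewrite ler_nat (leq_trans (leqnSn _)).
Qed.

Let mw : measurable_fun [set: R] w.
Proof.
apply: (measurableT_comp (measurable_powR _)).
by apply: measurable_funB => //; apply: measurable_funX.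
Qed.

Let ge0_integral_cvg (f : R -> R) : measurable_fun [set: R] f ->
  (forall x, -1 < x < 1 -> 0 <= f x) ->
  (\int[mu]_(x in F n) (f x)%:E)%E @[n --> \oo] --> (\int[mu]_(x in I11) (f x)%:E)%E.
Proof.
move=> mf f0.
have mf' A : measurable_fun A (EFin \o f).
  by apply/measurable_EFinP; apply: measurable_funS mf.
rewrite -(@integral_itv_obnd_cbnd _ (-1) (BRight 1) _)// -integral_itv_bndo_bndc// -F_cup.
apply: ge0_nondecreasing_set_cvg_integral => //.
  by move=> n; exact: measurable_itv.
  by move=> n; exact: mf'.
by move=> n x /FS x1; rewrite lee_fin f0.
Qed.

Lemma weight_ge0 x : 0 <= w x. Proof. exact: powR_ge0. Qed.

Lemma weight_gt0 x : -1 < x < 1 -> 0 < w x.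
Proof. by move=> /andP[? ?]; apply: powR_gt0; nra. Qed.

Lemma integral_derive (G g : R -> R) (b : R) : 0 < b < 1 ->
  (forall x : R, -1 < x < 1 -> is_derive x (1 : R) G (g x)) ->
  (forall x : R, -1 < x < 1 -> {for x, continuous g}) ->
  (\int[mu]_(x in `[(- b)%R, b]) (g x)%:E = (G b - G (- b))%:E)%E.
Proof.
move=> /andP[b0 b1] dG cg; rewrite EFinB.
have cG (x : R) : -1 < x < 1 -> {for x, continuous G}.
  by move=> x1; apply/differentiable_continuous/derivable1_diffP; case: (dG _ x1).
apply: continuous_FTC2; first by lra.
- apply: continuous_in_subspaceT => x; rewrite inE/= in_itv/= => /andP[? ?].
  by apply: cg; apply/andP; split; lra.
- split.
  + move=> x; rewrite in_itv/= => /andP[? ?].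
    by have [] // : is_derive x (1 : R) G (g x) by apply: dG; apply/andP; split; lra.
  + by apply/cvg_at_right_filter/cG; apply/andP; split; lra.
  + by apply/cvg_at_left_filter/cG; apply/andP; split; lra.
- move=> x; rewrite in_itv/= => /andP[? ?]; rewrite derive1E.
  by have [] // : is_derive x (1 : R) G (g x) by apply: dG; apply/andP; split; lra.
Qed.

Lemma weight_derive (e x : R) : -1 < x < 1 ->
  is_derive x (1 : R) (fun y => (1 - y ^+ 2) `^ e) (e * (1 - x ^+ 2) `^ (e - 1) * (- 2 * x)).
Proof.
move=> /andP[x1 x2]; have x0 : 0 < 1 - x ^+ 2 by nra.
apply: (@is_derive1_comp _ (fun y => y `^ e) (fun y => 1 - y ^+ 2)); first exact: is_derive1_powR.
have h := @is_deriveB R R R (cst 1) (id ^+ 2) x (1 : R) _ _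
    (is_derive_cst (1 : R) x (1 : R)) (is_deriveX 2 (is_derive_id x (1 : R))).
apply: is_derive_eq h _; rewrite sub0r /GRing.scale/= expr1; ring.
Qed.

Lemma weight_continuous (e x : R) : -1 < x < 1 ->
  {for x, continuous (fun y : R => (1 - y ^+ 2) `^ e)}.
Proof.
move=> x1; apply/differentiable_continuous/derivable1_diffP.
by case: (weight_derive e x1).
Qed.

Hypothesis l0 : l = 0 \/ 2^-1 <= l.

(** For l >= 1/2 the weight is at most 1; for l = 0 its primitive is [asin], so the integrals over
    [F n] stay below pi. *)
Lemma weight_int_bounded : (\int[mu]_(x in I11) (w x)%:E < +oo)%E.
Proof.
case: l0 => [l00|l12]; last first.
  apply: (@le_lt_trans _ _ (\int[mu]_(x in I11) (cst 1%:E x))%E).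
    apply: ge0_le_integral => //=.
    - by move=> x _; rewrite lee_fin weight_ge0.
    - by apply/measurable_EFinP; apply: measurable_funS mw.
    - move=> x; rewrite in_itv/= => /andP[? ?]; rewrite lee_fin.
      rewrite -(powRr0 (1 - x ^+ 2)) /gegenbauer_weight.
      have [->|x0] := eqVneq (1 - x ^+ 2) 0.
        by rewrite powRr0 /powR eqxx lern1 leq_b1.
      by apply: ger_powR; rewrite ?subr_ge0//; nra.
  rewrite integral_cst; last exact: measurable_itv.
  rewrite mul1e /= lebesgue_measure_itv /=.
  by case: ifP => _; rewrite -?EFinB ltry.
have h := ge0_integral_cvg mw (fun x _ => weight_ge0 x).
rewrite -(cvg_lim _ h)//; apply: (@le_lt_trans _ _ pi%:E); last exact: ltry.
apply: lime_le; first by apply/cvg_ex; eexists; exact: h.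
apply: nearW => n.
have -> : (\int[mu]_(x in F n) (w x)%:E = (asin (a n) - asin (- a n))%:E)%E.
  apply: integral_derive; first exact: a01.
    move=> x x1; have := is_derive1_asin x1.
    rewrite /gegenbauer_weight l00 sub0r powRN powR12_sqrt//.
    by case/andP: x1 => ? ?; nra.
  by move=> x x1; exact: weight_continuous.
rewrite lee_fin; have /andP[? ?] := a01 n.
have := @asin_lepi2 R (a n); have := @asin_geNpi2 R (- a n).
move=> h1 h2; have {}h1 := h1 _; have {}h2 := h2 _.
have : asin (a n) <= pi / 2 by apply: h2; apply/andP; split; lra.
have : - (pi / 2) <= asin (- a n) by apply: h1; apply/andP; split; lra.
lra.
Qed.

Lemma weight_integrable : mu.-integrable I11 (EFin \o w).
Proof.
apply/integrableP; split; first by apply/measurable_EFinP; apply: measurable_funS mw.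
apply: le_lt_trans weight_int_bounded.
by rewrite le_eqVlt; apply/orP; left; apply/eqP/eq_integral => x _ /=; rewrite ger0_norm ?weight_ge0.
Qed.

Lemma continuous_weight_integrable (f : R -> R) : {within I11, continuous f} ->
  mu.-integrable I11 (EFin \o (fun x => f x * w x)).
Proof.
move=> cf.
have [M fM] : exists M, forall x, I11 x -> `|f x| <= M.
  have [M [_ MP]] := compact_bounded (continuous_compact cf (@segment_compact R (-1) 1)).
  by exists (M + 1) => x x1; apply: (MP (M + 1)); rewrite ?ltrDl//; exists x.
have mf : measurable_fun I11 f.
  by apply: subspace_continuous_measurable_fun => //; exact: measurable_itv.
have mfw : measurable_fun I11 (fun x => f x * w x).
  by apply: measurable_funM => //; apply: measurable_funS mw.
apply: (@le_integrable _ _ _ mu I11 _ _ (EFin \o (fun x => M * w x))); first exact: measurable_itv.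
- exact/measurable_EFinP.
- move=> x x1 /=; rewrite lee_fin normrM [leRHS]normrM (ger0_norm (weight_ge0 _)).
  by rewrite ler_wpM2r ?weight_ge0// (le_trans (fM _ x1)) ?ler_norm.
- have -> : EFin \o (fun x => M * w x) = (fun x => M%:E * (EFin \o w) x)%E by [].
  by apply: integrableZl; [exact: measurable_itv|exact: weight_integrable].
Qed.

Definition weighted_integral (f : R -> R) : R := \int[mu]_(x in I11) (f x * w x).
Local Notation J := weighted_integral.

Lemma weighted_integralD (f g : R -> R) : {within I11, continuous f} -> {within I11, continuous g} ->
  J (fun x => f x + g x) = J f + J g.
Proof.
move=> cf cg; rewrite -RintegralD; [|exact: measurable_itv|exact: continuous_weight_integrable..].
by apply: eq_Rintegral => x _; rewrite mulrDl.
Qed.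

Lemma weighted_integralZ (c : R) (f : R -> R) : {within I11, continuous f} -> J (fun x => c * f x) = c * J f.
Proof.
move=> cf; rewrite -RintegralZl; [|exact: measurable_itv|exact: continuous_weight_integrable].
by apply: eq_Rintegral => x _; rewrite mulrA.
Qed.

Lemma le_weighted_integral (f g : R -> R) : {within I11, continuous f} -> {within I11, continuous g} ->
  (forall x, -1 <= x <= 1 -> f x <= g x) -> J f <= J g.
Proof.
move=> cf cg fg; apply: le_Rintegral => [||| x x1];
  [exact: measurable_itv|exact: continuous_weight_integrable..|].
by rewrite ler_wpM2r ?weight_ge0// fg// -[_ && _]/(x \in `[-1, 1]).
Qed.

Lemma eq_weighted_integral (f g : R -> R) : (forall x, -1 <= x <= 1 -> f x = g x) -> J f = J g.
Proof.
by move=> fg; apply: eq_Rintegral => x; rewrite inE/= in_itv/= => x1; rewrite fg.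
Qed.

Lemma within_horner (A : set R) (p : {poly R}) : {within A, continuous (horner p)}.
Proof. by apply: continuous_subspaceT => x; exact: continuous_horner. Qed.

Lemma weighted_integral_horner (c : R) (p q : {poly R}) :
  J (horner (p + c *: q)) = J (horner p) + c * J (horner q).
Proof.
rewrite -weighted_integralZ; last exact: within_horner.
rewrite -weighted_integralD; [|exact: within_horner|]; last first.
  by apply: continuous_subspaceT => x; apply: cvgMl_tmp; exact: continuous_horner.
by apply: eq_weighted_integral => x _; rewrite hornerD hornerZ.
Qed.

Let bounded_horner (p : {poly R}) : exists2 M, 0 <= M & forall x, -1 <= x <= 1 -> `|p.[x]| <= M.
Proof.
have cp := @within_horner I11 p.
have [M [_ MP]] := compact_bounded (continuous_compact cp (@segment_compact R (-1) 1)).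
exists (`|M| + 1) => [|x x1]; first by rewrite addr_ge0.
apply: (MP (`|M| + 1)); first by rewrite (le_lt_trans (ler_norm _))// ltrDl.
by exists x.
Qed.

(** Monotone convergence needs a nonnegative integrand: p is the difference of p + M and the
    constant M, where M bounds |p| on [-1, 1]. *)
Let cvg_horner (p : {poly R}) :
  \int[mu]_(x in F n) (p.[x] * w x) @[n --> \oo] --> J (horner p).
Proof.
have intp n (q : {poly R}) : mu.-integrable (F n) (EFin \o (fun x => q.[x] * w x)).
  apply: integrableS (continuous_weight_integrable (@within_horner I11 q)); try exact: measurable_itv.
  by move=> x /FS/andP[? ?]; rewrite /= in_itv/=; apply/andP; split; exact: ltW.
have pos (q : {poly R}) : (forall x, -1 <= x <= 1 -> 0 <= q.[x]) ->
    \int[mu]_(x in F n) (q.[x] * w x) @[n --> \oo] --> J (horner q).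
  move=> q0; apply: fine_cvg; rewrite /J /Rintegral fineK; last first.
    apply: integrable_fin_num; first exact: measurable_itv.
    exact: (continuous_weight_integrable (@within_horner I11 q)).
  apply: ge0_integral_cvg => [|x /andP[? ?]].
    by apply: measurable_funM => //; apply: continuous_measurable_fun; exact: continuous_horner.
  by rewrite mulr_ge0 ?weight_ge0// q0//; apply/andP; split; exact: ltW.
have [M M0 pM] := bounded_horner p.
have e (A : set R) : measurable A -> mu.-integrable A (EFin \o (fun x => (p + M%:P).[x] * w x)) ->
    mu.-integrable A (EFin \o (fun x => (M%:P).[x] * w x)) ->
   \int[mu]_(x in A) (p.[x] * w x) =
   \int[mu]_(x in A) ((p + M%:P).[x] * w x) - \int[mu]_(x in A) ((M%:P).[x] * w x).
  move=> mA i1 i2; rewrite -RintegralB//; apply: eq_Rintegral => x _.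
  by rewrite -mulrBl hornerD addrK.
rewrite /J e; [|exact: measurable_itv|
  exact: (continuous_weight_integrable (@within_horner I11 _))..].
have -> : (fun n => \int[mu]_(x in F n) (p.[x] * w x)) =
    (fun n => \int[mu]_(x in F n) ((p + M%:P).[x] * w x) - \int[mu]_(x in F n) ((M%:P).[x] * w x)).
  by apply/funext => n; rewrite e; [|exact: measurable_itv|exact: intp..].
apply: cvgB; apply: pos => x x1; rewrite ?hornerD ?hornerC//.
by have := pM _ x1; rewrite ler_norml => /andP[? _]; rewrite -lerBlDr sub0r.
Qed.

(** Integration by parts: the difference of the two sides is the integral of the derivative of (1 -
    x^2)^(l + 1/2) q(x), which tends to 0 at both end points. *)
Lemma weighted_integral_deriv (q : {poly R}) :
  (1 + 2 * l) * J (horner ('X * q)) = J (horner ((1 - 'X^2) * q^`())).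
Proof.
pose g := (1 - 'X^2) * q^`() - (1 + 2 * l) *: ('X * q).
have JE : J (horner g) = J (horner ((1 - 'X^2) * q^`())) - (1 + 2 * l) * J (horner ('X * q)).
  rewrite -[- (_ * J _)]mulNr -weighted_integral_horner; congr (J (horner _)).
  by rewrite /g scaleNr.
suff : J (horner g) = 0 by rewrite JE => /eqP; rewrite subr_eq0 => /eqP.
pose G (x : R) := (1 - x ^+ 2) `^ (l + 2^-1) * q.[x].
have le0 : 2^-1 <= l + 2^-1 by case: l0 => [->|?]; lra.
have dG (x : R) : -1 < x < 1 -> is_derive x (1 : R) G (g.[x] * w x).
  move=> x1; have dq : is_derive x (1 : R) (horner q) (q^`()).[x].
    by split; [exact: derivable_horner|rewrite derivE derive1E].
  have h1 := is_deriveM (weight_derive (l + 2^-1) x1) dq.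
  apply: is_derive_eq h1 _; rewrite /GRing.scale/= /g /gegenbauer_weight.
  rewrite hornerD hornerN hornerM hornerZ hornerM hornerX hornerD hornerN hornerXn hornerC.
  have -> : l + 2^-1 - 1 = l - 2^-1 by lra.
  have x0 : 0 < 1 - x ^+ 2 by case/andP: x1 => ? ?; nra.
  have -> : (1 - x ^+ 2) `^ (l + 2^-1) = (1 - x ^+ 2) * (1 - x ^+ 2) `^ (l - 2^-1).
    rewrite -[X in _ = X * _](powRr1 (ltW x0)) -powRD; last by rewrite (gt_eqF x0) implybT.
    by congr (_ `^ _); lra.
  by field.
have cg x : -1 < x < 1 -> {for x, continuous (fun x => g.[x] * w x)}.
  by move=> x1; apply: cvgM; [exact: continuous_horner|exact: weight_continuous].
have FE n : \int[mu]_(x in F n) (g.[x] * w x) = G (a n) - G (- a n).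
  by rewrite /Rintegral (integral_derive (a01 n) dG cg).
have h : (fun n => G (a n) - G (- a n)) @ \oo --> J (horner g).
  have := @cvg_horner g.
  rewrite (_ : (fun n => _) = (fun n => G (a n) - G (- a n)))//.
  by apply/funext => n; rewrite FE.
have [M M0 qM] := bounded_horner q.
(* 1 - (a n)^2 is at most 2 / (n + 2), and the exponent l + 1/2 is at least 1/2, whence the square
   root in the bound. *)
have G0 : (fun n => G (a n) - G (- a n)) @ \oo --> (0 : R).
  have bd n : `|G (a n) - G (- a n)| <= (2 * M) * Num.sqrt (2 * n.+2%:R^-1).
    have /andP[an0 an1] := a01 n.
    have i0 : 0 < n.+2%:R^-1 :> R by rewrite invr_gt0.
    have p0 : 0 < 1 - a n ^+ 2 by rewrite expr2; nra.
    have p1 : 1 - a n ^+ 2 <= 2 * n.+2%:R^-1.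
      have -> : 1 - a n ^+ 2 = 2 * n.+2%:R^-1 - n.+2%:R^-1 ^+ 2 by rewrite /a; ring.
      by rewrite lerBlDr lerDl sqr_ge0.
    have pw : 0 <= (1 - a n ^+ 2) `^ (l + 2^-1) <= Num.sqrt (2 * n.+2%:R^-1).
      rewrite powR_ge0/= (@le_trans _ _ ((1 - a n ^+ 2) `^ (2^-1)))//.
        by apply: ger_powR => //; rewrite p0 lerBlDr lerDl sqr_ge0.
      by rewrite powR12_sqrt ?ler_wsqrtr// ltW.
    rewrite (le_trans (ler_normB _ _))// /G sqrrN !normrM.
    case/andP: pw => pw0 pw1; rewrite !(ger0_norm pw0).
    have m1 : `|q.[a n]| <= M by apply: qM; apply/andP; split; lra.
    have m2 : `|q.[- a n]| <= M by apply: qM; apply/andP; split; lra.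
    rewrite -mulrDr mulrC ler_pM// ?addr_ge0//; lra.
  apply: norm_cvg0; apply: (@squeeze_cvgr _ _ _ _ (cst 0) (fun n => (2 * M) * Num.sqrt (2 * n.+2%:R^-1))).
  - by apply: nearW => n; rewrite normr_ge0 bd.
  - exact: cvg_cst.
  have h1 : Num.sqrt (2 * n.+2%:R^-1) @[n --> \oo] --> Num.sqrt (2 * 0 : R).
    apply: continuous_cvg; first exact: sqrt_continuous.
    apply: cvgMl_tmp; have := @cvg_harmonic R; rewrite -(cvg_shiftn 1) /=.
    rewrite (_ : (fun n => _) = (fun n => n.+2%:R^-1))//.
    by apply/funext => n; rewrite addn1.
  have := @cvgMl_tmp _ _ _ _ _ (2 * M) _ h1.
  by rewrite mulr0 sqrtr0 mulr0; apply.
exact: (cvg_unique _ h G0).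
Qed.

Lemma weighted_integral_eq0 (f : R -> R) : {within I11, continuous f} ->
  (forall x, -1 <= x <= 1 -> 0 <= f x) -> J f = 0 -> forall x, -1 <= x <= 1 -> f x = 0.
Proof.
move=> cf f0 J0 t t1; apply/eqP; rewrite eq_le f0// andbT leNgt; apply/negP => ft.
have [e e0 ef] : exists2 e : R, 0 < e & forall x, -1 <= x <= 1 -> `|x - t| < e -> 0 < f x.
  have /subspace_continuousP/(_ t t1) := cf.
  move=> /cvgrPdist_lt/(_ _ ft); rewrite near_withinE => /nbhs_ballP[e /= e0 eP].
  exists e => // x x1 xt.
  have xb : ball t e x by rewrite /ball/= distrC.
  by have := eP x xb x1; rewrite ltr_norml => /andP[_ h]; have : f t - f x < f t := h; lra.
pose m := Num.min e 1.
have m0 : 0 < m by rewrite lt_min e0 ltr01.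
have me : m <= e by rewrite ge_min lexx.
have m1 : m <= 1 by rewrite ge_min lexx orbT.
(* The interval lies beside t on the side of 0, so it stays inside ]-1, 1[, where the weight is
   continuous and positive, even when t is an end point. *)
have [c [d [cd c1 d1 cdt]]] : exists c d : R, [/\ c < d, -1 < c, d < 1 &
    forall x, c <= x <= d -> `|x - t| < e].
  have [t0|t0] := leP t 0.
    exists (t + m / 4), (t + m / 2); case/andP: t1 => *; split; try lra.
    by move=> x /andP[? ?]; rewrite ltr_norml; apply/andP; split; lra.
  exists (t - m / 2), (t - m / 4); case/andP: t1 => *; split; try lra.
  by move=> x /andP[? ?]; rewrite ltr_norml; apply/andP; split; lra.
have in11 x : c <= x <= d -> -1 <= x <= 1.
  by move=> /andP[? ?]; apply/andP; split; lra.
have ifw := continuous_weight_integrable cf.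
have cfw : {within `[c, d], continuous (fun x => f x * w x)}.
  have cf' : {within `[c, d], continuous f}.
    by apply: continuous_subspaceW cf => z; rewrite /= !in_itv/=; exact: in11.
  have cw : {within `[c, d], continuous w}.
    apply: continuous_in_subspaceT => z; rewrite inE/= in_itv/= => /andP[? ?].
    by apply: weight_continuous; apply/andP; split; lra.
  by move=> x; apply: cvgM; [exact: cf'|exact: cw].
have [z zcd zP] := EVT_min (ltW cd) cfw.
have fz : 0 < f z * w z.
  move: zcd; rewrite in_itv/= => zcd; rewrite mulr_gt0 ?ef ?in11 ?cdt//.
  by apply: weight_gt0; case/andP: zcd => ? ?; apply/andP; split; lra.
have : J f >= (f z * w z) * (d - c).
  rewrite /J -lee_fin /Rintegral fineK; last first.
    by apply: integrable_fin_num => //; exact: measurable_itv.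
  apply: (@le_trans _ _ (\int[mu]_(x in `[c, d]) (f x * w x)%:E)%E); last first.
    apply: ge0_subset_integral; try exact: measurable_itv.
    - exact: (measurable_int mu ifw).
    - by move=> x x1; rewrite lee_fin mulr_ge0 ?weight_ge0// f0.
    - by move=> x; rewrite /= !in_itv/=; exact: in11.
  have -> : ((f z * w z * (d - c))%:E = \int[mu]_(x in `[c, d]) (cst (f z * w z)%:E x))%E.
    rewrite integral_cst; last exact: measurable_itv.
    by rewrite /= lebesgue_measure_itv /= lte_fin cd -EFinB -EFinM.
  apply: ge0_le_integral => //.
  - by move=> x _; rewrite lee_fin ltW.
  - apply: measurable_funS (measurable_int mu ifw); try exact: measurable_itv.
    by move=> x; rewrite /= !in_itv/=; exact: in11.
rewrite J0 leNgt mulr_gt0// subr_gt0//.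
Qed.

End weight.

(** * Sphere means and existence of cubatures *)

Lemma horner_ext_itv (R : realFieldType) (p q : {poly R}) :
  (forall x, -1 <= x <= 1 -> p.[x] = q.[x]) -> p = q.
Proof.
move=> e; apply/eqP; rewrite -subr_eq0; apply/eqP.
apply: (@roots_geq_poly_eq0 _ _ [seq i.+1%:R^-1 | i <- iota 0 (size (p - q))]).
- apply/allP => _ /mapP[i _ ->]; rewrite rootE hornerD hornerN e ?subrr//.
  have i0 : 0 <= i.+1%:R^-1 :> R by rewrite invr_ge0.
  by rewrite invf_le1 ?ltr0n// ler1n andbT (le_trans _ i0)// lerN10.
- rewrite map_inj_uniq ?iota_uniq// => i j /invr_inj/eqP.
  by rewrite eqr_nat eqSS => /eqP.
- by rewrite size_map size_iota.
Qed.

Section sphere_mean.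
Variables (R : realType) (m : nat).
Local Notation l := (m%:R / 2 : R).
Local Notation J := (weighted_integral l).

Let l0 : l = 0 \/ 2^-1 <= l.
Proof.
by case: m => [|n]; [left; rewrite mul0r|right; rewrite ler_pdivlMr// mulVf// ler1n].
Qed.

(* The mean over the unit sphere of R^(m+2) of a polynomial in one coordinate. *)
Definition sphere_mean (p : {poly R}) : R := J (horner p) / J (horner 1).

Lemma weighted_integral_gt0 (p : {poly R}) : p != 0 ->
  (forall t, -1 <= t <= 1 -> 0 <= p.[t]) -> 0 < J (horner p).
Proof.
move=> p0 pge; rewrite lt_neqAle; apply/andP; split; last first.
  apply: le_trans (le_weighted_integral l0 (@within_horner _ _ 0) (@within_horner _ _ p) _).
    have := @weighted_integralZ _ _ l0 0 (horner 0) (@within_horner _ _ 0).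
    by rewrite mul0r => <-; rewrite le_eqVlt; apply/orP; left; apply/eqP/eq_weighted_integral => x _;
      rewrite hornerC mulr0.
  by move=> x x1; rewrite hornerC pge.
apply: contraNneq p0 => /esym h; apply/eqP.
apply: horner_ext_itv => x x1; rewrite hornerC.
exact: (weighted_integral_eq0 l0 (@within_horner _ _ p) pge h).
Qed.

Let J1 : 0 < J (horner 1).
Proof. by apply: weighted_integral_gt0 => [|t _]; rewrite ?oner_neq0// hornerC ler01. Qed.

Lemma weighted_integral1_gt0 : 0 < J (horner 1). Proof. exact: J1. Qed.

Lemma sphere_mean_linear : linear (sphere_mean : {poly R} -> R^o).
Proof.
move=> c p q; rewrite /sphere_mean [c *: p + q]addrC weighted_integral_horner//.
by rewrite mulrDl -mulrA addrC.
Qed.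

HB.instance Definition _ := GRing.isLinear.Build R {poly R} R^o *:%R
  (sphere_mean : {poly R} -> R^o) sphere_mean_linear.

Lemma sphere_mean1 : sphere_mean 1 = 1.
Proof. by rewrite /sphere_mean divff// gt_eqF. Qed.

Lemma sphere_mean_deriv (q : {poly R}) :
  m.+1%:R * sphere_mean ('X * q) = sphere_mean ((1 - 'X^2) * q^`()).
Proof.
rewrite /sphere_mean mulrA -weighted_integral_deriv//; congr (_ * _ / _).
by rewrite mulrC divfK// addrC natr1.
Qed.

Lemma sphere_mean_gt0 (p : {poly R}) : p != 0 ->
  (forall t, -1 <= t <= 1 -> 0 <= p.[t]) -> 0 < sphere_mean p.
Proof. by move=> p0 h; rewrite divr_gt0// weighted_integral_gt0. Qed.

End sphere_mean.

Section cubature.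
Variable R : realType.
Local Notation C m := (ultraspherical (m%:R : R)).

Let deriv_mean m (q : {poly R}) :
  (1 + m%:R) * (sphere_mean m ('X * q) : R^o) = sphere_mean m ((1 - 'X^2) * q^`()) :> R.
Proof. by rewrite -sphere_mean_deriv addrC natr1. Qed.

(** Induction on the dimension from the sphere {-1, 1} of R^1: each step slices with the Gauss
    quadrature at the zeros of C_{N+1}, exact up to degree N. *)
Lemma cubature_exists d N : exists s : seq (R * 'rV[R]_d.+1), cubature N s.
Proof.
elim: d => [|m [s cub]]; first exact: cubature1.
have sP : size (C m N.+1) = N.+2 by exact: size_ultraspherical.
have orth (q : {poly R}) : (size q < size (C m N.+1))%N -> sphere_mean m (C m N.+1 * q) = 0.
  rewrite sP ltnS => sq.
  exact: (@ultraspherical_orth_size _ _ (@sphere_mean R m : {linear {poly R} -> R^o}) (ler0n _ _) (@deriv_mean m)).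
have [r [r0 r1 rE]] := @gauss_quadrature R (@sphere_mean R m : {linear {poly R} -> R^o})
  (C m N.+1) (@sphere_mean_gt0 R m) (ultraspherical_neq0 (ler0n _ _) _) orth.
eexists; apply: (@cubatureS R m.+1 N (@sphere_mean R m : {linear {poly R} -> R^o}) r s) => //.
- exact: sphere_mean1.
- exact: sphere_mean_deriv.
- by move=> p sp; apply: rE; rewrite sP.
Qed.

Lemma sphere_meanXn m n : sphere_mean m 'X^n = sphere_moment R m.+2 n.
Proof.
exact: (@momentE R m.+1 (@sphere_mean R m : {linear {poly R} -> R^o}) isT (sphere_mean1 R m)
  (@sphere_mean_deriv R m)).
Qed.

Lemma sphere_mean_orth m i j : i != j -> sphere_mean m (C m i * C m j) = 0.
Proof.
have h a b : (a < b)%N -> sphere_mean m (C m a * C m b) = 0.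
  by move=> ab; exact: (@ultraspherical_orth _ _ (@sphere_mean R m : {linear {poly R} -> R^o}) (ler0n _ _) (@deriv_mean m)).
by rewrite neq_ltn => /orP[/h//|/h]; rewrite mulrC.
Qed.

Lemma zonal_mean m N (s : seq (R * 'rV[R]_m.+2)) (p : {poly R}) x : cubature N s ->
  (size p <= N.+1)%N -> dot x x = 1 -> \sum_(z <- s) z.1 * p.[dot x z.2] = sphere_mean m p.
Proof.
move=> cub pN x1.
exact: (@cubature_zonal _ _ _ _ cub (@sphere_mean R m : {linear {poly R} -> R^o}) p x (@sphere_meanXn m)).
Qed.

Lemma zonal_reproducing m N n (s : seq (R * 'rV[R]_m.+2)) x y : cubature N s ->
  (4 * n.+1 <= N)%N -> dot x x = 1 -> dot y y = 1 ->
  \sum_(z <- s) z.1 * ((C m n).[dot x z.2] * (C m n).[dot y z.2]) =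
  sphere_mean m (C m n * C m n) * (C m n).[dot x y].
Proof.
move=> cub nN x1 y1.
have mE : m.+2%:R - 2 = m%:R :> R by rewrite -[m.+2]addn2 natrD addrK.
have := @funk_hecke _ _ _ _ cub (@sphere_mean R m : {linear {poly R} -> R^o}) isT
  (@sphere_meanXn m) (@sphere_mean_deriv R m) isT (@sphere_mean_gt0 R m) n x y nN x1 y1.
by rewrite mE.
Qed.

Lemma sphere_mean_sqr_gt0 m n : 0 < sphere_mean m (C m n * C m n).
Proof.
apply: sphere_mean_gt0 => [|t _]; first by rewrite mulf_neq0// ultraspherical_neq0.
by rewrite hornerM -expr2 sqr_ge0.
Qed.

(* Funk-Hecke for zonal harmonics of different degrees. *)
Lemma zonal_orthogonal m N i j (s : seq (R * 'rV[R]_m.+2)) x y : cubature N s ->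
  (4 * i.+1 <= N)%N -> (4 * j.+1 <= N)%N -> i != j -> dot x x = 1 -> dot y y = 1 ->
  \sum_(z <- s) z.1 * ((C m i).[dot x z.2] * (C m j).[dot y z.2]) = 0.
Proof.
move=> cub iN jN ij x1 y1.
have mE : m.+2%:R - 2 = m%:R :> R by rewrite -[m.+2]addn2 natrD addrK.
have h a b u v : (4 * a.+1 <= N)%N -> (b < a)%N -> dot u u = 1 -> dot v v = 1 ->
    \sum_(z <- s) z.1 * ((C m a).[dot u z.2] * (C m b).[dot v z.2]) = 0.
  move=> aN ba u1 v1.
  have := @funk_hecke_lt _ _ _ _ cub (@sphere_mean R m : {linear {poly R} -> R^o}) isT
    (@sphere_meanXn m) (@sphere_mean_deriv R m) isT (@sphere_mean_gt0 R m) a (C m b) u v aN _ u1 v1.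
  by rewrite mE; apply; rewrite size_ultraspherical.
move: ij; rewrite neq_ltn => /orP[|/h ->//] ij.
rewrite -[RHS](h j i y x)//; apply: eq_bigr => z _; congr (_ * _).
by rewrite mulrC.
Qed.

End cubature.

(* One step of a random walk with independent increments +h and -h of mean h * rho maps F to
   [walk_even h F + rho * walk_odd h F], so n steps give a polynomial in rho. *)
Definition walk_even (R : fieldType) (h : R) (F : R -> R) (s : R) := (F (s + h) + F (s - h)) / 2.
Definition walk_odd (R : fieldType) (h : R) (F : R -> R) (s : R) := (F (s + h) - F (s - h)) / 2.

Fixpoint walk_poly (R : fieldType) (h : R) (n : nat) (F : R -> R) (s : R) : {poly R} :=
  if n is n'.+1 then walk_poly h n' (walk_even h F) s + 'X * walk_poly h n' (walk_odd h F) s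
  else (F s)%:P.

(** * Bernstein approximation on [-1, 1] by random walks *)

Section walk.
Variable R : realFieldType.
Implicit Types (F G : R -> R) (h s t : R).

(** The expectation of F after n steps from s when +h and -h have probabilities (1 + t) / 2 and (1 -
    t) / 2; hence the monotonicity in F for -1 <= t <= 1. *)
Fixpoint walk_mean h t n F s : R :=
  if n is n'.+1 then walk_mean h t n' (fun s => walk_even h F s + t * walk_odd h F s) s else F s.

Lemma walk_meanD h t n F G c s :
  walk_mean h t n (fun s => F s + c * G s) s = walk_mean h t n F s + c * walk_mean h t n G s.
Proof.
elim: n F G => //= n IH F G; rewrite -IH; congr walk_mean; apply/funext => u.
by rewrite /walk_even /walk_odd; ring.
Qed.

Lemma horner_walk_poly h t n F s : (walk_poly h n F s).[t] = walk_mean h t n F s.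
Proof.
elim: n F => [|n IH] F /=; first by rewrite hornerC.
by rewrite hornerD hornerM hornerX !IH walk_meanD.
Qed.

Lemma le_walk_mean h t n F G s : -1 <= t <= 1 -> (forall s, F s <= G s) ->
  walk_mean h t n F s <= walk_mean h t n G s.
Proof.
move=> /andP[t1 t2]; elim: n F G => //= n IH F G FG; apply: IH => u.
rewrite /walk_even /walk_odd; have := FG (u + h); have := FG (u - h) => h1 h2.
have h3 : (1 + t) * F (u + h) <= (1 + t) * G (u + h) by rewrite ler_wpM2l//; lra.
have h4 : (1 - t) * F (u - h) <= (1 - t) * G (u - h) by rewrite ler_wpM2l//; lra.
nra.
Qed.

Lemma walk_mean_cst h t n c s : walk_mean h t n (fun=> c) s = c.
Proof.
elim: n => //= n IH; rewrite -[RHS]IH; congr walk_mean; apply/funext => u.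
by rewrite /walk_even /walk_odd; field.
Qed.

Lemma walk_mean_variance h t n a s :
  walk_mean h t n (fun s => (s - a) ^+ 2) s =
  (s + n%:R * h * t - a) ^+ 2 + n%:R * h ^+ 2 * (1 - t ^+ 2).
Proof.
elim: n a => [|n IH] a /=; first by ring.
have -> : (fun s => walk_even h (fun s => (s - a) ^+ 2) s + t * walk_odd h (fun s => (s - a) ^+ 2) s) =
    (fun s => (s - (a - h * t)) ^+ 2 + (h ^+ 2 * (1 - t ^+ 2)) * (fun=> 1) s).
  by apply/funext => u; rewrite /walk_even /walk_odd; field.
rewrite walk_meanD walk_mean_cst IH -natr1; ring.
Qed.

End walk.

Section bernstein.
Variable R : realType.
Local Notation I11 := `[(-1 : R), 1]%classic.

(** The comparison principle [le_walk_mean] asks for inequalities at all real s, while f is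
    controlled on [-1, 1] only; f is thus extended by its end values. *)
Definition clamp (s : R) : R := Num.max (-1) (Num.min 1 s).

Lemma clamp_itv s : -1 <= clamp s <= 1.
Proof.
rewrite /clamp le_max lexx/= ge_max ge_min lexx/= andbT; lra.
Qed.

Lemma clampE s : -1 <= s <= 1 -> clamp s = s.
Proof. by move=> /andP[? ?]; rewrite /clamp min_r// max_r. Qed.

Lemma clamp_le s t : -1 <= t <= 1 -> `|clamp s - t| <= `|s - t|.
Proof.
move=> /andP[t1 t2]; rewrite /clamp; case: (leP 1 s) => s1.
  rewrite max_r; last by lra.
  by rewrite !ger0_norm; lra.
case: (leP (-1) s) => s2 //.
by rewrite ler0_norm ?ler0_norm; lra.
Qed.

Lemma itv_unif_continuous (f : R -> R) : {within I11, continuous f} -> forall e, 0 < e ->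
  exists2 d, 0 < d & forall x y, -1 <= x <= 1 -> -1 <= y <= 1 -> `|x - y| < d -> `|f x - f y| < e.
Proof.
move=> cf e e0.
have /compact_near_coveringP nc := @segment_compact R (-1) 1.
have := nc R (0 : R)^'+ (fun d x => -1 <= x <= 1 -> forall y, -1 <= y <= 1 -> `|x - y| < d -> `|f x - f y| < e) _.
case=> [x x1|r /= r0 rP].
  have /subspace_continuousP/(_ x x1) := cf.
  have e2 : 0 < e / 2 by rewrite divr_gt0.
  move=> /cvgrPdist_lt/(_ _ e2); rewrite near_withinE => /nbhs_ballP[r /= r0 rP].
  have {}rP z : -1 <= z <= 1 -> `|x - z| < r -> `|f x - f z| < e / 2.
    by move=> z1 zr; exact: (rP z zr z1).
  exists (ball x (r / 2), [set d | d < r / 2]) => /=.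
    split; first by apply: nbhsx_ballx; rewrite divr_gt0.
    by exists (r / 2); rewrite /= ?divr_gt0// => d /=; rewrite sub0r normrN => dr d0; rewrite (le_lt_trans (ler_norm _)).
  move=> [z d] /= [xz dr] z1 y y1 zy.
  have h1 : `|f x - f z| < e / 2 by apply: rP => //; rewrite (lt_le_trans xz)//; lra.
  have h2 : `|f x - f y| < e / 2.
    apply: rP => //; have -> : x - y = (x - z) + (z - y) by ring.
    rewrite (le_lt_trans (ler_normD _ _))//; rewrite /ball/= in xz; lra.
  have -> : f z - f y = - (f x - f z) + (f x - f y) by ring.
  by rewrite (le_lt_trans (ler_normD _ _))// normrN; lra.
have r2 : 0 < r / 2 by rewrite divr_gt0.
exists (r / 2) => // x y x1 y1; apply: (rP (r / 2)) => //.
by rewrite /ball/= sub0r normrN gtr0_norm//; lra.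
Qed.

Lemma itv_bounded (f : R -> R) : {within I11, continuous f} ->
  exists2 M, 0 < M & forall x, -1 <= x <= 1 -> `|f x| <= M.
Proof.
move=> cf; have [M [_ MP]] := compact_bounded (continuous_compact cf (@segment_compact R (-1) 1)).
exists (`|M| + 1) => [|x x1]; first by rewrite ltr_wpDl.
apply: (MP (`|M| + 1)); first by rewrite (le_lt_trans (ler_norm _))// ltrDl.
by exists x.
Qed.

Definition bernstein_poly (f : R -> R) (n : nat) : {poly R} :=
  walk_poly n.+1%:R^-1 n.+1 (f \o clamp) 0.

(** Bernstein's argument with Chebyshev's inequality: |f(clamp s) - f(t)| <= e / 2 + K (s - t)^2,
    and the endpoint of n + 1 steps of length 1 / (n + 1) has mean t and variance (1 - t^2) / (n +
    1). The value of N makes K / (n + 1) at most e / 2. *)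
Lemma bernstein_approx (f : R -> R) e : {within I11, continuous f} -> 0 < e ->
  exists N, forall n t, (N <= n)%N -> -1 <= t <= 1 -> `|(bernstein_poly f n).[t] - f t| <= e.
Proof.
move=> cf e0; have e2 : 0 < e / 2 by rewrite divr_gt0.
have [d d0 fd] := itv_unif_continuous cf e2.
have [M M0 fM] := itv_bounded cf.
pose K := 2 * M / d ^+ 2.
have K0 : 0 <= K by rewrite divr_ge0 ?sqr_ge0// mulr_ge0// ltW.
exists (Num.bound (K / (e / 2))) => n t nN t1.
rewrite /bernstein_poly horner_walk_poly; set h := n.+1%:R^-1.
have bd s : `|f (clamp s) - f t| <= e / 2 + K * (s - t) ^+ 2.
  have [ds|ds] := ltP `|clamp s - t| d.
    by rewrite (le_trans (ltW (fd _ _ (clamp_itv s) t1 ds)))// lerDl mulr_ge0// sqr_ge0.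
  have h1 : d ^+ 2 <= (s - t) ^+ 2.
    rewrite -(real_normK (num_real (s - t))) lerXn2r ?nnegrE//; first exact: ltW.
    by rewrite (le_trans ds)// clamp_le.
  rewrite (le_trans (ler_normB _ _))//.
  have : `|f (clamp s)| + `|f t| <= 2 * M by rewrite mulr2n mulrDl mul1r lerD// fM// clamp_itv.
  move=> h2; rewrite (le_trans h2)// (@le_trans _ _ (K * (s - t) ^+ 2))//; last by rewrite lerDr ltW.
  by rewrite /K mulrAC ler_pdivlMr ?exprn_gt0// ler_wpM2l// mulr_ge0// ltW.
have var : walk_mean h t n.+1 (fun s => (s - t) ^+ 2) 0 = h * (1 - t ^+ 2).
  have hn : n.+1%:R * h = 1 by rewrite /h mulfV// pnatr_eq0.
  by rewrite walk_mean_variance hn expr2 mulrA hn; ring.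
have quad c : walk_mean h t n.+1 (fun s => (fun=> f t + c * (e / 2)) s + (c * K) * (s - t) ^+ 2) 0 =
    f t + c * (e / 2 + K * (h * (1 - t ^+ 2))).
  by rewrite walk_meanD walk_mean_cst var; ring.
have small : K * (h * (1 - t ^+ 2)) <= e / 2.
  have h0 : 0 <= h by rewrite invr_ge0.
  rewrite (@le_trans _ _ (K * h))//.
    by rewrite ler_wpM2l// ler_piMr// lerBlDr lerDl sqr_ge0.
  rewrite /h ler_pdivrMr// mulrC -ler_pdivrMr//.
  have Ke : 0 <= K / (e / 2) by rewrite divr_ge0// ltW.
  by rewrite (le_trans (ltW (archi_boundP Ke)))// ler_nat (leq_trans nN).
rewrite ler_norml; apply/andP; split.
  have := @le_walk_mean _ h t n.+1 (fun s => (fun=> f t + -1 * (e / 2)) s + (-1 * K) * (s - t) ^+ 2)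
    (f \o clamp) 0 t1; rewrite quad => H.
  have {}H := H _; rewrite lerBrDl; apply: le_trans (H _); first lra.
  by move=> s; have := bd s; rewrite ler_norml /= => /andP[? ?]; lra.
have := @le_walk_mean _ h t n.+1 (f \o clamp)
  (fun s => (fun=> f t + 1 * (e / 2)) s + (1 * K) * (s - t) ^+ 2) 0 t1; rewrite quad => H.
have {}H := H _; rewrite lerBlDl; apply: le_trans (H _) _; last lra.
by move=> s; have := bd s; rewrite ler_norml /= => /andP[? ?]; lra.
Qed.

End bernstein.

(** Points come as a weighted sequence, with repetitions allowed, so that a cubature or a weighted
    cube can be inserted directly. *)
Definition pd_zonal (R : realType) (d : dimension) (f : R -> R) : Prop :=
  forall s : seq (R * euclidean R d), all (fun p => euclid_dot p.2 p.2 == 1) s ->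
    0 <= \sum_(p <- s) \sum_(q <- s) p.1 * q.1 * f (euclid_dot p.2 q.2).

(** * Cubes in l^2 and the coefficients of Bernstein polynomials *)

Section ell2_finite.
Variable R : realType.

Definition ell2_seq_val (u : seq R) : nat -> R := fun n => u`_n.

Lemma ell2_seq_subproof (u : seq R) : ell2_seq_val u \in @square_summable R.
Proof.
apply/square_summableP; apply/cvg_ex; exists (\sum_(0 <= i < size u) u`_i ^+ 2).
apply: cvg_near_cst.
exists (size u) => // n /= un; rewrite /series/= (big_cat_nat (n := size u))//=.
rewrite [X in _ + X](_ : _ = 0) ?addr0// big_nat big1// => i /andP[ui _].
by rewrite /ell2_seq_val nth_default// expr0n.
Qed.

Definition ell2_seq (u : seq R) : ell2 R := Ell2 (ell2_seq_subproof u).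

Lemma ell2_dot_seq (u v : seq R) : ell2_dot (ell2_seq u) (ell2_seq v) =
  \sum_(0 <= i < size u) u`_i * v`_i.
Proof.
apply: cvg_lim => //; apply: cvg_near_cst.
exists (size u) => // n /= un; rewrite /series/= (big_cat_nat (n := size u))//=.
rewrite [X in _ + X](_ : _ = 0) ?addr0// big_nat big1// => i /andP[ui _].
by rewrite /= /ell2_seq_val [u`_i]nth_default// mul0r.
Qed.

Variable h : R.
Hypothesis h0 : 0 <= h.

(* Vertices of the cube {sqrt h, - sqrt h}^n, weighted by the character of the coordinates marked [false]. *)
Fixpoint cube (o : seq bool) : seq (R * seq R) :=
  if o is b :: o' then
    [seq (p.1, Num.sqrt h :: p.2) | p <- cube o'] ++
    [seq ((-1) ^+ (~~ b) * p.1, - Num.sqrt h :: p.2) | p <- cube o']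
  else [:: (1, [::])].

(** One branch of the expansion of [walk_poly]: [true] selects the even part, [false] the odd part,
    which carries the factor X. *)
Fixpoint walk_word (o : seq bool) (F : R -> R) (s : R) : R :=
  if o is b :: o' then walk_word o' (if b then walk_even h F else walk_odd h F) s else F s.

Let sdot (u v : seq R) : R := \sum_(0 <= i < size u) u`_i * v`_i.

Let sdot_cons a b u v : sdot (a :: u) (b :: v) = a * b + sdot u v.
Proof. by rewrite /sdot/= big_nat_recl//. Qed.

(** Each coordinate contributes four sign pairs, with products h, h, -h, -h; the character adds or
    subtracts the last two, giving four times the even or odd part. *)
Lemma cube_sum o (F : R -> R) s :
  \sum_(p <- cube o) \sum_(q <- cube o) p.1 * q.1 * F (s + sdot p.2 q.2) =
  4 ^+ size o * walk_word o F s.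
Proof.
elim: o F => [|b o IH] F.
  by rewrite /= !big_seq1/= /sdot/= big_nil addr0; ring.
rewrite [walk_word _ _ _]/= [size _]/= exprS -mulrA -IH mulr_sumr.
rewrite [cube _]/= big_cat/= !big_map/= -big_split/=; apply: eq_bigr => p _.
rewrite !big_cat/= !big_map/= -!big_split/= mulr_sumr; apply: eq_bigr => q _.
rewrite !sdot_cons !(mulNr, mulrN) opprK -!expr2 sqr_sqrtr//.
rewrite !addrA; have -> : s + h + sdot p.2 q.2 = (s + sdot p.2 q.2) + h by ring.
have -> : s - h + sdot p.2 q.2 = (s + sdot p.2 q.2) - h by ring.
by case: b => /=; rewrite /walk_even /walk_odd ?expr0 ?expr1; field.
Qed.

Lemma cube_size o p : p \in cube o -> size p.2 = size o.
Proof.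
elim: o p => [|b o IH] p /=; first by rewrite inE => /eqP->.
by rewrite mem_cat => /orP[] /mapP[q /IH qo ->]/=; rewrite qo.
Qed.

Lemma cube_norm o p : p \in cube o -> sdot p.2 p.2 = (size o)%:R * h.
Proof.
elim: o p => [|b o IH] p; first by rewrite inE => /eqP->; rewrite /sdot big_nil mul0r.
rewrite [cube _]/= mem_cat => /orP[] /mapP[q /IH qo ->]; rewrite [(_, _).2]/= sdot_cons qo.
  by rewrite -expr2 sqr_sqrtr// -natr1; ring.
by rewrite mulrNN -expr2 sqr_sqrtr// -natr1; ring.
Qed.

(** The k-th coefficient is the sum of [walk_word] over the words with exactly k letters [false]. *)
Lemma walk_poly_coef_ge0 n F s : (forall o, size o = n -> 0 <= walk_word o F s) ->
  forall k, 0 <= (walk_poly h n F s)`_k.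
Proof.
elim: n F => [|n IH] F pF k /=.
  by rewrite coefC; case: ifP => // _; exact: (pF [::]).
rewrite coefD coefXM addr_ge0//.
  by apply: IH => o on; apply: (pF (true :: o)); rewrite /= on.
case: ifP => // _; apply: IH => o on; apply: (pF (false :: o)); rewrite /= on//.
Qed.

End ell2_finite.

(** By [cube_sum] each [walk_word] is, up to a power of 4, a quadratic form of f on cube vertices.
    These are unit vectors, having n + 1 coordinates of square 1 / (n + 1). *)
Lemma bernstein_coef_ge0 (R : realType) (f : R -> R) n k :
  pd_zonal Infinite f -> 0 <= (bernstein_poly f n)`_k.
Proof.
move=> pf; pose h : R := n.+1%:R^-1.
have h0 : 0 <= h by rewrite invr_ge0.
apply: walk_poly_coef_ge0 => o on.
have := cube_sum h0 o (f \o clamp (R := R)) 0; rewrite -(pmulr_rge0 _ (exprn_gt0 (size o) (ltr0n R 4))).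
move=> <-.
have unit p : p \in cube h o -> ell2_dot (ell2_seq p.2) (ell2_seq p.2) = 1.
  by move=> po; rewrite ell2_dot_seq (cube_norm h0 po) on mulfV// pnatr_eq0.
have := pf [seq (p.1, ell2_seq p.2) | p <- cube h o].
rewrite all_map big_map => H.
have /H : all (preim (fun p => (p.1, ell2_seq p.2) : R * euclidean R Infinite)
    (fun p => euclid_dot p.2 p.2 == 1)) (cube h o).
  by apply/allP => p po; apply/eqP; exact: unit.
move=> {}H; apply: le_trans H _; rewrite le_eqVlt; apply/orP; left; apply/eqP.
apply: eq_big_seq => p po; rewrite big_map; apply: eq_big_seq => q qo /=.
rewrite add0r -ell2_dot_seq clampE//.
have := ell2_dot_CS (ell2_seq p.2) (ell2_seq q.2); rewrite !unit// mulr1 => h1.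
by rewrite -ler_norml -(@ler_pXn2r _ 2)// ?nnegrE// expr1n real_normK ?num_real.
Qed.

(** * Schoenberg's theorem on the unit sphere of l^2 *)

(** Limits along one ultrafilter finer than infinity serve for all coefficients at once, in place of
    a diagonal subsequence. *)
Lemma ultra_bounded_cvg (R : realType) (T : Type) (G : set_system T) (b : T -> R) (M : R) :
  UltraFilter G -> (forall n, `|b n| <= M) -> exists l : R, b @ G --> l.
Proof.
move=> uG bM.
have cK := @segment_compact R (- M) M.
have [|l [_ lcl]] := cK (b @ G) _.
  by apply: nearW => n; rewrite /= in_itv/= -ler_norml.
exists l => V Vl.
have [//|nV] := in_ultra_setVsetC (b @^-1` V) uG.
have := lcl (~` V) V nV Vl; rewrite setICl.
by case.
Qed.

Lemma cvg_sumr (K : numFieldType) (V : normedModType K) (I T : Type) (F : set_system T)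
    (s : seq I) (u : I -> T -> V) (l : I -> V) : Filter F -> (forall i, u i @ F --> l i) ->
  (fun x => \sum_(i <- s) u i x) @ F --> \sum_(i <- s) l i.
Proof.
move=> FF ul; elim: s => [|i s IH].
  rewrite big_nil (_ : (fun x => _) = cst 0); first exact: cvg_cst.
  by apply/funext => x; rewrite big_nil.
rewrite big_cons (_ : (fun x => _) = (fun x => u i x + \sum_(j <- s) u j x)).
  exact: cvgD.
by apply/funext => x; rewrite big_cons.
Qed.

Section hilbert_expansion.
Variable R : realType.
Local Notation I11 := `[(-1 : R), 1]%classic.

Lemma tail_poly_le (p : {poly R}) K t : (forall k, 0 <= p`_k) -> -1 <= t <= 1 ->
  `|p.[t] - \sum_(0 <= k < K) p`_k * t ^+ k| <= `|t| ^+ K * p.[1].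
Proof.
move=> p0 t1; have t1' : `|t| <= 1 by rewrite ler_norml.
have hw x : p.[x] = \sum_(0 <= k < K) p`_k * x ^+ k + \sum_(K <= k < K + size p) p`_k * x ^+ k.
  rewrite -big_cat_nat ?leq_addr//= big_mkord.
  by rewrite (@horner_coef_wide _ (K + size p))// leq_addl.
rewrite hw addrC addKr (le_trans (ler_norm_sum _ _ _))// hw mulrDr.
rewrite -[leLHS]add0r lerD//.
  by rewrite mulr_ge0 ?exprn_ge0// sumr_ge0// => k _; rewrite expr1n mulr1.
rewrite mulr_sumr big_nat [leRHS]big_nat; apply: ler_sum => k /andP[Kk _].
rewrite expr1n mulr1 normrM ger0_norm// mulrC ler_wpM2r// normrX.
by rewrite -(subnKC Kk) exprD ler_piMr ?exprn_ge0// exprn_ile1.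
Qed.

Lemma head_poly_le (p : {poly R}) K : (forall k, 0 <= p`_k) ->
  \sum_(0 <= k < K) p`_k <= p.[1].
Proof.
move=> p0; have -> : p.[1] = \sum_(0 <= k < K) p`_k + \sum_(K <= k < K + size p) p`_k.
  rewrite -big_cat_nat ?leq_addr//= big_mkord.
  rewrite (@horner_coef_wide _ (K + size p)) ?leq_addl//.
  by apply: eq_bigr => i _; rewrite expr1n mulr1.
by rewrite lerDl sumr_ge0.
Qed.

(** The coefficients of p_n are bounded by p_n(1), hence have limits a_k along an ultrafilter. For
    |t| < 1 the tails are at most B |t|^K uniformly in n, so the series sums to f(t). Continuity of
    f then forces the a_k to sum to f(1), and absolute convergence carries the identity to t = -1 as
    well. *)
Lemma nonneg_poly_limit (f : R -> R) (p : nat -> {poly R}) :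
  {within I11, continuous f} -> (forall n k, 0 <= (p n)`_k) ->
  (forall t, -1 <= t <= 1 -> (p n).[t] @[n --> \oo] --> f t) ->
  exists2 a : nat -> R, (forall k, 0 <= a k) &
    forall t, -1 <= t <= 1 -> series (fun k => a k * t ^+ k) @ \oo --> f t.
Proof.
move=> cf p0 pf.
have in1 : -1 <= (1 : R) <= 1 by rewrite lexx andbT; lra.
have [G [uG GF]] := @ultraFilterLemma nat \oo _.
have pfG t : -1 <= t <= 1 -> (p n).[t] @[n --> G] --> f t.
  by move=> t1 V Vf; apply: GF; exact: pf.
have [B B0 pB] : exists2 B, 0 <= B & forall n, (p n).[1] <= B.
  have /cvg_seq_bounded := cvgP _ (pf 1 in1).
  move=> [M [_ MP]]; exists (`|M| + 1); first by rewrite addr_ge0.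
  move=> n; rewrite (le_trans (ler_norm _))//; apply: (MP (`|M| + 1)) => //.
  by rewrite (le_lt_trans (ler_norm _))// ltrDl.
have coefB n k : `|(p n)`_k| <= B.
  rewrite ger0_norm// (le_trans _ (pB n))// (le_trans _ (head_poly_le k.+1 (p0 n)))//.
  by rewrite big_nat_recr//= lerDr sumr_ge0.
have aex (k : nat) : exists l : R, (fun n => (p n)`_k) @ G --> l.
  by apply: ultra_bounded_cvg => n; exact: coefB.
have [a aP] := boolp.choice aex.
have a0 k : 0 <= a k.
  by apply: (ler_cvg_to (cvg_cst 0) (aP k)); apply: nearW => n /=.
have sumG K t : (fun n => \sum_(0 <= k < K) (p n)`_k * t ^+ k) @ G --> \sum_(0 <= k < K) a k * t ^+ k.
  by apply: cvg_sumr => k; apply: cvgMr_tmp; exact: aP.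
have tail K t : -1 <= t <= 1 -> `|f t - \sum_(0 <= k < K) a k * t ^+ k| <= `|t| ^+ K * B.
  move=> t1; apply: (ler_cvg_to (cvg_norm (cvgB (pfG t t1) (sumG K t))) (cvg_cst _)).
  apply: nearW => n /=; rewrite (le_trans (tail_poly_le _ (p0 n) t1))//.
  by rewrite ler_wpM2l ?exprn_ge0.
have cvg_in t : -1 < t < 1 -> series (fun k => a k * t ^+ k) @ \oo --> f t.
  move=> t1; have t1' : `|t| < 1 by rewrite ltr_norml.
  apply/cvgrPdist_le => e e0.
  have h : `|t| ^+ K * B @[K --> \oo] --> (0 : R).
    by rewrite -[X in _ --> X](mul0r B); apply: cvgMr_tmp; apply: cvg_expr; rewrite normr_id.
  move/cvgrPdist_le : h => /(_ e e0); apply: filterS => K.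
  rewrite sub0r normrN ger0_norm ?mulr_ge0 ?exprn_ge0// => h.
  by rewrite (le_trans _ h)// /series/= tail//; case/andP: t1 => *; rewrite !ltW.
have aS K : \sum_(0 <= k < K) a k <= f 1.
  apply: (ler_cvg_to (@cvg_sumr _ R _ _ _ (index_iota 0 K) (fun k n => (p n)`_k) a _ aP) (pfG 1 in1)).
  by apply: nearW => n /=; exact: head_poly_le.
(* For x < 1 close to 1, f(x) is near f(1), and the partial sums at x are below those at 1. *)
have aSge e : 0 < e -> exists K, f 1 - e <= \sum_(0 <= k < K) a k.
  move=> e0; have e2 : 0 < e / 2 by rewrite divr_gt0.
  have [d d0 fd] := itv_unif_continuous cf e2.
  pose x := 1 - Num.min (d / 2) (1 / 2).
  have [m0 m1 m2] : [/\ 0 < Num.min (d / 2) (1 / 2), Num.min (d / 2) (1 / 2) <= 1 / 2 &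
       Num.min (d / 2) (1 / 2) <= d / 2].
    by rewrite lt_min divr_gt0// divr_gt0// !ge_min !lexx orbT.
  have x1 : -1 < x < 1 by rewrite /x; apply/andP; split; lra.
  have fx : `|f 1 - f x| < e / 2.
    apply: fd => //; first by case/andP: x1 => ? ?; rewrite !ltW.
    by rewrite /x opprB addrC subrK gtr0_norm//; lra.
  have /cvgrPdist_lt/(_ _ e2)[K _ /(_ K (leqnn K))] := cvg_in x x1.
  rewrite /= => h; exists K.
  have : \sum_(0 <= k < K) a k * x ^+ k <= \sum_(0 <= k < K) a k.
    apply: ler_sum => k _; rewrite ler_piMr// exprn_ile1//; first by rewrite /x; lra.
    by case/andP: x1 => _ /ltW.
  move: h fx; rewrite /series/= !ltr_norml => /andP[_ h1] /andP[_ h2] h3; lra.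
exists a => // t t1.
have [tl|tg] := ltP `|t| 1; first by apply: cvg_in; rewrite -ltr_norml.
apply/cvgrPdist_le => e e0.
have e4 : 0 < e / 4 by rewrite divr_gt0.
have [K0 aK0] := aSge _ e4.
exists K0 => // K /= K0K; rewrite /series/=.
have aK : f 1 - e / 4 <= \sum_(0 <= k < K) a k.
  by rewrite (le_trans aK0)// [leRHS](big_cat_nat (n := K0))//= lerDl sumr_ge0.
have [d d0 fd] := itv_unif_continuous cf e4.
pose m := Num.min (d / 2) (1 / 2).
have [m0 m1 m2] : [/\ 0 < m, m <= 1 / 2 & m <= d / 2].
  by rewrite lt_min divr_gt0// divr_gt0// !ge_min !lexx orbT.
pose x := 1 - m.
have x1 : -1 < x < 1 by rewrite /x; apply/andP; split; lra.
have x1' : -1 <= x <= 1 by case/andP: x1 => ? ?; rewrite !ltW.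
have x0 : 0 <= x by rewrite /x; lra.
have nt : `|t| = 1 by apply/eqP; rewrite eq_le tg ler_norml t1.
have tx1 : -1 < t * x < 1 by rewrite -ltr_norml normrM nt mul1r ger0_norm//; case/andP: x1.
have tx1' : -1 <= t * x <= 1 by case/andP: tx1 => ? ?; rewrite !ltW.
have fx : `|f 1 - f x| < e / 4.
  by apply: fd => //; rewrite /x opprB addrC subrK gtr0_norm//; lra.
have ftx : `|f t - f (t * x)| < e / 4.
  apply: fd => //; rewrite -[X in X - _](mulr1 t) -mulrBr normrM nt mul1r.
  by rewrite /x opprB addrC subrK gtr0_norm//; lra.
(* The difference of the partial sums at t and at t * x, t = +-1, is at most the same
   difference for t = 1. *)
have key L : `|\sum_(0 <= k < L) a k * t ^+ k - \sum_(0 <= k < L) a k * (t * x) ^+ k| <=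
    f 1 - \sum_(0 <= k < L) a k * x ^+ k.
  rewrite (@le_trans _ _ (\sum_(0 <= k < L) a k - \sum_(0 <= k < L) a k * x ^+ k))//; last first.
    by rewrite lerB.
  rewrite -!sumrB (le_trans (ler_norm_sum _ _ _))//; apply: ler_sum => k _.
  have -> : a k * t ^+ k - a k * (t * x) ^+ k = t ^+ k * (a k - a k * x ^+ k) by rewrite exprMn; ring.
  rewrite normrM normrX nt expr1n mul1r ger0_norm// subr_ge0 ler_piMr// exprn_ile1//.
  by case/andP: x1'.
have keyK := key K.
have e8 : 0 < e / 8 by rewrite divr_gt0.
have cx := cvg_in x x1; have ctx := cvg_in (t * x) tx1.
have /cvgrPdist_lt/(_ _ e8)[L1 _ hL1] := cx.
have /cvgrPdist_lt/(_ _ e8)[L2 _ hL2] := ctx.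
pose L := maxn K (maxn L1 L2).
have := hL1 L _; rewrite /= /L !leq_max leqnn !orbT => /(_ isT); rewrite -/L => {}hL1.
have := hL2 L _; rewrite /= /L !leq_max leqnn !orbT => /(_ isT); rewrite -/L => {}hL2.
have KL : (K <= L)%N by rewrite leq_max leqnn.
have hd : `|\sum_(0 <= k < L) a k * t ^+ k - \sum_(0 <= k < K) a k * t ^+ k| <= e / 4.
  rewrite (@big_cat_nat _ _ _ K 0 L)//= addrAC subrr add0r (le_trans (ler_norm_sum _ _ _))//.
  rewrite (@le_trans _ _ (\sum_(K <= k < L) a k))//.
    by apply: ler_sum => k _; rewrite normrM normrX nt expr1n mulr1 ger0_norm.
  by have := aS L; rewrite (@big_cat_nat _ _ _ K 0 L)//=; lra.
have := key L; move: hL1 hL2 hd fx ftx; rewrite /series/= !ltr_norml !ler_norml.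
set s1 := \sum_(0 <= k < L) _; set s2 := \sum_(0 <= k < L) _; set s3 := \sum_(0 <= k < L) _.
move=> /andP[? ?] /andP[? ?] /andP[? ?] /andP[? ?] /andP[? ?] /andP[? ?].
apply/andP; split; lra.
Qed.

Lemma hilbert_expansion (f : R -> R) : {within I11, continuous f} -> pd_zonal Infinite f ->
  exists2 a : nat -> R, (forall k, 0 <= a k) &
    forall t, -1 <= t <= 1 -> series (fun k => a k * t ^+ k) @ \oo --> f t.
Proof.
move=> cf pf; apply: (@nonneg_poly_limit f (bernstein_poly f)) => //.
  by move=> n k; exact: bernstein_coef_ge0.
move=> t t1; apply/cvgrPdist_le => e e0; have [N hN] := bernstein_approx cf e0.
by exists N => // n /= Nn; rewrite distrC hN.
Qed.

End hilbert_expansion.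

(** * Schoenberg's theorem on finite-dimensional spheres *)

Section dominated_series.
Variable R : realType.

Lemma dominated_series_cvg (u b : nat -> R) : (forall n, `|u n| <= b n) ->
  cvgn (series b) -> cvgn (series u).
Proof.
move=> ub cb; apply: normed_cvg; apply: (series_le_cvg _ _ ub cb) => n //.
exact: le_trans (ub n).
Qed.

Lemma dominated_series_tail (u b : nat -> R) N : (forall n, `|u n| <= b n) ->
  cvgn (series b) -> `|limn (series u) - series u N| <= limn (series b) - series b N.
Proof.
move=> ub cb; have cu := dominated_series_cvg ub cb.
apply: (ler_cvg_to (cvg_norm (cvgB cu (cvg_cst _))) (cvgB cb (cvg_cst _))).
exists N => // n /= Nn.
have h : `|series u n - series u N| <= series b n - series b N.
  by rewrite !sub_series_geq// (le_trans (ler_norm_sum _ _ _))// ler_sum.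
exact: h.
Qed.

Lemma series_nneg_cvg (a : nat -> R) M : (forall n, 0 <= a n) ->
  (forall n, series a n <= M) -> cvgn (series a).
Proof.
move=> a0 aM; apply: nondecreasing_is_cvgn.
  by apply/nondecreasing_seqP => n; rewrite /series/= big_nat_recr//= lerDl.
by exists M => _ [n _ <-].
Qed.

Lemma uniform_approx_continuous (A : set R) (g : R -> R) :
  (forall e, 0 < e -> exists2 p : R -> R, {within A, continuous p} &
     forall t, A t -> `|g t - p t| <= e) -> {within A, continuous g}.
Proof.
move=> gp; apply/subspace_continuousP => x Ax; apply/cvgrPdist_le => e e0.
have e3 : 0 < e / 3 by rewrite divr_gt0.
have [p /subspace_continuousP/(_ x Ax) cp gpe] := gp _ e3.
move/cvgrPdist_le : cp => /(_ _ e3); rewrite !near_withinE; apply: filterS => y + Ay => /(_ Ay) h.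
have h1 := gpe x Ax; have h2 := gpe y Ay.
have -> : g x - g y = (g x - p x) + (p x - p y) - (g y - p y) by ring.
rewrite (le_trans (ler_normB _ _))// (@le_trans _ _ (e / 3 + e / 3 + e / 3))//; last lra.
by rewrite lerD// (le_trans (ler_normD _ _))// lerD.
Qed.

End dominated_series.

Section ultraspherical_bound.
Variables (R : realType) (m : nat).
Local Notation C := (ultraspherical (m%:R : R)).
Local Notation I11 := `[(-1 : R), 1]%classic.

Lemma unit_pair t : -1 <= t <= 1 -> exists x y : 'rV[R]_m.+2,
  [/\ dot x x = 1, dot y y = 1 & dot x y = t].
Proof.
move=> t1; have sq : Num.sqrt (1 - t ^+ 2) ^+ 2 = 1 - t ^+ 2.
  by rewrite sqr_sqrtr// expr2; case/andP: t1 => ? ?; nra.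
have d0 : dot (delta_mx 0 ord0 : 'rV[R]_m.+1) (delta_mx 0 ord0) = 1.
  rewrite /dot (bigD1 ord0)//= big1 ?addr0; last by move=> i /negbTE i0; rewrite !mxE eqxx i0 mulr0.
  by rewrite !mxE !eqxx mulr1.
exists (sphere_point 1 0), (sphere_point t (delta_mx 0 ord0)).
have e1 z : \row_i sphere_point (1 : R) (0 : 'rV[R]_m.+1) 0 (lift ord0 i) = z *: 0 :> 'rV[R]_m.+1.
  by apply/rowP => i; rewrite !mxE liftK mxE !mulr0.
have z0 (v : 'rV[R]_m.+1) : dot 0 v = 0 by rewrite /dot big1// => i _; rewrite mxE mul0r.
split.
- by rewrite dot_sphere_point mxE unlift_none (e1 0) scaler0 z0 mulr0 addr0 mulr1.
- rewrite dot_sphere_point mxE unlift_none.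
  rewrite (_ : \row_i _ = Num.sqrt (1 - t ^+ 2) *: delta_mx 0 ord0); last first.
    by apply/rowP => i; rewrite !mxE liftK !mxE.
  by rewrite dotZl d0 mulr1 -[_ * Num.sqrt _]expr2 sq expr2; ring.
- by rewrite dot_sphere_point mxE unlift_none (e1 0) scaler0 z0 mulr0 addr0 mul1r.
Qed.

(** Cauchy-Schwarz for the reproducing kernel: C_n(<x, y>) is, up to a positive constant, an inner
    product of zonal functions at x and y, whose squared norms are both given by C_n(1) = 1. *)
Lemma ultraspherical_le1 n t : -1 <= t <= 1 -> `|(C n).[t]| <= 1.
Proof.
move=> t1; have [x [y [x1 y1 xy]]] := unit_pair t1.
have [s cub] := cubature_exists R m.+1 (4 * n.+1).
have h0 := sphere_mean_sqr_gt0 R m n.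
rewrite -(ler_pM2l h0) mulr1 -[X in X * _](gtr0_norm h0) -normrM -xy -(zonal_reproducing cub)//.
have [s0 _ _] := cub.
rewrite (le_trans (ler_norm_sum _ _ _))//.
have hx (v : 'rV[R]_m.+2) : dot v v = 1 ->
    \sum_(z <- s) z.1 * ((C n).[dot v z.2] * (C n).[dot v z.2]) = sphere_mean m (C n * C n).
  by move=> v1; rewrite (zonal_reproducing cub)// v1 ultraspherical1// mulr1.
have -> : sphere_mean m (C n * C n) = \sum_(z <- s) z.1 *
    (((C n).[dot x z.2] * (C n).[dot x z.2] + (C n).[dot y z.2] * (C n).[dot y z.2]) / 2).
  transitivity ((sphere_mean m (C n * C n) + sphere_mean m (C n * C n)) / 2); first by field.
  rewrite -{1}(hx x x1) -(hx y y1) -big_split/= mulr_suml; apply: eq_bigr => z _; ring.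
rewrite big_seq [leRHS]big_seq; apply: ler_sum => z zs.
have z0 : 0 <= z.1 by exact: (allP s0).
rewrite normrM ger0_norm// ler_wpM2l//.
move: (C n).[_] (C n).[_] => a b; rewrite ler_norml; apply/andP; split.
  by have := sqr_ge0 (a + b); rewrite expr2; lra.
by have := sqr_ge0 (a - b); rewrite expr2; lra.
Qed.

End ultraspherical_bound.

Section finite_expansion.
Variables (R : realType) (m : nat).
Local Notation l := (m%:R / 2 : R).
Local Notation C := (ultraspherical (m%:R : R)).
Local Notation I11 := `[(-1 : R), 1]%classic.
Local Notation J := (weighted_integral l).

Let l0 : l = 0 \/ 2^-1 <= l.
Proof.
by case: m => [|n]; [left; rewrite mul0r|right; rewrite ler_pdivlMr// mulVf// ler1n].
Qed.

Definition zonal_integral (f : R -> R) : R := J f / J (horner 1).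
Local Notation I := zonal_integral.

Let J1 : 0 < J (horner 1). Proof. exact: weighted_integral1_gt0. Qed.

Lemma zonal_integralD (f g : R -> R) (c : R) : {within I11, continuous f} ->
  {within I11, continuous g} -> I (fun x => f x + c * g x) = I f + c * I g.
Proof.
move=> cf cg; rewrite /I weighted_integralD//; last first.
  by move=> x; apply: cvgMl_tmp; exact: cg.
by rewrite weighted_integralZ// mulrDl mulrA.
Qed.

Lemma eq_zonal_integral (f g : R -> R) : (forall x, -1 <= x <= 1 -> f x = g x) -> I f = I g.
Proof. by move=> fg; rewrite /I (eq_weighted_integral _ fg). Qed.

Lemma zonal_integral_horner (p : {poly R}) : I (horner p) = sphere_mean m p.
Proof. by []. Qed.

Lemma zonal_integral_norm (f : R -> R) M : {within I11, continuous f} ->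
  (forall x, -1 <= x <= 1 -> `|f x| <= M) -> `|I f| <= M.
Proof.
move=> cf fM.
have cM : {within I11, continuous (fun x => M * (horner 1 x))}.
  by move=> x; apply: cvgMl_tmp; exact: within_horner.
have cM' : {within I11, continuous (fun x => - M * (horner 1 x))}.
  by move=> x; apply: cvgMl_tmp; exact: within_horner.
rewrite /I normrM [`|_^-1|]gtr0_norm ?invr_gt0// ler_pdivrMr// ler_norml.
have h x : -1 <= x <= 1 -> - M <= f x <= M by move=> /fM; rewrite ler_norml.
rewrite -mulNr -weighted_integralZ//; last exact: within_horner.
rewrite -weighted_integralZ//; last exact: within_horner.
by apply/andP; split; apply: le_weighted_integral => // x x1; rewrite hornerC mulr1;
  case/andP: (h x x1).
Qed.

Lemma withinM (f g : R -> R) : {within I11, continuous f} -> {within I11, continuous g} ->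
  {within I11, continuous (fun x => f x * g x)}.
Proof. by move=> cf cg x; apply: cvgM; [exact: cf|exact: cg]. Qed.

Lemma withinD (f g : R -> R) : {within I11, continuous f} -> {within I11, continuous g} ->
  {within I11, continuous (fun x => f x + g x)}.
Proof. by move=> cf cg x; apply: cvgD; [exact: cf|exact: cg]. Qed.

Lemma withinB (f g : R -> R) : {within I11, continuous f} -> {within I11, continuous g} ->
  {within I11, continuous (fun x => f x - g x)}.
Proof. by move=> cf cg x; apply: cvgB; [exact: cf|exact: cg]. Qed.

Local Notation h i := (sphere_mean m (C i * C i)).
Local Notation c f i := (I (fun x => f x * (C i).[x])).

Let coef_close (f g : R -> R) e i : {within I11, continuous f} -> {within I11, continuous g} ->
  (forall x, -1 <= x <= 1 -> `|f x - g x| <= e) -> `|c f i - c g i| <= e.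
Proof.
move=> cf cg fg.
have -> : c f i - c g i = I (fun x => (f x - g x) * (C i).[x]).
  rewrite -mulN1r -zonal_integralD; try by apply: withinM => //; exact: within_horner.
  by apply: eq_zonal_integral => x _; ring.
apply: zonal_integral_norm => [|x x1].
  by apply: withinM; [exact: withinB|exact: within_horner].
rewrite normrM (le_trans _ (fg x x1))// ler_piMr//.
exact: ultraspherical_le1.
Qed.

Let mean_coef (p : nat -> R) n i : (i < n)%N ->
  sphere_mean m ((\sum_(j < n) p j *: C j) * C i) = p i * h i.
Proof.
move=> lin; rewrite mulr_suml linear_sum/= (bigD1 (Ordinal lin))//= big1 ?addr0.
  by rewrite -scalerAl linearZ.
by move=> j ji; rewrite -scalerAl linearZ/= sphere_mean_orth ?scaler0.
Qed.

Let coef_poly (p : nat -> R) n i : (i < n)%N ->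
  c (horner (\sum_(j < n) p j *: C j)) i = p i * h i.
Proof.
move=> /mean_coef <-.
by rewrite -zonal_integral_horner; apply: eq_zonal_integral => x _; rewrite hornerM.
Qed.

(* The value of f at (nu, nu) for nu = delta_e + q(<e, .>) sigma, sigma being the normalized
   surface measure and q the sum of the q i *: C i; here it is computed with a cubature. *)
Let pd_poly (f : R -> R) (q : nat -> R) n e : {within I11, continuous f} ->
  pd_zonal (Fin m.+2) f -> 0 < e ->
  0 <= f 1 + \sum_(i < n) (2 * q i + q i ^+ 2 * h i) * c f i +
    e * ((1 + \sum_(i < n) `|q i|) ^+ 2 + 1 + \sum_(i < n) `|2 * q i + q i ^+ 2 * h i|).
Proof.
move=> cf pf e0.
have [N0 /(_ N0 _ (leqnn N0)) pfe] := bernstein_approx cf e0.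
(* P exceeds the degrees of both Q and B; degree 4 (P + 1) lets the cubature reproduce all C_i with
   i < P. *)
pose P := (n + size (bernstein_poly f N0))%N.
have [p pE] := @ultraspherical_basis R m%:R (ler0n _ _) (bernstein_poly f N0) P (leq_addl _ _).
rewrite pE in pfe; set B := \sum_(i < P) p i *: C i in pfe.
have [s cub] := cubature_exists R m.+1 (4 * P.+1).
have [s0 s1 _] := cub.
have [|u [_ [u1 _ _]]] := @unit_pair R m 0; first by rewrite lerN10 ler01.
pose Q := \sum_(i < n) q i *: C i.
have zu z : z \in s -> dot z.2 z.2 = 1 by move=> zs; apply/eqP/(allP s1).
have reprod i j x y : (i < P)%N -> (j < P)%N -> dot x x = 1 -> dot y y = 1 ->
   \sum_(z <- s) z.1 * ((C i).[dot x z.2] * (C j).[dot y z.2]) =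
   (i == j)%:R * h i * (C i).[dot x y].
  move=> iP jP x1 y1; have [<-|ij] := eqVneq i j.
    by rewrite (zonal_reproducing cub)// ?mul1r//; lia.
  by rewrite (zonal_orthogonal cub)// ?mul0r//; lia.
have dotu (x y : 'rV[R]_m.+2) : dot x x = 1 -> dot y y = 1 -> -1 <= dot x y <= 1.
  move=> x1 y1.
  have dot0 (v : 'rV[R]_m.+2) : 0 <= dot v v.
    by apply: sumr_ge0 => i _; exact: (sqr_ge0 (v 0 i)).
  have a1 := dot0 (x + y); have a2 := dot0 (x + (-1) *: y).
  move: a1 a2; rewrite !dotDl ![dot _ (_ + _)]dotC !dotDl !dotZl ![dot _ ((-1) *: _)]dotC !dotZl.
  rewrite x1 y1 (dotC y x) => a1 a2; apply/andP; split; lra.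
have sum1 : \sum_(z <- s) z.1 = 1.
  rewrite -(sphere_mean1 R m) -(zonal_mean cub _ u1); last by rewrite size_poly1.
  by apply: eq_bigr => z _; rewrite hornerC mulr1.
pose D := \sum_(i < n) `|q i|.
have D0 : 0 <= D by apply: sumr_ge0.
have QD t : -1 <= t <= 1 -> `|Q.[t]| <= D.
  move=> t1; rewrite horner_sum (le_trans (ler_norm_sum _ _ _))//; apply: ler_sum => i _.
  by rewrite hornerZ normrM ler_piMr// ultraspherical_le1.
(* The form at (nu, nu) with g in place of f: Dirac with Dirac, twice the cross term, density with
   density. *)
pose F (g : R -> R) := g 1 + 2 * (\sum_(z <- s) z.1 * Q.[dot u z.2] * g (dot u z.2)) +
  \sum_(z <- s) \sum_(y <- s) (z.1 * Q.[dot u z.2]) * (y.1 * Q.[dot u y.2]) * g (dot z.2 y.2).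
have F0 : 0 <= F f.
  have := pf ((1, u) :: [seq (z.1 * Q.[dot u z.2], z.2) | z <- s]).
  rewrite /= all_map; set A := _ && _ => H.
  have /H : A.
    rewrite /A; apply/andP; split; first exact/eqP.
    by apply/allP => z zs /=; apply/eqP; exact: zu.
  rewrite !big_cons !big_map/= -/(dot u u) u1.
  under [X in _ + X]eq_bigr do rewrite big_cons big_map/=.
  rewrite big_split/= mulr1 mul1r.
  move=> {}H; apply: le_trans H _; rewrite /F le_eqVlt; apply/orP; left; apply/eqP.
  set S := \sum_(z <- s) z.1 * _ * _; set D' := \sum_(z <- s) \sum_(y <- s) _.
  have -> : \sum_(j <- s) 1 * (j.1 * Q.[dot u j.2]) * f (\sum_(i < m.+2) u 0 i * j.2 0 i) = S.
    by apply: eq_bigr => z _; rewrite mul1r.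
  have -> : \sum_(i <- s) i.1 * Q.[dot u i.2] * 1 * f (\sum_(i0 < m.+2) i.2 0 i0 * u 0 i0) = S.
    by apply: eq_bigr => z _; rewrite mulr1 -/(dot z.2 u) [dot z.2 u]dotC.
  by rewrite addrA; congr (_ + _); ring.
(* The total mass of |nu| is at most 1 + D, because the cubature weights are nonnegative with sum 1
   and |Q| <= D on [-1, 1]. *)
have Fclose : `|F f - F (horner B)| <= e * (1 + D) ^+ 2.
  pose g x := f x - B.[x].
  have gE : F f - F (horner B) = F g.
    rewrite /F /g !opprD addrACA; congr (_ + _).
      rewrite addrACA -mulrBr -sumrB; congr (_ + 2 * _).
      by apply: eq_bigr => z _; rewrite mulrBr.
    rewrite -sumrB; apply: eq_bigr => z _; rewrite -sumrB; apply: eq_bigr => y _.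
    by rewrite mulrBr.
  have ge x : -1 <= x <= 1 -> `|g x| <= e by move=> x1; rewrite /g distrC pfe.
  rewrite gE /F (le_trans (ler_normD _ _))//.
  have -> : e * (1 + D) ^+ 2 = (e + 2 * (D * e)) + D ^+ 2 * e by ring.
  have wQ z : z \in s -> `|z.1 * Q.[dot u z.2]| <= z.1 * D.
    move=> zs; have z0 : 0 <= z.1 by exact: (allP s0).
    by rewrite normrM ger0_norm// ler_wpM2l// QD// dotu// zu.
  apply: lerD.
    rewrite (le_trans (ler_normD _ _))// lerD//; first by apply: ge; rewrite lexx andbT; lra.
    rewrite normrM ger0_norm// ler_wpM2l// (le_trans (ler_norm_sum _ _ _))//.
    rewrite -[D]mul1r -sum1 !mulr_suml big_seq [leRHS]big_seq; apply: ler_sum => z zs.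
    by rewrite normrM ler_pM// ?wQ// ge// dotu// zu.
  rewrite (le_trans (ler_norm_sum _ _ _))//.
  have -> : D ^+ 2 * e = \sum_(z <- s) (z.1 * D) * (D * e).
    by rewrite -mulr_suml -mulr_suml sum1; ring.
  rewrite big_seq [leRHS]big_seq; apply: ler_sum => z zs.
  rewrite (le_trans (ler_norm_sum _ _ _))//.
  have -> : z.1 * D * (D * e) = \sum_(y <- s) (z.1 * D) * (y.1 * D) * e.
    by rewrite -mulr_suml -mulr_sumr -mulr_suml sum1; ring.
  rewrite big_seq [leRHS]big_seq; apply: ler_sum => y ys.
  rewrite normrM; apply: ler_pM => //; last by rewrite ge// dotu// zu.
  by rewrite normrM; apply: ler_pM => //; exact: wQ.
(* For the polynomial B the reproducing property diagonalises the form in the basis of the C_i. *)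
have FB : F (horner B) = B.[1] + \sum_(i < n) (2 * q i + q i ^+ 2 * h i) * c (horner B) i.
  have nP i : (i < n)%N -> (i < P)%N by move=> lin; rewrite (leq_trans lin)// leq_addr.
  have in1 (z : R * 'rV[R]_m.+2) : z \in s -> \sum_(y <- s) y.1 * (Q.[dot u y.2] * B.[dot z.2 y.2]) =
     \sum_(i < n) q i * p i * h i * (C i).[dot u z.2].
    move=> zs; under eq_bigr => y _.
      rewrite /Q horner_sum mulr_suml mulr_sumr.
      under eq_bigr => i _.
        rewrite /B horner_sum hornerZ mulr_sumr mulr_sumr.
        under eq_bigr => j _ do rewrite hornerZ.
        over.
      over.
    rewrite exchange_big/=; apply: eq_bigr => i _.
    rewrite exchange_big/= (bigD1 (Ordinal (nP i (ltn_ord i))))//= [X in _ + X]big1 ?addr0.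
      transitivity (q i * p i * \sum_(y <- s) y.1 * ((C i).[dot u y.2] * (C i).[dot z.2 y.2])).
        by rewrite mulr_sumr; apply: eq_bigr => y _; ring.
      by rewrite reprod ?nP// ?zu// eqxx mul1r mulrA.
    move=> j ji; transitivity (q i * p j * \sum_(y <- s) y.1 * ((C i).[dot u y.2] * (C j).[dot z.2 y.2])).
      by rewrite mulr_sumr; apply: eq_bigr => y _; ring.
    have ij : ((i : nat) == j) = false by apply/negbTE; rewrite eq_sym; exact: ji.
    by rewrite (reprod i j u z.2 (nP i (ltn_ord i)) (ltn_ord j) u1 (zu z zs)) ij !mul0r mulr0.
  have in2 : \sum_(z <- s) z.1 * (Q.[dot u z.2] * B.[dot u z.2]) = \sum_(i < n) q i * p i * h i.
    transitivity (sphere_mean m (Q * B)).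
      rewrite -(zonal_mean cub _ u1); first by apply: eq_bigr => z _; rewrite hornerM.
      rewrite (leq_trans (size_polyMleq _ _))//.
      have sS k (v : nat -> R) : (k <= P)%N -> (size (\sum_(i < k) v i *: C i)%R <= P)%N.
        move=> kP; rewrite (leq_trans (size_sum _ _ _))//; apply/bigmax_leqP => i _.
        by rewrite (leq_trans (size_scale_leq _ _))// size_ultraspherical// (leq_trans (ltn_ord i)).
      have := sS n q (leq_addr _ _); have := sS P p (leqnn P); rewrite -/B -/Q; lia.
    rewrite /Q mulr_suml linear_sum; apply: eq_bigr => i _.
    rewrite -scalerAl linearZ/= [C i * B]mulrC mean_coef ?nP// /GRing.scale/=; ring.
  have in3 : \sum_(z <- s) \sum_(y <- s) (z.1 * Q.[dot u z.2]) * (y.1 * Q.[dot u y.2]) * B.[dot z.2 y.2] =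
      \sum_(i < n) q i ^+ 2 * p i * h i ^+ 2.
    transitivity (\sum_(z <- s) z.1 * ((\sum_(i < n) (q i * p i * h i) *: C i) * Q).[dot u z.2]).
      apply: eq_big_seq => z zs.
      transitivity (z.1 * Q.[dot u z.2] * \sum_(y <- s) y.1 * (Q.[dot u y.2] * B.[dot z.2 y.2])).
        by rewrite mulr_sumr; apply: eq_bigr => y _; ring.
      rewrite in1// hornerM (_ : (\sum_(i < n) (q i * p i * h i) *: C i).[_] =
        \sum_(i < n) q i * p i * h i * (C i).[dot u z.2]); last first.
        by rewrite horner_sum; apply: eq_bigr => i _; rewrite hornerZ.
      by rewrite -mulrA [Q.[_] * _]mulrC.
    rewrite (zonal_mean cub _ u1); last first.
      rewrite (leq_trans (size_polyMleq _ _))//.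
      have sS k (v : nat -> R) : (k <= P)%N -> (size (\sum_(i < k) v i *: C i)%R <= P)%N.
        move=> kP; rewrite (leq_trans (size_sum _ _ _))//; apply/bigmax_leqP => i _.
        by rewrite (leq_trans (size_scale_leq _ _))// size_ultraspherical// (leq_trans (ltn_ord i)).
      have := sS n q (leq_addr _ _).
      have := sS n (fun i => q i * p i * h i) (leq_addr _ _); rewrite -/Q; lia.
    rewrite mulr_suml linear_sum; apply: eq_bigr => i _.
    rewrite -scalerAl linearZ/= [C i * Q]mulrC mean_coef// /GRing.scale/=; ring.
  rewrite /F in3 -addrA; congr (_ + _).
  under eq_bigr do rewrite -mulrA.
  rewrite in2 mulr_sumr -big_split/=; apply: eq_bigr => i _.
  by rewrite coef_poly ?nP//; ring.
have Bclose : `|(f 1 + \sum_(i < n) (2 * q i + q i ^+ 2 * h i) * c f i) - F (horner B)| <=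
    e * (1 + \sum_(i < n) `|2 * q i + q i ^+ 2 * h i|).
  rewrite FB opprD addrACA -sumrB mulrDr mulr1 (le_trans (ler_normD _ _))// lerD//.
    by rewrite distrC pfe// lexx andbT; lra.
  rewrite mulr_sumr (le_trans (ler_norm_sum _ _ _))//; apply: ler_sum => i _.
  rewrite -mulrBr normrM mulrC ler_wpM2r// coef_close//; first exact: within_horner.
  by move=> x x1; rewrite distrC pfe.
move: Bclose Fclose F0; rewrite !ler_norml => /andP[h1 _] /andP[_ h2] h3.
rewrite -/D; nra.
Qed.

(** With q equal to t at i and 0 elsewhere, [pd_poly] gives 0 <= f(1) + (2 t + t^2 h) c in the
    limit. If c < 0, the chosen t makes 2 t c = -2 (|f(1)| + 1), which is absurd. *)
Lemma zonal_coef_ge0 (f : R -> R) i : {within I11, continuous f} ->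
  pd_zonal (Fin m.+2) f -> 0 <= c f i.
Proof.
move=> cf pf; rewrite leNgt; apply/negP => ci.
pose t := (`|f 1| + 1) / - c f i.
have t0 : 0 <= t by rewrite divr_ge0 ?addr_ge0// oppr_ge0 ltW.
have : f 1 + (2 * t + t ^+ 2 * h i) * c f i >= 0.
  apply/ler_addgt0Pr => e e0; rewrite addrC.
  pose q j := if j == i then t else 0.
  pose K := (1 + \sum_(j < i.+1) `|q j|) ^+ 2 + 1 + \sum_(j < i.+1) `|2 * q j + q j ^+ 2 * h j|.
  have K0 : 0 < K by rewrite ltr_wpDr ?sumr_ge0// ltr_wpDl ?sqr_ge0.
  have := @pd_poly f q i.+1 (e / K) cf pf (divr_gt0 e0 K0); rewrite -/K divfK ?gt_eqF//.
  rewrite big_ord_recr/= big1 ?add0r; last first.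
    by move=> j _; rewrite /q ltn_eqF// expr0n/= mulr0 mul0r addr0 mul0r.
  by rewrite /q eqxx addrC.
have h0 := sphere_mean_sqr_gt0 R m i.
have : 2 * t * c f i = - 2 * (`|f 1| + 1) by rewrite /t; field; rewrite lt_eqF.
have : t ^+ 2 * h i * c f i <= 0 by apply: mulr_ge0_le0; [apply: mulr_ge0; [exact: sqr_ge0|exact: ltW]|exact: ltW].
have := ler_norm (f 1); rewrite mulrDl; have := normr_ge0 (f 1); lra.
Qed.

(** The choice q_j = -1 / h_j minimises 2 q + q^2 h_j, with value -1 / h_j: the Dirac mass minus its
    projection onto degrees below n. *)
Lemma zonal_coef_sum (f : R -> R) n : {within I11, continuous f} ->
  pd_zonal (Fin m.+2) f -> \sum_(i < n) c f i / h i <= f 1.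
Proof.
move=> cf pf; rewrite -subr_ge0; apply/ler_addgt0Pr => e e0.
pose q j := - (h j)^-1.
pose K := (1 + \sum_(j < n) `|q j|) ^+ 2 + 1 + \sum_(j < n) `|2 * q j + q j ^+ 2 * h j|.
have K0 : 0 < K by rewrite ltr_wpDr ?sumr_ge0// ltr_wpDl ?sqr_ge0.
have := @pd_poly f q n (e / K) cf pf (divr_gt0 e0 K0); rewrite -/K divfK ?gt_eqF//.
rewrite -sumrN; congr (0 <= _ + _ + _); apply: eq_bigr => i _.
have h0 := sphere_mean_sqr_gt0 R m i.
by rewrite /q; field; rewrite gt_eqF.
Qed.

(** g is orthogonal to all polynomials, hence to its Bernstein approximations, so the integral of
    g^2 is arbitrarily small and thus 0. *)
Lemma zonal_integral_eq0 (g : R -> R) : {within I11, continuous g} ->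
  (forall i, c g i = 0) -> forall t, -1 <= t <= 1 -> g t = 0.
Proof.
move=> cg g0.
have cgp (p : {poly R}) : {within I11, continuous (fun x => g x * p.[x])}.
  by apply: withinM => //; exact: within_horner.
have gp (p : {poly R}) : I (fun x => g x * p.[x]) = 0.
  have [a ->] := @ultraspherical_basis R m%:R (ler0n _ _) p (size p) (leqnn _).
  elim: (size p) => [|n IH].
    have := zonal_integralD (-1) (cgp 1) (cgp 1); rewrite mulN1r subrr => <-.
    by apply: eq_zonal_integral => x _; rewrite big_ord0 !hornerC; ring.
  rewrite -[RHS]IH -[RHS]addr0 -(mulr0 (a n)) -(g0 n) -zonal_integralD//.
  by apply: eq_zonal_integral => x _; rewrite big_ord_recr/= hornerD hornerZ; ring.
have [M M0 gM] := itv_bounded cg.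
have Ig0 : I (fun x => g x * g x) = 0.
  apply/eqP; rewrite -normr_eq0 eq_le normr_ge0 andbT; apply/ler_addgt0Pl => e e0.
  have eM : 0 < e / M by rewrite divr_gt0.
  have [N /(_ N _ (leqnn N)) pg] := bernstein_approx cg eM.
  rewrite addr0; pose B := bernstein_poly g N.
  have -> : I (fun x => g x * g x) = I (fun x => g x * (g x - B.[x])).
    rewrite -[LHS]addr0 -(mulr0 (-1)) -(gp B) -zonal_integralD//; last exact: withinM.
    by apply: eq_zonal_integral => x _; ring.
  apply: zonal_integral_norm => [|x x1].
    by apply: withinM => //; apply: withinB => //; exact: within_horner.
  have -> : e = M * (e / M) by rewrite mulrC divfK// gt_eqF.
  by rewrite normrM ler_pM// ?gM// distrC pg.
have := weighted_integral_eq0 l0 (withinM cg cg) (fun x _ => sqr_ge0 (g x)) _.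
move=> h t t1; have {}h := h _ t t1.
apply/eqP; have : g t * g t = 0.
  apply: h; move: Ig0; rewrite /I => /eqP; rewrite mulf_eq0 invr_eq0 (gt_eqF J1) orbF => /eqP.
  by [].
by move/eqP; rewrite mulf_eq0 orbb.
Qed.

(** The bound |C_n| <= 1 makes the series converge uniformly, so continuity passes to the sum and
    the coefficients can be integrated termwise. *)
Lemma zonal_coef_series (a : nat -> R) (g : R -> R) (b : nat -> R) i :
  (forall n, `|a n| <= b n) -> cvgn (series b) ->
  (forall t, -1 <= t <= 1 -> series (fun n => a n * (C n).[t]) @ \oo --> g t) ->
  {within I11, continuous g} /\ c g i = a i * h i.
Proof.
move=> ab cb ag.
have tail K t : -1 <= t <= 1 ->
    `|g t - (\sum_(j < K) a j *: C j).[t]| <= limn (series b) - series b K.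
  move=> t1; have ub n : `|a n * (C n).[t]| <= b n.
    by rewrite normrM (le_trans _ (ab n))// ler_piMr// ultraspherical_le1.
  have := dominated_series_tail K ub cb; rewrite (cvg_lim _ (ag t t1))//.
  rewrite (_ : (\sum_(j < K) a j *: C j).[t] = series (fun n => a n * (C n).[t]) K)//.
  by rewrite horner_sum /series/= big_mkord; apply: eq_bigr => j _; rewrite hornerZ.
have small (e : R) : 0 < e -> exists2 K, (i < K)%N & (limn (series b) : R) - series b K <= e.
  move=> e0; have /cvgrPdist_le/(_ _ e0)[K _ hK] := cb.
  exists (maxn K i.+1); first by rewrite leq_max leqnn orbT.
  have := hK (maxn K i.+1); rewrite /= leq_maxl => /(_ isT).
  by apply: le_trans; rewrite ler_norm.
have cg : {within I11, continuous g}.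
  apply: (@uniform_approx_continuous R I11 g) => e e0; have [K _ Ke] := small e e0.
  exists (horner (\sum_(j < K) a j *: C j)); first exact: within_horner.
  by move=> t t1; rewrite (le_trans (tail K t t1)).
split => //; apply/eqP; rewrite -subr_eq0 -normr_eq0 eq_le normr_ge0 andbT.
apply/ler_addgt0Pl => e e0; rewrite addr0.
have [K iK Ke] := small e e0.
rewrite -(@coef_poly a K i iK); apply: coef_close => //; first exact: within_horner.
by move=> t t1; rewrite (le_trans (tail K t t1)).
Qed.

(** The coefficients are nonnegative with partial sums at most f(1), so the series converges to a
    continuous g with the same coefficients as f; [zonal_integral_eq0] then gives f = g. *)
Lemma sphere_expansion (f : R -> R) : {within I11, continuous f} ->
  pd_zonal (Fin m.+2) f ->
  exists2 a : nat -> R, (forall n, 0 <= a n) &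
    forall t, -1 <= t <= 1 -> series (fun n => a n * (C n).[t]) @ \oo --> f t.
Proof.
move=> cf pf; pose a i := c f i / h i.
have h0 i : 0 < h i by exact: sphere_mean_sqr_gt0.
have a0 n : 0 <= a n by rewrite divr_ge0 ?zonal_coef_ge0// ltW.
have ca : cvgn (series a).
  apply: (series_nneg_cvg (M := f 1)) => // n.
  by rewrite /series/= big_mkord zonal_coef_sum.
have aa n : `|a n| <= a n by rewrite ger0_norm.
pose g t := limn (series (fun n => a n * (C n).[t])).
have ag t : -1 <= t <= 1 -> series (fun n => a n * (C n).[t]) @ \oo --> g t.
  move=> t1; apply: (dominated_series_cvg _ ca) => n.
  by rewrite normrM ger0_norm// ler_piMr// ultraspherical_le1.
have cg : {within I11, continuous g} by case: (zonal_coef_series 0 aa ca ag).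
exists a => // t t1.
have : f t - g t = 0.
  apply: (@zonal_integral_eq0 (fun x => f x - g x)) => //; first exact: withinB.
  move=> i; have [_ gi] := zonal_coef_series i aa ca ag.
  transitivity (c f i + -1 * c g i).
    rewrite -zonal_integralD; try by apply: withinM => //; exact: within_horner.
    by apply: eq_zonal_integral => x _; ring.
  by rewrite gi /a divfK ?gt_eqF// mulN1r subrr.
by move/eqP; rewrite subr_eq0 => /eqP ->; exact: ag.
Qed.

Lemma sphere_expansion_unique (a b : nat -> R) : (forall n, `|a n| <= b n) -> cvgn (series b) ->
  (forall t, -1 <= t <= 1 -> series (fun n => a n * (C n).[t]) @ \oo --> (0 : R)) ->
  forall n, a n = 0.
Proof.
move=> ab cb a0 n; have [_ e] := zonal_coef_series n ab cb (a0 : forall t, _ -> _ --> (fun=> 0 : R) t).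
apply: (mulIf (lt0r_neq0 (sphere_mean_sqr_gt0 R m n))); rewrite mul0r -e.
have c0 : {within I11, continuous (fun=> 0 : R)} by move=> x; exact: cvg_cst.
transitivity (I (fun=> 0 : R) + -1 * I (fun=> 0 : R)); last by rewrite mulN1r subrr.
by rewrite -zonal_integralD//; apply: eq_zonal_integral => x _; ring.
Qed.

End finite_expansion.

(** * Uniqueness of power series, and identification of the Gegenbauer polynomials *)

Section power_series.
Variable R : realType.

(** By strong induction the coefficients below N vanish, and convergence at 1/2 bounds the later
    ones by M 2^n; for small z the N-th term must then be of the order of z^(N+1). *)
Lemma power_series_eq0 (w : nat -> R) :
  (forall z : R, 0 < z < 1 -> series (fun n => w n * z ^+ n) @ \oo --> (0 : R)) ->
  forall n, w n = 0.
Proof.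
move=> w0.
have [M wM] : exists M : R, forall n, `|w n * 2^-1 ^+ n| <= M.
  have h : 0 < (2^-1 : R) < 1 by apply/andP; split; lra.
  have c0 := cvg_series_cvg_0 (cvgP _ (w0 _ h)).
  have /cvg_seq_bounded := cvgP _ c0; move=> [M [_ HM]].
  exists (M + 1) => n; apply: HM => //; first by rewrite ltrDl.
have M0 : 0 <= M by exact: le_trans (wM 0%N).
have wM2 n : `|w n| <= M * 2 ^+ n.
  by have := wM n; rewrite normrM normrX [`|2^-1|]ger0_norm ?invr_ge0// exprVn ler_pdivrMr ?exprn_gt0.
elim/ltn_ind => N IH; apply/eqP; rewrite -normr_eq0 eq_le normr_ge0 andbT.
(* The geometric tail M (2 z)^(N+1) / (1 - 2 z) is at most A z^(N+1) when z <= 1/4; the last factor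
   2 absorbs 1 / (1 - 2 z). *)
pose A := M * 2 ^+ N.+2.
have A0 : 0 <= A by rewrite mulr_ge0// exprn_ge0.
apply/ler_addgt0Pl => e e0; rewrite addr0.
pose z := Num.min (1/4) (e / (A + 1)).
have eA : 0 < e / (A + 1) by rewrite divr_gt0// ltr_wpDl.
have z0 : 0 < z by rewrite lt_min eA andbT divr_gt0.
have z4 : z <= 1/4 by rewrite ge_min lexx.
have ze : z * A <= e.
  apply: (@le_trans _ _ (e / (A + 1) * A)); first by rewrite ler_wpM2r// ge_min lexx orbT.
  by rewrite mulrAC ler_pdivrMr ?ltr_wpDl// (ler_wpM2l (ltW e0))// lerDl.
have ub n : `|w n * z ^+ n| <= geometric M (2 * z) n.
  by rewrite normrM normrX (gtr0_norm z0) /= exprMn mulrA ler_wpM2r// exprn_ge0// ltW.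
have z2 : `|2 * z| < 1 by rewrite ger0_norm ?mulr_ge0 ?ltW//; lra.
have z21 : 2 * z != 1 by rewrite lt_eqF//; lra.
have cb := @cvg_geometric_series R M (2 * z) z2.
have := dominated_series_tail N.+1 ub (cvgP _ cb).
rewrite (cvg_lim _ cb)// (cvg_lim _ (w0 z _))//; last by rewrite z0; lra.
rewrite sub0r normrN geometric_seriesE//= {1}/series/= big_nat_recr//= big_nat big1 ?add0r; last first.
  by move=> i /IH ->; rewrite mul0r.
rewrite normrM normrX (gtr0_norm z0) -mulrBl.
rewrite (_ : M - _ = M * (2 * z) ^+ N.+1); last by ring.
rewrite exprMn ler_pdivlMr; last by lra.
rewrite [z ^+ N.+1]exprSr mulrA => h.
have zN : 0 < z ^+ N by rewrite exprn_gt0.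
apply: le_trans ze; rewrite -(ler_pM2r zN) /A [2 ^+ N.+2]exprS.
have : 0 <= (`|w N| * z ^+ N) * (2^-1 - 2 * z) by rewrite mulr_ge0 ?mulr_ge0 ?(ltW zN)//; lra.
lra.
Qed.

End power_series.

Section gegenbauer_hat.
Variable R : realType.

Lemma gg_poly_ultraspherical (l : R) n t : 0 < l ->
  (gg_poly l n).[t] = gg_bound l n * (ultraspherical (2 * l) n).[t].
Proof.
move=> l0; elim/nat_ind2: n => [||n h0 h1].
- by rewrite /gg_bound gg_conv0 ultrasphericalE0 mul1r.
- have := gg_conv11S l 0; rewrite gg_conv0 mul1r mulr1 add0r /gg_bound => ->.
  by rewrite /gg_poly/= hornerZ ultrasphericalE1.
- apply: (mulfI (_ : n.+2%:R != 0)); first by rewrite pnatr_eq0.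
  rewrite gg_polyS h0 h1 [RHS]mulrA [n.+2%:R * gg_bound _ _]gg_conv11S -/(gg_bound l n.+1).
  have /= := horner_ultrasphericalS (_ : 0 <= 2 * l) n t; rewrite mulr_ge0 ?ltW// => /(_ isT) e.
  have b := gg_conv11S l n; rewrite -!/(gg_bound l _) in b.
  rewrite [RHS]mulrAC e mulrBl; transitivity (2 * t * (n.+1%:R + l) * (gg_bound l n.+1 * (ultraspherical (2 * l) n.+1).[t]) - ((n%:R + 2 * l) * gg_bound l n) * (ultraspherical (2 * l) n).[t]); first by ring.
  rewrite -b mulr2n; ring.
Qed.

Lemma gg_bound_gt0 (l : R) n : 0 < l -> 0 < gg_bound l n.
Proof.
move=> l0; elim: n => [|n IH]; first by rewrite /gg_bound gg_conv0.
have : 0 < n.+1%:R * gg_bound l n.+1.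
  by rewrite [_ * _]gg_conv11S mulr_gt0// ltr_wpDl// mulr_gt0.
by rewrite pmulr_rgt0.
Qed.

(** [gegenbauer] is only specified by its generating function; at fixed t it is a power series in z,
    whose coefficients are determined. *)
Lemma gegenbauerE (l : R) n t : 0 < l -> -1 <= t <= 1 ->
  (gegenbauer l n).[t] = (gg_poly l n).[t].
Proof.
move=> l0 t1; apply/eqP; rewrite -subr_eq0; apply/eqP.
apply: (@power_series_eq0 R (fun n => (gegenbauer l n).[t] - (gg_poly l n).[t])) => z /andP[z0 z1].
have nz : `|z| < 1 by rewrite gtr0_norm.
have := cvgB (gegenbauerP l0 nz t1) (gg_poly_gf l0 nz t1).
rewrite subrr; set B := series (fun k => (_ - _) * _).
rewrite (_ : B = (fun k => series (fun n => z ^+ n * (gegenbauer l n).[t]) k -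
  series (fun n => z ^+ n * (gg_poly l n).[t]) k)) => [H|]; first exact: H.
by apply/funext => k; rewrite /B /series/= -sumrB; apply: eq_bigr => i _; ring.
Qed.

Lemma gegenbauer_hat_fin m n (t : R) : -1 <= t <= 1 ->
  gegenbauer_hat (dim_index R (Fin m.+2)) n t = (ultraspherical (m%:R : R) n).[t].
Proof.
move=> t1 /=; have -> : (m.+2%:R - 2) / 2 = m%:R / 2 :> R.
  by rewrite -[m.+2]addn2 natrD addrK.
have one1 : -1 <= (1 : R) <= 1 by apply/andP; split; lra.
case: m => [|m]; last first.
  have l0 : 0 < m.+1%:R / 2 :> R by rewrite divr_gt0.
  rewrite gt_eqF// !gegenbauerE// !gg_poly_ultraspherical//.
  have -> : 2 * (m.+1%:R / 2) = m.+1%:R :> R by field.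
  by rewrite ultraspherical1// mulr1 mulrC mulKf// gt_eqF// gg_bound_gt0.
rewrite mul0r eqxx; elim/nat_ind2: n => [||n h0 h1].
- by rewrite mul0r cos0 ultrasphericalE0 hornerC.
- by rewrite mul1r acosK// ultrasphericalE1 hornerX.
- apply: (mulfI (_ : n.+1%:R + 0 != 0 :> R)); first by rewrite addr0 pnatr_eq0.
  rewrite horner_ultrasphericalS// -h0 -h1 !addr0.
  set a := acos t; have -> : t = cos a by rewrite acosK.
  have -> : n.+2%:R * a = n.+1%:R * a + a by rewrite -natr1; ring.
  have -> : n%:R * a = n.+1%:R * a - a by rewrite -natr1; ring.
  rewrite cosB cosD mulr2n; ring.
Qed.

End gegenbauer_hat.

(** * Limits of complex functions through real and imaginary parts *)

Section complex_limits.
Variable R : realType.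
Implicit Types z w : R[i].

Lemma Re_le_norm z : `|complex.Re z| <= complex.Re `|z|.
Proof.
case: z => a b; rewrite normc_def/= -sqrtr_sqr ler_wsqrtr// lerDl; exact: sqr_ge0.
Qed.

Lemma Im_le_norm z : `|complex.Im z| <= complex.Re `|z|.
Proof.
case: z => a b; rewrite normc_def/= -sqrtr_sqr ler_wsqrtr// lerDr; exact: sqr_ge0.
Qed.

Lemma norm_le_ReIm z : complex.Re `|z| <= `|complex.Re z| + `|complex.Im z|.
Proof.
case: z => a b; rewrite normc_def/= -[leRHS]ger0_norm ?addr_ge0// -sqrtr_sqr ler_wsqrtr//.
by rewrite sqrrD !real_normK ?num_real// addrAC lerDl mulrn_wge0.
Qed.

Lemma normc_ReE z : `|z| = (complex.Re `|z|)%:C.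
Proof. by rewrite normc_def. Qed.

Lemma cvg_complexP (T : Type) (F : set_system T) (FF : Filter F) (f : T -> R[i]) z :
  f @ F --> z <-> (fun x => complex.Re (f x)) @ F --> complex.Re z /\
                  (fun x => complex.Im (f x)) @ F --> complex.Im z.
Proof.
split=> [/cvgrPdist_le fz|[/cvgrPdist_le fR /cvgrPdist_le fI]].
  split; apply/cvgrPdist_le => e e0;
    have e0' : 0 < e%:C :> R[i] by rewrite ltcR.
    apply: filterS (fz _ e0') => x; rewrite normc_ReE lecR => /(le_trans _); apply.
    by rewrite -raddfB Re_le_norm.
  apply: filterS (fz _ e0') => x; rewrite normc_ReE lecR => /(le_trans _); apply.
  by rewrite -raddfB Im_le_norm.
apply/cvgrPdist_le => -[e e'] ee; move: (ee); rewrite ltcE/= => /andP[/eqP e'0 e0].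
rewrite e'0; have e2 : 0 < e / 2 by rewrite divr_gt0.
apply: filterS2 (fR _ e2) (fI _ e2) => x h1 h2.
rewrite normc_ReE lecR (le_trans (norm_le_ReIm _))// raddfB raddfB/=.
by rewrite [e]splitr lerD.
Qed.

Lemma complex_eqP z w : z = w <-> complex.Re z = complex.Re w /\ complex.Im z = complex.Im w.
Proof. by split=> [->//|[h1 h2]]; case: z w h1 h2 => a b [c d] /= -> ->. Qed.

Lemma complex_le0 z : 0 <= z <-> 0 <= complex.Re z /\ complex.Im z = 0.
Proof. by case: z => a b; rewrite lecE/=; split=> [/andP[/eqP -> ?]|[? ->]]//; rewrite eqxx. Qed.

Lemma conj_real (x : R) : ((x%:C : R[i])^*)%R = x%:C.
Proof. by apply/complex_eqP; rewrite /= oppr0. Qed.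

Lemma complex_ReM z w : complex.Re (z * w) = complex.Re z * complex.Re w - complex.Im z * complex.Im w.
Proof. by case: z w => [a b] [c d]. Qed.

Lemma complex_ImM z w : complex.Im (z * w) = complex.Re z * complex.Im w + complex.Im z * complex.Re w.
Proof. by case: z w => [a b] [c d]. Qed.

Lemma complex_ReMr z (x : R) : complex.Re (z * x%:C) = complex.Re z * x.
Proof. by rewrite complex_ReM/= mulr0 subr0. Qed.

Lemma complex_ImMr z (x : R) : complex.Im (z * x%:C) = complex.Im z * x.
Proof. by rewrite complex_ImM/= mulr0 add0r. Qed.

Lemma series_Re (u : nat -> R[i]) : (fun n => complex.Re (series u n)) = series (fun n => complex.Re (u n)).
Proof. by apply/funext => n; rewrite /series/= raddf_sum. Qed.

Lemma series_Im (u : nat -> R[i]) : (fun n => complex.Im (series u n)) = series (fun n => complex.Im (u n)).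
Proof. by apply/funext => n; rewrite /series/= raddf_sum. Qed.

Lemma cvg_series_complexP (u : nat -> R[i]) z :
  series u @ \oo --> z <-> series (fun n => complex.Re (u n)) @ \oo --> complex.Re z /\
                           series (fun n => complex.Im (u n)) @ \oo --> complex.Im z.
Proof. by rewrite cvg_complexP series_Re series_Im. Qed.

Lemma cvg_series_scaleP (c : nat -> R[i]) (x : nat -> R) z :
  series (fun n => c n * (x n)%:C) @ \oo --> z <->
  series (fun n => complex.Re (c n) * x n) @ \oo --> complex.Re z /\
  series (fun n => complex.Im (c n) * x n) @ \oo --> complex.Im z.
Proof.
rewrite cvg_series_complexP.
have -> : (fun n => complex.Re (c n * (x n)%:C)) = (fun n => complex.Re (c n) * x n).
  by apply/funext => n; rewrite complex_ReMr.
have -> // : (fun n => complex.Im (c n * (x n)%:C)) = (fun n => complex.Im (c n) * x n).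
by apply/funext => n; rewrite complex_ImMr.
Qed.

Lemma within_complexP (T : topologicalType) (A : set T) (f : T -> R[i]) :
  {within A, continuous f} <-> {within A, continuous (fun x => complex.Re (f x))} /\
                               {within A, continuous (fun x => complex.Im (f x))}.
Proof.
split=> [fc|[fR fI] x].
  by split=> x; have /cvg_complexP[] := fc x.
by apply/cvg_complexP; split; [exact: fR|exact: fI].
Qed.

Lemma continuous_complexP (T : topologicalType) (f : T -> R[i]) :
  continuous f <-> continuous (fun x => complex.Re (f x)) /\
                               continuous (fun x => complex.Im (f x)).
Proof.
split=> [fc|[fR fI] x].
  by split=> x; have /cvg_complexP[] := fc x.
by apply/cvg_complexP; split; [exact: fR|exact: fI].
Qed.

Lemma cvg_complex_ge0 (u : nat -> R[i]) z : u @ \oo --> z -> (forall n, 0 <= u n) -> 0 <= z.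
Proof.
move=> /cvg_complexP[uR uI] u0; apply/complex_le0; split.
  by apply: (ler_cvg_to (cvg_cst 0) uR); apply: nearW => n; have /complex_le0[] := u0 n.
apply: (cvg_unique _ uI) => //; rewrite (_ : (fun _ => _) = (fun=> 0)); first exact: cvg_cst.
by apply/funext => n; have /complex_le0[] := u0 n.
Qed.

End complex_limits.

(** * Positive semidefinite matrices and Schur products *)

Section psd.
Variable R : realType.

Definition psd n (A : 'I_n -> 'I_n -> R[i]) := forall c : 'I_n -> R[i],
  0 <= \sum_i \sum_j c i * (c j)^* * A i j.

(** The Schur product with a weighted Gram matrix: the weight w_k multiplies the form of A at the
    vector c_i v_k(i). *)
Lemma psd_gram n (A : 'I_n -> 'I_n -> R[i]) (I : Type) (s : seq I) (P : pred I) (v : I -> 'I_n -> R) (w : I -> R) :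
  psd A -> (forall k, P k -> 0 <= w k) ->
  psd (fun i j => A i j * (\sum_(k <- s | P k) w k * (v k i * v k j))%:C).
Proof.
move=> pA w0 c.
have -> : \sum_i \sum_j c i * (c j)^* * (A i j * (\sum_(k <- s | P k) w k * (v k i * v k j))%:C)
  = \sum_(k <- s | P k) (w k)%:C * \sum_i \sum_j (c i * (v k i)%:C) * (c j * (v k j)%:C)^* * A i j.
  under eq_bigr do (under eq_bigr do rewrite rmorph_sum !mulr_sumr; rewrite exchange_big).
  rewrite exchange_big/=; apply: eq_bigr => k _; rewrite mulr_sumr; apply: eq_bigr => i _.
  rewrite mulr_sumr; apply: eq_bigr => j _; rewrite !rmorphM/=. rewrite conj_real; ring.
by apply: sumr_ge0 => k Pk; apply: mulr_ge0; [rewrite lecR w0|exact: pA].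
Qed.

Lemma eq_psd n (A B : 'I_n -> 'I_n -> R[i]) : (forall i j, A i j = B i j) -> psd A -> psd B.
Proof.
move=> AB pA c; rewrite (_ : \sum_i _ = \sum_i \sum_j c i * (c j)^* * A i j); first exact: pA.
by apply: eq_bigr => i _; apply: eq_bigr => j _; rewrite AB.
Qed.

Lemma psd_gramX n (A : 'I_n -> 'I_n -> R[i]) N (v : nat -> 'I_n -> R) k :
  psd A -> psd (fun i j => A i j * ((\sum_(0 <= l < N) v l i * v l j) ^+ k)%:C).
Proof.
move=> pA; elim: k => [|k IH]; first by apply: eq_psd pA => i j; rewrite expr0 mulr1.
apply: eq_psd (@psd_gram _ _ _ (index_iota 0 N) predT v (fun=> 1) IH (fun _ _ => ler01)) => i j.
by rewrite exprSr rmorphM mulrA; congr (_ * _%:C); apply: eq_bigr => l _; exact: mul1r.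
Qed.

Lemma psd_cvg n (A : nat -> 'I_n -> 'I_n -> R[i]) (B : 'I_n -> 'I_n -> R[i]) :
  (forall N, psd (A N)) -> (forall i j, (fun N => A N i j) @ \oo --> B i j) -> psd B.
Proof.
move=> pA AB c; apply: (cvg_complex_ge0 (u := fun N => \sum_i \sum_j c i * (c j)^* * A N i j)) => [|N].
  by apply: cvg_sumr => i; apply: cvg_sumr => j; apply: cvgMl_tmp; exact: AB.
exact: pA.
Qed.

End psd.

(** * Euclidean geometry of R^d and l^2, and reflections *)

Section euclid.
Variables (R : realType) (d : dimension).
Local Notation E := (euclidean R d).
Implicit Types (x y z : E) (a : R).

Lemma euclid_dotC x y : euclid_dot x y = euclid_dot y x.
Proof. by case: d x y => [n|] x y; [exact: dotC|exact: ell2_dotC]. Qed.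

Lemma euclid_dotDl x y z : euclid_dot (x + y) z = euclid_dot x z + euclid_dot y z.
Proof. by case: d x y z => [n|] x y z; [exact: dotDl|exact: ell2_dotDl]. Qed.

Lemma euclid_dotZl a x z : euclid_dot (a *: x) z = a * euclid_dot x z.
Proof. by case: d x z => [n|] x z; [exact: dotZl|exact: ell2_dotZl]. Qed.

Lemma euclid_dotDr x y z : euclid_dot x (y + z) = euclid_dot x y + euclid_dot x z.
Proof. by rewrite euclid_dotC euclid_dotDl !(euclid_dotC x). Qed.

Lemma euclid_dotZr a x z : euclid_dot x (a *: z) = a * euclid_dot x z.
Proof. by rewrite euclid_dotC euclid_dotZl euclid_dotC. Qed.

Lemma euclid_dotNl x z : euclid_dot (- x) z = - euclid_dot x z.
Proof. by rewrite -scaleN1r euclid_dotZl mulN1r. Qed.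

Lemma euclid_dotNr x z : euclid_dot x (- z) = - euclid_dot x z.
Proof. by rewrite euclid_dotC euclid_dotNl euclid_dotC. Qed.

Lemma euclid_dot0l x : euclid_dot 0 x = 0.
Proof. by rewrite -(scale0r 0) euclid_dotZl mul0r. Qed.

Lemma euclid_dot0r x : euclid_dot x 0 = 0.
Proof. by rewrite euclid_dotC euclid_dot0l. Qed.

Lemma euclid_dot_ge0 x : 0 <= euclid_dot x x.
Proof.
case: d x => [n|] x; last exact: ell2_dot_ge0.
by apply: sumr_ge0 => i _; rewrite -expr2 sqr_ge0.
Qed.

Lemma euclid_dot_eq0 x : euclid_dot x x = 0 -> x = 0.
Proof.
case: d x => [n|] x; last exact: ell2_dot_eq0.
move=> /eqP; rewrite psumr_eq0 => [/allP h|i _]; last by rewrite -expr2 sqr_ge0.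
apply/rowP => i; rewrite mxE; apply/eqP.
by have := h i (mem_index_enum _); rewrite /= mulf_eq0 orbb.
Qed.

Lemma euclid_dot_CS x y : euclid_dot x y ^+ 2 <= euclid_dot x x * euclid_dot y y.
Proof.
have [y0|y0] := eqVneq (euclid_dot y y) 0.
  by rewrite (euclid_dot_eq0 y0) !euclid_dot0r expr0n mulr0.
have yp : 0 < euclid_dot y y by rewrite lt_neqAle eq_sym y0 euclid_dot_ge0.
have := euclid_dot_ge0 (euclid_dot y y *: x - euclid_dot x y *: y).
rewrite !(euclid_dotDl, euclid_dotDr, euclid_dotNl, euclid_dotNr, euclid_dotZl, euclid_dotZr).
rewrite (euclid_dotC y x).
set a := euclid_dot x x; set b := euclid_dot x y; set c := euclid_dot y y => h.
rewrite -subr_ge0 -(pmulr_rge0 _ yp) -/c.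
by apply: le_trans h _; rewrite le_eqVlt; apply/orP; left; apply/eqP; ring.
Qed.

Lemma euclid_norm_ge0 x : 0 <= euclid_norm x.
Proof. exact: sqrtr_ge0. Qed.

Lemma euclid_norm_sqr x : euclid_norm x ^+ 2 = euclid_dot x x.
Proof. by rewrite sqr_sqrtr// euclid_dot_ge0. Qed.

Lemma euclid_norm0 : euclid_norm (0 : E) = 0.
Proof. by rewrite /euclid_norm euclid_dot0l sqrtr0. Qed.

Lemma euclid_norm_eq0 x : (euclid_norm x == 0) = (x == 0).
Proof.
apply/eqP/eqP => [x0|->]; last exact: euclid_norm0.
by apply: euclid_dot_eq0; rewrite -euclid_norm_sqr x0 expr0n.
Qed.

Lemma euclid_normZ a x : euclid_norm (a *: x) = `|a| * euclid_norm x.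
Proof.
rewrite /euclid_norm euclid_dotZl euclid_dotZr mulrA -expr2 sqrtrM ?sqr_ge0//.
by rewrite sqrtr_sqr.
Qed.

Lemma euclid_dot_le x y : `|euclid_dot x y| <= euclid_norm x * euclid_norm y.
Proof.
rewrite -sqrtr_sqr -sqrtrM ?euclid_dot_ge0// ler_wsqrtr//; exact: euclid_dot_CS.
Qed.

Lemma euclid_unit x : x != 0 ->
  euclid_dot ((euclid_norm x)^-1 *: x) ((euclid_norm x)^-1 *: x) = 1.
Proof.
rewrite -euclid_norm_eq0 => x0.
by rewrite euclid_dotZl euclid_dotZr -euclid_norm_sqr; field.
Qed.

Lemma euclid_unit_dot x y : euclid_dot x x = 1 -> euclid_dot y y = 1 ->
  -1 <= euclid_dot x y <= 1.
Proof.
move=> x1 y1; rewrite -ler_norml (le_trans (euclid_dot_le x y))//.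
by rewrite /euclid_norm x1 y1 sqrtr1 mulr1.
Qed.

Lemma euclid_norm_continuous : continuous (@euclid_norm R d).
Proof.
case: d => [n|]; last exact: norm_continuous.
move=> x; apply: (@continuous_comp _ _ _ (fun x : 'rV[R]_n => \sum_(i < n) x 0 i * x 0 i) Num.sqrt).
  apply: (@cvg_sumr _ R _ _ (nbhs x) (index_enum 'I_n) (fun i (z : 'rV[R]_n) => z 0 i * z 0 i)
    (fun i => x 0 i * x 0 i)) => i.
  by apply: cvgM; exact: coord_continuous.
exact: sqrt_continuous.
Qed.

Lemma euclid_dot_polar x y : euclid_dot x y =
  4^-1 * (euclid_norm (x + y) ^+ 2 - euclid_norm (x - y) ^+ 2).
Proof.
rewrite !euclid_norm_sqr !(euclid_dotDl, euclid_dotDr, euclid_dotNl, euclid_dotNr).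
by rewrite (euclid_dotC y x); field.
Qed.

Lemma euclid_dot_continuous : continuous (fun p : E * E => euclid_dot p.1 p.2).
Proof.
move=> p; rewrite (_ : (fun _ => _) = (fun p : E * E =>
    4^-1 * (euclid_norm (p.1 + p.2) ^+ 2 - euclid_norm (p.1 - p.2) ^+ 2))); last first.
  by apply/funext => q; exact: euclid_dot_polar.
apply: cvgMl_tmp; apply: cvgB; apply: (cvg_comp (fun p : E * E => euclid_norm _) (fun a => a ^+ 2));
  try exact: exprn_continuous.
  apply: (cvg_comp (fun p : E * E => p.1 + p.2)); last exact: euclid_norm_continuous.
  by apply: cvgD; [exact: cvg_fst|exact: cvg_snd].
apply: (cvg_comp (fun p : E * E => p.1 - p.2)); last exact: euclid_norm_continuous.
by apply: cvgB; [exact: cvg_fst|exact: cvg_snd].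
Qed.

(** For v = 0 the convention 0^-1 = 0 makes this the identity, so the reflection lemmas hold for
    every v. *)
Definition euclid_reflection (v x : E) : E :=
  x - (2 * euclid_dot x v / euclid_dot v v) *: v.

Lemma euclid_reflection_is_linear v : linear (euclid_reflection v).
Proof.
move=> a x y; rewrite /euclid_reflection euclid_dotDl euclid_dotZl.
rewrite scalerBr scalerA [RHS]addrACA; congr (_ + _).
by rewrite -opprD -scalerDl; congr (- (_ *: _)); ring.
Qed.

HB.instance Definition _ v := GRing.isLinear.Build R E E _ (euclid_reflection v)
  (euclid_reflection_is_linear v).

Lemma euclid_dot_reflection v x y :
  euclid_dot (euclid_reflection v x) (euclid_reflection v y) = euclid_dot x y.
Proof.
have [v0|v0] := eqVneq (euclid_dot v v) 0.
  by rewrite /euclid_reflection v0 invr0 !mulr0 !scale0r !subr0.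
rewrite /euclid_reflection.
rewrite !(euclid_dotDl, euclid_dotDr, euclid_dotNl, euclid_dotNr, euclid_dotZl, euclid_dotZr).
by rewrite (euclid_dotC v y); field.
Qed.

Lemma euclid_reflectionK v : involutive (euclid_reflection v).
Proof.
move=> x; have [v0|v0] := eqVneq (euclid_dot v v) 0.
  by rewrite /euclid_reflection v0 invr0 !mulr0 !scale0r !subr0.
rewrite /euclid_reflection euclid_dotDl euclid_dotNl euclid_dotZl divfK//.
rewrite -addrA -opprD -scalerDl; set c := (X in X *: v).
suff -> : c = 0 by rewrite scale0r subr0.
by rewrite /c; field.
Qed.

Lemma euclid_reflection_swap x y : euclid_dot x x = euclid_dot y y ->
  euclid_reflection (x - y) x = y.
Proof.
move=> xy; have [->|nxy] := eqVneq x y.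
  by rewrite /euclid_reflection subrr euclid_dot0r mulr0 mul0r scale0r subr0.
have v0 : euclid_dot (x - y) (x - y) != 0.
  by apply: contra_neq nxy => /euclid_dot_eq0/eqP; rewrite subr_eq0 => /eqP.
rewrite /euclid_reflection (_ : 2 * euclid_dot x (x - y) = euclid_dot (x - y) (x - y)).
  by rewrite divff// scale1r opprB addrC subrK.
rewrite !(euclid_dotDl, euclid_dotDr, euclid_dotNl, euclid_dotNr) xy (euclid_dotC y x).
by ring.
Qed.

Lemma euclid_reflection_fix v x : euclid_dot x v = 0 -> euclid_reflection v x = x.
Proof. by move=> xv; rewrite /euclid_reflection xv mulr0 mul0r scale0r subr0. Qed.

(** A first reflection takes x to x' and y to some y1; a second takes y1 to y'. It fixes x' because
    y1 - y' is orthogonal to x', both inner products with x' being <x, y>. *)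
Lemma euclid_isometry_exists x y x' y' : euclid_dot x x = euclid_dot x' x' ->
  euclid_dot y y = euclid_dot y' y' -> euclid_dot x y = euclid_dot x' y' ->
  exists U : {linear E -> E},
    [/\ bijective U, forall z, euclid_norm (U z) = euclid_norm z, U x = x' & U y = y'].
Proof.
move=> xx yy xy; pose s1 := euclid_reflection (x - x').
pose y1 := s1 y; pose s2 := euclid_reflection (y1 - y').
exists (s2 \o s1); split.
- exists (s1 \o s2) => z /=; first by rewrite /s2 euclid_reflectionK /s1 euclid_reflectionK.
  by rewrite /s1 euclid_reflectionK /s2 euclid_reflectionK.
- by move=> z; rewrite /euclid_norm /= !euclid_dot_reflection.
- rewrite /= /s1 euclid_reflection_swap// /s2 euclid_reflection_fix//.
  rewrite euclid_dotDr euclid_dotNr -xy /y1 -(euclid_reflection_swap xx).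
  by rewrite euclid_dot_reflection subrr.
- by rewrite /= -/y1 euclid_reflection_swap// /y1 euclid_dot_reflection.
Qed.

Lemma euclid_orthonormal_pair : dim_ge2 d -> exists e f : E,
  [/\ euclid_dot e e = 1, euclid_dot f f = 1 & euclid_dot e f = 0].
Proof.
case: d => [[|[|n]]|]//= _; last first.
  exists (ell2_seq [:: 1]), (ell2_seq [:: 0; 1]).
  by rewrite !ell2_dot_seq /= !big_nat_recl//= !big_nil; split; ring.
have dd (i j : 'I_n.+2) : \sum_(k < n.+2) (delta_mx 0 i : 'rV[R]_n.+2) 0 k * (delta_mx 0 j : 'rV[R]_n.+2) 0 k = (i == j)%:R.
  rewrite (bigD1 i)//= big1 ?addr0.
    by rewrite !mxE !eqxx /= mul1r eq_sym.
  by move=> k /negbTE ki; rewrite !mxE ki andbF mul0r.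
by exists (delta_mx 0 ord0), (delta_mx 0 ord_max); rewrite !dd !eqxx.
Qed.

End euclid.

(** * The polynomials [gegenbauer_hat] treated uniformly in d *)

Section hat.
Variables (R : realType) (d : dimension).
Hypothesis d2 : dim_ge2 d.
Local Notation E := (euclidean R d).
Local Notation H n t := (gegenbauer_hat (dim_index R d) n (t : R)).
Local Notation I11 := `[(-1 : R), 1]%classic.

Lemma hat0 t : -1 <= t <= 1 -> H 0 t = 1.
Proof.
move=> t1; case: d d2 => [[|[|m]]|]//= _.
by rewrite [LHS]gegenbauer_hat_fin// ultrasphericalE0 hornerC.
Qed.

Lemma hat1 n : H n 1 = 1.
Proof.
have h : -1 <= (1 : R) <= 1 by apply/andP; split; lra.
case: d d2 => [[|[|m]]|] _ //; last exact: expr1n.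
by rewrite gegenbauer_hat_fin// ultraspherical1.
Qed.

Lemma hat_le1 n t : -1 <= t <= 1 -> `|H n t| <= 1.
Proof.
move=> t1; case: d d2 => [[|[|m]]|] _ //.
  by rewrite gegenbauer_hat_fin// ultraspherical_le1.
by rewrite /= normrX exprn_ile1// ler_norml.
Qed.

Lemma hat_continuous n : {within I11, continuous (fun t => H n t)}.
Proof.
case: d d2 => [[|[|m]]|] _ //=; last first.
  by apply: continuous_subspaceT => x; exact: exprn_continuous.
apply: (@subspace_eq_continuous _ _ _ (horner (ultraspherical (m%:R : R) n))); last exact: within_horner.
by move=> t; rewrite inE/= in_itv/= => t1; rewrite [RHS]gegenbauer_hat_fin.
Qed.

Lemma hat_expansion (f : R -> R) : {within I11, continuous f} -> pd_zonal d f ->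
  exists2 a : nat -> R, (forall n, 0 <= a n) &
    forall t, -1 <= t <= 1 -> series (fun n => a n * H n t) @ \oo --> f t.
Proof.
move=> cf; case: d d2 => [[|[|m]]|] _ // pf; last exact: hilbert_expansion.
have [a a0 af] := sphere_expansion cf pf; exists a => // t t1.
by under eq_fun do rewrite gegenbauer_hat_fin//; exact: af.
Qed.

Lemma hat_expansion_unique (a b : nat -> R) : (forall n, `|a n| <= b n) -> cvgn (series b) ->
  (forall t, -1 <= t <= 1 -> series (fun n => a n * H n t) @ \oo --> (0 : R)) ->
  forall n, a n = 0.
Proof.
move=> ab cb; case: d d2 => [[|[|m]]|] _ // a0.
  apply: (sphere_expansion_unique (m := m) ab cb) => t t1.
  by have := a0 t t1; under eq_fun do rewrite gegenbauer_hat_fin//.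
by apply: power_series_eq0 => z /andP[z0 z1]; apply: a0; apply/andP; split; lra.
Qed.

(** For finite d the reproducing property writes the factor as a Gram matrix with nonnegative
    cubature weights; for l^2 it is the limit of powers of truncated inner products. *)
Lemma hat_psd k (A : 'I_k -> 'I_k -> R[i]) (u : 'I_k -> E) n :
  psd A -> (forall i, euclid_dot (u i) (u i) = 1) ->
  psd (fun i j => A i j * (H n (euclid_dot (u i) (u j)))%:C).
Proof.
move=> pA; case: d d2 u => [[|[|m]]|] _ // u u1; last first.
  apply: (@psd_cvg _ _ (fun N i j => A i j * ((\sum_(0 <= l < N) u i l * u j l) ^+ n)%:C)) => [N|i j].
    exact: (@psd_gramX _ _ _ _ (fun l i => u i l)).
  apply: cvgMl_tmp; apply/cvg_complexP; split; last exact: cvg_cst.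
  apply: (cvg_comp (fun N => \sum_(0 <= l < N) u i l * u j l) (fun x : R => x ^+ n)).
    exact: ell2_dot_cvg.
  exact: exprn_continuous.
have [s cub] := cubature_exists R m.+1 (4 * n.+1).
have h0 := sphere_mean_sqr_gt0 R m n; have [s0 _ _] := cub.
pose w (z : R * 'rV[R]_m.+2) := z.1 / sphere_mean m (ultraspherical m%:R n * ultraspherical m%:R n).
have w0 z : z \in s -> 0 <= w z by move=> zs; rewrite divr_ge0 ?(ltW h0)//; exact: (allP s0).
have := @psd_gram _ _ A _ s (mem s) (fun z i => (ultraspherical (m%:R : R) n).[dot (u i) z.2]) w pA w0.
apply: eq_psd => i j; congr (_ * _%:C); rewrite gegenbauer_hat_fin; last exact: euclid_unit_dot.
rewrite -big_seq; apply: (mulfI (lt0r_neq0 h0)).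
rewrite -(zonal_reproducing cub)//; [|exact: u1|exact: u1].
rewrite mulr_sumr; apply: eq_bigr => z _.
by rewrite /w [LHS]mulrA [sphere_mean _ _ * _]mulrC divfK ?gt_eqF.
Qed.

End hat.

(** * A continuous square root of the Gram matrix, and the function kappa *)

Section gram_vectors.
Variable R : realType.
Implicit Types p : R * R * R.

(** For the Gram matrix M with diagonal r^2, s^2 and off-diagonal entry g, this is sqrt(det M), and
    [gram_scale] is sqrt(tr M + 2 sqrt(det M)). They enter the 2 x 2 square root (M + sqrt(det M) I)
    / sqrt(tr M + 2 sqrt(det M)). *)
Definition gram_area p : R := Num.sqrt (p.1.1 ^+ 2 * p.1.2 ^+ 2 - p.2 ^+ 2).
Definition gram_scale p : R := Num.sqrt (p.1.1 ^+ 2 + p.1.2 ^+ 2 + 2 * gram_area p).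

Lemma kappa_domain_sqr p : kappa_domain p -> p.2 ^+ 2 <= p.1.1 ^+ 2 * p.1.2 ^+ 2.
Proof.
move=> [r0 s0 g]; rewrite -exprMn -real_normK ?num_real//.
by rewrite ler_pXn2r// ?nnegrE ?mulr_ge0.
Qed.

Lemma gram_area_sqr p : kappa_domain p ->
  gram_area p ^+ 2 = p.1.1 ^+ 2 * p.1.2 ^+ 2 - p.2 ^+ 2.
Proof. by move=> /kappa_domain_sqr h; rewrite sqr_sqrtr// subr_ge0. Qed.

Lemma gram_scale_sqr p :
  gram_scale p ^+ 2 = p.1.1 ^+ 2 + p.1.2 ^+ 2 + 2 * gram_area p.
Proof. by rewrite sqr_sqrtr// !addr_ge0 ?sqr_ge0// mulr_ge0// sqrtr_ge0. Qed.

Lemma gram_scale_eq0 p : kappa_domain p -> gram_scale p = 0 -> p = (0, 0, 0).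
Proof.
move=> Mp t0; have := gram_scale_sqr p; rewrite t0 expr0n/= => /esym e.
have d0 : 0 <= gram_area p by exact: sqrtr_ge0.
have r2 := sqr_ge0 p.1.1; have s2 := sqr_ge0 p.1.2.
have r0 : p.1.1 = 0 by apply/eqP; rewrite -sqrf_eq0; apply/eqP; lra.
have s0 : p.1.2 = 0 by apply/eqP; rewrite -sqrf_eq0; apply/eqP; lra.
have := kappa_domain_sqr Mp; rewrite r0 expr0n mul0r => g0.
have : p.2 = 0 by apply/eqP; rewrite -sqrf_eq0; apply/eqP; have := sqr_ge0 p.2; lra.
by case: p r0 s0 {Mp t0 e d0 r2 s2 g0} => [[? ?] ?] /= -> -> ->.
Qed.

Lemma gram_coef_le (a t r : R) : 0 <= r -> a ^+ 2 <= r ^+ 2 * t ^+ 2 -> `|a / t| <= r.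
Proof.
move=> r0 h; have [->|t0] := eqVneq t 0; first by rewrite invr0 mulr0 normr0.
rewrite -ler_sqr ?nnegrE// real_normK ?num_real// exprMn exprVn ler_pdivrMr//.
by rewrite exprn_even_gt0.
Qed.

Lemma cvg_sqr (T : Type) (F : set_system T) (FF : Filter F) (f : T -> R) (l : R) :
  f @ F --> l -> (fun x => f x ^+ 2) @ F --> l ^+ 2.
Proof. by move=> fl; rewrite expr2; under eq_fun do rewrite expr2; exact: cvgM. Qed.

Lemma cvg_fst_fst p : (fun p : R * R * R => p.1.1) @ p --> p.1.1.
Proof. by apply: (cvg_comp (fun p : R * R * R => p.1) fst); [exact: cvg_fst|exact: cvg_fst]. Qed.

Lemma cvg_fst_snd p : (fun p : R * R * R => p.1.2) @ p --> p.1.2.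
Proof. by apply: (cvg_comp (fun p : R * R * R => p.1) snd); [exact: cvg_fst|exact: cvg_snd]. Qed.

Lemma continuous_gram_area : continuous gram_area.
Proof.
move=> p; have c : (fun p : R * R * R => p.1.1 ^+ 2 * p.1.2 ^+ 2 - p.2 ^+ 2) @ p -->
    p.1.1 ^+ 2 * p.1.2 ^+ 2 - p.2 ^+ 2.
  apply: cvgB; first by apply: cvgM; apply: cvg_sqr; [exact: cvg_fst_fst|exact: cvg_fst_snd].
  by apply: cvg_sqr; exact: cvg_snd.
exact: (cvg_comp _ Num.sqrt c (@sqrt_continuous R _)).
Qed.

Lemma continuous_gram_scale : continuous gram_scale.
Proof.
move=> p; have c : (fun p : R * R * R => p.1.1 ^+ 2 + p.1.2 ^+ 2 + 2 * gram_area p) @ p -->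
    p.1.1 ^+ 2 + p.1.2 ^+ 2 + 2 * gram_area p.
  apply: cvgD; last by apply: cvgMl_tmp; exact: continuous_gram_area.
  by apply: cvgD; apply: cvg_sqr; [exact: cvg_fst_fst|exact: cvg_fst_snd].
exact: (cvg_comp _ Num.sqrt c (@sqrt_continuous R _)).
Qed.

(** The quotient is delicate only where [gram_scale] vanishes, that is at the origin; there it is
    squeezed by r, which tends to 0. *)
Lemma gram_coef_cvg (a : R * R * R -> R) (r : R * R * R -> R) q : kappa_domain q ->
  a p @[p --> q] --> a q -> r p @[p --> q] --> r q ->
  (forall p, kappa_domain p -> 0 <= r p /\ a p ^+ 2 <= r p ^+ 2 * gram_scale p ^+ 2) ->
  r (0, 0, 0) = 0 ->
  a p / gram_scale p @[p --> within (@kappa_domain R) (nbhs q)] --> a q / gram_scale q.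
Proof.
move=> Mq ca cr ar r0; have [t0|t0] := eqVneq (gram_scale q) 0; last first.
  apply: cvg_within_filter; apply: cvgM => //; apply: cvgV => //; exact: continuous_gram_scale.
have q0 := gram_scale_eq0 Mq t0; rewrite t0 invr0 mulr0.
have cr0 : r p @[p --> within (@kappa_domain R) (nbhs q)] --> (0 : R).
  have <- : r q = 0 by rewrite q0.
  exact: cvg_within_filter.
apply/cvgrPdist_le => e e0; move/cvgrPdist_le : cr0 => /(_ e e0).
rewrite !near_withinE; apply: filterS => p h Mp; have {}h := h Mp.
rewrite sub0r normrN (le_trans _ h)// sub0r normrN; have [rp ap] := ar p Mp.
by rewrite (ger0_norm rp); exact: gram_coef_le.
Qed.

End gram_vectors.

Section kappa_of_kernel.
Variables (R : realType) (d : dimension).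
Hypothesis d2 : dim_ge2 d.
Local Notation E := (euclidean R d).
Variable K : E -> E -> R[i].

Lemma kappa_domain_euclid (x y : E) :
  kappa_domain (euclid_norm x, euclid_norm y, euclid_dot x y).
Proof. by split; rewrite /= ?euclid_norm_ge0//; exact: euclid_dot_le. Qed.

Lemma kappa_representation_isotropic_pd kappa : posdef_on setT K ->
  kappa_representation K kappa -> isotropic_pd_kernel K.
Proof.
move=> pK [ck Kk]; split=> //.
  pose g (p : E * E) := (euclid_norm p.1, euclid_norm p.2, euclid_dot p.1 p.2).
  move=> p; rewrite (_ : (fun _ => _) = (fun q => kappa q.1.1 q.1.2 q.2) \o g); last first.
    by apply/funext => q; rewrite /= Kk.
  have /subspace_continuousP/(_ _ (kappa_domain_euclid p.1 p.2)) := ck.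
  apply: cvg_comp => A /=; rewrite /within/=.
  have cg : g @ p --> g p.
    have n1 : (fun p : E * E => euclid_norm p.1) @ p --> euclid_norm p.1.
      by apply: (cvg_comp fst); [exact: cvg_fst|exact: euclid_norm_continuous].
    have n2 : (fun p : E * E => euclid_norm p.2) @ p --> euclid_norm p.2.
      by apply: (cvg_comp snd); [exact: cvg_snd|exact: euclid_norm_continuous].
    exact: (cvg_pair (cvg_pair n1 n2) (@euclid_dot_continuous _ _ p)).
  move=> h; have := cg _ h; rewrite /nbhs/=; apply: (@filterS _ (nbhs p)) => q.
  by move=> /(_ (kappa_domain_euclid q.1 q.2)).
move=> U _ Un x y; rewrite !Kk !Un; congr (kappa _ _ _).
by rewrite !euclid_dot_polar -!raddfD -!raddfB !Un.
Qed.

(** kappa is K at X and Y, whose coordinates in an orthonormal pair are the rows of the square root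
    of the Gram matrix. Placing X at r e instead would give Y the coordinate g / r, which has no
    limit as r tends to 0. *)
Lemma isotropic_pd_kappa_representation : isotropic_pd_kernel K ->
  exists kappa, kappa_representation K kappa.
Proof.
move=> [cK pK iK]; have [e [f [e1 f1 ef]]] := euclid_orthonormal_pair R d2.
pose a (p : R * R * R) := (p.1.1 ^+ 2 + gram_area p) / gram_scale p.
pose b (p : R * R * R) := p.2 / gram_scale p.
pose c (p : R * R * R) := (p.1.2 ^+ 2 + gram_area p) / gram_scale p.
pose X (p : R * R * R) : E := a p *: e + b p *: f.
pose Y (p : R * R * R) : E := b p *: e + c p *: f.
have dotE (s t u v : R) : euclid_dot (s *: e + t *: f : E) (u *: e + v *: f) = s * u + t * v.
  rewrite !(euclid_dotDl, euclid_dotDr, euclid_dotZl, euclid_dotZr) e1 f1 (euclid_dotC f) ef.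
  by ring.
have XY p : kappa_domain p -> [/\ euclid_dot (X p) (X p) = p.1.1 ^+ 2,
    euclid_dot (Y p) (Y p) = p.1.2 ^+ 2 & euclid_dot (X p) (Y p) = p.2].
  move=> Mp; rewrite !dotE /a /b /c; have [t0|t0] := eqVneq (gram_scale p) 0.
    by rewrite t0 (gram_scale_eq0 Mp t0) invr0 !mulr0 addr0 expr0n.
  have A2 := gram_area_sqr Mp; have S2 := gram_scale_sqr p.
  split; apply: (mulIf (_ : gram_scale p ^+ 2 != 0)); rewrite ?sqrf_eq0//.
  - transitivity ((p.1.1 ^+ 2 + gram_area p) ^+ 2 + p.2 ^+ 2); first by field.
    by rewrite S2 sqrrD A2; ring.
  - transitivity ((p.1.2 ^+ 2 + gram_area p) ^+ 2 + p.2 ^+ 2); first by field.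
    by rewrite S2 sqrrD A2; ring.
  - transitivity (p.2 * (p.1.1 ^+ 2 + p.1.2 ^+ 2 + 2 * gram_area p)); first by field.
    by rewrite S2.
exists (fun r s g => K (X (r, s, g)) (Y (r, s, g))); split; last first.
  move=> x y; have [XX YY xy] := XY _ (kappa_domain_euclid x y).
  rewrite /= !euclid_norm_sqr in XX YY.
  have [U [bU nU <- <-]] := euclid_isometry_exists (esym XX) (esym YY) (esym xy).
  exact: iK.
apply/subspace_continuousP => q Mq.
have sq0 (p : R * R * R) : 0 <= gram_area p by exact: sqrtr_ge0.
have bnd (p : R * R * R) : kappa_domain p ->
   [/\ (p.1.1 ^+ 2 + gram_area p) ^+ 2 <= p.1.1 ^+ 2 * gram_scale p ^+ 2,
       (p.1.2 ^+ 2 + gram_area p) ^+ 2 <= p.1.2 ^+ 2 * gram_scale p ^+ 2 &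
       p.2 ^+ 2 <= p.1.1 ^+ 2 * gram_scale p ^+ 2].
  move=> Mp; have A2 := gram_area_sqr Mp; rewrite gram_scale_sqr.
  have g0 := sqr_ge0 p.2; have := kappa_domain_sqr Mp; have := mulr_ge0 (sqr_ge0 p.1.1) (sq0 p).
  have := sqr_ge0 (p.1.1 ^+ 2); rewrite !sqrrD A2; split; lra.
have ca : a p @[p --> within (@kappa_domain R) (nbhs q)] --> a q.
  apply: (@gram_coef_cvg _ (fun p => p.1.1 ^+ 2 + gram_area p) (fun p => p.1.1)) => //.
  - by apply: cvgD; [apply: cvg_sqr; exact: cvg_fst_fst|exact: continuous_gram_area].
  - exact: cvg_fst_fst.
  - by move=> p Mp; split; [case: Mp|case: (bnd p Mp)].
have cc : c p @[p --> within (@kappa_domain R) (nbhs q)] --> c q.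
  apply: (@gram_coef_cvg _ (fun p => p.1.2 ^+ 2 + gram_area p) (fun p => p.1.2)) => //.
  - by apply: cvgD; [apply: cvg_sqr; exact: cvg_fst_snd|exact: continuous_gram_area].
  - exact: cvg_fst_snd.
  - by move=> p Mp; split; [case: Mp|case: (bnd p Mp)].
have cb : b p @[p --> within (@kappa_domain R) (nbhs q)] --> b q.
  apply: (@gram_coef_cvg _ (fun p => p.2) (fun p => p.1.1)) => //.
  - exact: cvg_snd.
  - exact: cvg_fst_fst.
  - by move=> p Mp; split; [case: Mp|case: (bnd p Mp)].
have cX : X p @[p --> within (@kappa_domain R) (nbhs q)] --> X q.
  by apply: cvgD; apply: cvgZr_tmp.
have cY : Y p @[p --> within (@kappa_domain R) (nbhs q)] --> Y q.
  by apply: cvgD; apply: cvgZr_tmp.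
apply: (@cvg_comp _ _ _ (fun p => (X p, Y p)) (fun z : E * E => K z.1 z.2) _ (nbhs (X q, Y q)) (nbhs (K (X q) (Y q)))).
  exact: (cvg_pair cX cY).
exact: (cK (X q, Y q)).
Qed.

End kappa_of_kernel.

(** * Inequalities for positive definite kernels *)

Section posdef.
Variable R : realType.
Implicit Types A B C D : R[i].

Lemma hermitian_form2 A B C D :
  (forall a b : R[i], 0 <= a * (a)^* * A + a * (b)^* * B + b * (a)^* * C + b * (b)^* * D) ->
  [/\ 0 <= A, 0 <= D, C = (B)^*%R &
      complex.Re B ^+ 2 + complex.Im B ^+ 2 <= complex.Re A * complex.Re D].
Proof.
case: A B C D => [a1 a2] [b1 b2] [c1 c2] [d1 d2] q.
have q' (x y z w : R) := q (Complex x y) (Complex z w).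
have {}q' (x y z w : R) :
    0 <= (x ^+ 2 + y ^+ 2) * a1 + (x * z + y * w) * b1 - (y * z - x * w) * b2 +
      (x * z + y * w) * c1 - (w * x - z * y) * c2 + (z ^+ 2 + w ^+ 2) * d1 /\
    (x ^+ 2 + y ^+ 2) * a2 + (x * z + y * w) * b2 + (y * z - x * w) * b1 +
      (x * z + y * w) * c2 + (w * x - z * y) * c1 + (z ^+ 2 + w ^+ 2) * d2 = 0.
  have /complex_le0[] := q' x y z w; simpc => /= h1 h2.
  split; first by apply: le_trans h1 _; rewrite le_eqVlt; apply/orP; left; apply/eqP; ring.
  by rewrite -[RHS]h2; ring.
have [A1 A2] := q' 1 0 0 0; have [D1 D2] := q' 0 0 1 0.
have [_ BC1] := q' 1 0 1 0; have [_ BC2] := q' 1 0 0 1.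
have a10 : 0 <= a1 by lra.
have a20 : a2 = 0 by lra.
have d10 : 0 <= d1 by lra.
have d20 : d2 = 0 by lra.
have c1E : c1 = b1 by lra.
have c2E : c2 = - b2 by lra.
split; [by apply/complex_le0|by apply/complex_le0|by apply/complex_eqP|rewrite /=].
subst; set S := b1 ^+ 2 + b2 ^+ 2.
(* The vectors (D, -B) and (conj B, -A) give D (A D - |B|^2) and A (A D - |B|^2); if A = D = 0, the
   vector (-1, B) gives -2 |B|^2. *)
have [h1 _] := q' d1 0 (- b1) (- b2); have [h2 _] := q' b1 (- b2) (- a1) 0.
have [h3 _] := q' (-1) 0 b1 b2.
have [d0|d0] := ltP 0 d1.
  by rewrite -subr_ge0 -(pmulr_rge0 _ d0); apply: le_trans h1 _; rewrite le_eqVlt /S; apply/orP; left; apply/eqP; ring.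
have {}d0 : d1 = 0 by lra.
have [a0|a0] := ltP 0 a1.
  by rewrite -subr_ge0 -(pmulr_rge0 _ a0); apply: le_trans h2 _; rewrite le_eqVlt /S; apply/orP; left; apply/eqP; ring.
have {}a0 : a1 = 0 by lra.
move: h3; rewrite a0 d0 => h3; rewrite -subr_ge0 -(pmulr_rge0 _ (ltr0n R 2)).
by apply: le_trans h3 _; rewrite le_eqVlt /S; apply/orP; left; apply/eqP; ring.
Qed.

Section kernel.
Variables (X : Type) (S : set X) (K : X -> X -> R[i]).
Hypothesis pK : posdef_on S K.

Lemma posdef_diag x : S x -> 0 <= K x x.
Proof.
move=> Sx; have := pK (m := 1) (x := fun=> x) (fun=> 1) (fun=> Sx).
by rewrite !big_ord1 rmorph1 !mul1r.
Qed.

Let form2 x y : S x -> S y -> forall a b : R[i],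
  0 <= a * (a)^* * K x x + a * (b)^* * K x y + b * (a)^* * K y x + b * (b)^* * K y y.
Proof.
move=> Sx Sy a b.
have := pK (m := 2) (x := fun i => if i == ord0 then x else y) (fun i => if i == ord0 then a else b).
have h (i : 'I_2) : S (if i == ord0 then x else y) by case: ifP.
by move=> /(_ h); rewrite !big_ord_recl !big_ord0 /= !addr0 !addrA.
Qed.

Lemma posdef_herm x y : S x -> S y -> K y x = (K x y)^*%R.
Proof. by move=> Sx Sy; have [] := hermitian_form2 (form2 Sx Sy). Qed.

Lemma posdef_CS x y : S x -> S y ->
  complex.Re (K x y) ^+ 2 + complex.Im (K x y) ^+ 2 <= complex.Re (K x x) * complex.Re (K y y).
Proof. by move=> Sx Sy; have [] := hermitian_form2 (form2 Sx Sy). Qed.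

Lemma posdef_norm_le x y : S x -> S y ->
  complex.Re `|K x y| <= 2^-1 * (complex.Re (K x x) + complex.Re (K y y)).
Proof.
move=> Sx Sy; have := posdef_CS Sx Sy.
have /complex_le0[x0 _] := posdef_diag Sx; have /complex_le0[y0 _] := posdef_diag Sy.
move: x0 y0; case: (K x y) => a b /=; set p := complex.Re _; set q := complex.Re _ => p0 q0 h.
rewrite -[leRHS]ger0_norm; last by rewrite mulr_ge0 ?invr_ge0 ?addr_ge0.
rewrite -sqrtr_sqr ler_wsqrtr// (le_trans h)//.
have := sqr_ge0 (p - q); rewrite !expr2; lra.
Qed.

(** The squared distance between the feature vectors of x and x'; [posdef_gap] is Cauchy-Schwarz for
    their difference against the feature vector of y. *)
Definition kernel_gap x x' : R[i] := K x x - K x x' - K x' x + K x' x'.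

Lemma posdef_gap x x' y : S x -> S x' -> S y ->
  0 <= kernel_gap x x' /\
  (complex.Re `|K x y - K x' y|) ^+ 2 <= complex.Re (kernel_gap x x') * complex.Re (K y y).
Proof.
move=> Sx Sx' Sy.
have [] := @hermitian_form2 (kernel_gap x x') (K x y - K x' y) (K y x - K y x') (K y y).
  move=> a b.
  have h (i : 'I_3) : S (tnth [tuple x; x'; y] i).
    by case: i => [[|[|[|//]]] ?]; rewrite !(tnth_nth x).
  have := pK (fun i : 'I_3 => tnth [tuple a; - a; b] i) h.
  rewrite !big_ord_recl !big_ord0 /= !(tnth_nth x) !(tnth_nth 0)/= rmorphN /kernel_gap.
  by move=> {}h; apply: le_trans h _; rewrite le_eqVlt; apply/orP; left; apply/eqP; ring.
move=> A0 _ _ h; split=> //; apply: le_trans h.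
by rewrite normc_def/= sqr_sqrtr// addr_ge0 ?sqr_ge0.
Qed.

End kernel.
End posdef.

(** * Complex expansions with summable coefficients *)

Section hat_coef.
Variables (R : realType) (d : dimension).
Hypothesis d2 : dim_ge2 d.
Local Notation E := (euclidean R d).
Local Notation H n t := (gegenbauer_hat (dim_index R d) n (t : R)).
Implicit Types (F G : R -> R[i]) (a b : nat -> R[i]).

(** The summable majorant is part of the notion because uniqueness of coefficients rests on termwise
    integration of a uniformly convergent series. *)
Definition hat_coef F a : Prop :=
  (exists2 B : nat -> R, (forall n, `|a n| <= (B n)%:C) & cvgn (series B)) /\
  forall t, -1 <= t <= 1 -> series (fun n => a n * (H n t)%:C) @ \oo --> F t.

Lemma hat_coefD F G a b : hat_coef F a -> hat_coef G b ->
  hat_coef (fun t => F t + G t) (fun n => a n + b n).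
Proof.
move=> [[A aA cA] aF] [[B bB cB] bG]; split.
  exists (A \+ B) => [n|]; last exact: is_cvg_seriesD.
  by rewrite (le_trans (ler_normD _ _))// rmorphD lerD.
move=> t t1; rewrite (_ : series _ = series (fun n => a n * (H n t)%:C) +
    series (fun n => b n * (H n t)%:C)); first by apply: cvgD; [exact: aF|exact: bG].
by apply/funext => n; rewrite /series/= -[RHS]big_split; apply: eq_bigr => i _; rewrite mulrDl.
Qed.

Lemma hat_coefZ F a z : hat_coef F a -> hat_coef (fun t => z * F t) (fun n => z * a n).
Proof.
move=> [[A aA cA] aF]; split.
  exists (complex.Re `|z| *: A) => [n|]; last exact: is_cvg_seriesZ.
  rewrite -[(_ *: A) n]/(complex.Re `|z| * A n) rmorphM/= -normc_ReE normrM.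
  by rewrite ler_wpM2l.
move=> t t1; rewrite (_ : series _ = (fun n => z * series (fun n => a n * (H n t)%:C) n)).
  by apply: cvgMl_tmp; exact: aF.
by apply/funext => n; rewrite /series/= mulr_sumr; apply: eq_bigr => i _; rewrite mulrA.
Qed.

Lemma eq_hat_coef F G a b : (forall t, -1 <= t <= 1 -> F t = G t) -> a =1 b ->
  hat_coef F a -> hat_coef G b.
Proof.
move=> FG ab [aA aF]; have <- : a = b by apply/funext => n; exact: ab.
split; first exact: aA.
by move=> t t1; rewrite -(FG t t1); exact: aF.
Qed.

Lemma hat_coef0 : hat_coef (fun=> 0) (fun=> 0).
Proof.
split=> [|t t1].
  exists (fun=> 0) => [n|]; first by rewrite normr0.
  by rewrite (_ : series _ = fun=> 0); [exact: is_cvg_cst|apply/funext => n; rewrite /series/= big1].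
by rewrite (_ : series _ = fun=> 0); [exact: cvg_cst|apply/funext => n; rewrite /series/= big1// => i _; rewrite mul0r].
Qed.

Lemma hat_coef_sum (I : Type) (s : seq I) (F : I -> R -> R[i]) (a : I -> nat -> R[i]) :
  (forall i, hat_coef (F i) (a i)) ->
  hat_coef (fun t => \sum_(i <- s) F i t) (fun n => \sum_(i <- s) a i n).
Proof.
move=> Fa; elim: s => [|i s IH].
  by apply: eq_hat_coef hat_coef0 => [t _|n]; rewrite big_nil.
by apply: eq_hat_coef (hat_coefD (Fa i) IH) => [t _|n]; rewrite big_cons.
Qed.

Lemma hat_coef_unique F a b : hat_coef F a -> hat_coef F b -> a =1 b.
Proof.
move=> Fa Fb n; have [[B bB cB] c0] := hat_coefD Fa (hat_coefZ (-1) Fb).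
have part (f : R[i] -> R) : (forall z, `|f z| <= complex.Re `|z|) ->
    (forall t, -1 <= t <= 1 -> series (fun n => f (a n + -1 * b n) * H n t) @ \oo --> (0 : R)) ->
    f (a n + -1 * b n) = 0.
  move=> fz f0; apply: (hat_expansion_unique d2 (a := fun n => f (a n + -1 * b n)) (b := B)) => // k.
  by rewrite (le_trans (fz _))//; have := bB k; rewrite normc_ReE lecR.
have ReI : complex.Re (a n + -1 * b n) = 0.
  apply: part (@Re_le_norm R) _ => t t1; have /cvg_series_scaleP[+ _] := c0 t t1.
  by rewrite mulN1r subrr.
have ImI : complex.Im (a n + -1 * b n) = 0.
  apply: part (@Im_le_norm R) _ => t t1; have /cvg_series_scaleP[_ +] := c0 t t1.
  by rewrite mulN1r subrr.
by apply/eqP; rewrite -subr_eq0 -mulN1r; apply/eqP/complex_eqP.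
Qed.

Lemma nonneg_hat_coef (f : R -> R) : {within `[(-1 : R), 1]%classic, continuous f} ->
  pd_zonal d f -> exists2 a : nat -> R, (forall n, 0 <= a n) &
    hat_coef (fun t => (f t)%:C) (fun n => (a n)%:C).
Proof.
move=> cf pf; have [a a0 af] := hat_expansion d2 cf pf; exists a => //; split.
  exists a => [n|]; first by rewrite normc_ReE/= expr0n addr0 sqrtr_sqr ger0_norm.
  have h : -1 <= (1 : R) <= 1 by apply/andP; split; lra.
  have /cvgP := af 1 h.
  by rewrite (_ : (fun n => _) = a)//; apply/funext => n; rewrite hat1// mulr1.
move=> t t1; apply/cvg_series_scaleP; split; first exact: af.
rewrite (_ : series _ = fun=> 0); first exact: cvg_cst.
by apply/funext => n; rewrite /series/= big1// => i _; rewrite mul0r.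
Qed.

End hat_coef.

Lemma posdef_finType (R : realType) (X : Type) (S : set X) (K : X -> X -> R[i]) (I : finType)
    (x : I -> X) (c : I -> R[i]) : posdef_on S K -> (forall i, S (x i)) ->
  0 <= \sum_i \sum_j c i * (c j)^* * K (x i) (x j).
Proof.
move=> pK Sx; have := pK _ (fun i : 'I_#|I| => x (enum_val i)) (fun i => c (enum_val i)).
move=> /(_ (fun i => Sx (enum_val i))) h.
have key (G : I -> R[i]) : \sum_i G i = \sum_(i < #|I|) G (enum_val i).
  by rewrite -(big_enum_val (A := I)).
by rewrite key; under eq_bigr do rewrite key.
Qed.

(** * The kernel at fixed radii as a function of the cosine *)

Section profile.
Variables (R : realType) (d : dimension).
Hypothesis d2 : dim_ge2 d.
Local Notation E := (euclidean R d).
Variables (K : E -> E -> R[i]) (kappa : R -> R -> R -> R[i]).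
Hypothesis kr : kappa_representation K kappa.
Local Notation I11 := `[(-1 : R), 1]%classic.

Definition profile r s (t : R) := kappa r s (r * s * t).

Lemma profile_dot r s (u v : E) : 0 <= r -> 0 <= s -> euclid_dot u u = 1 ->
  euclid_dot v v = 1 -> profile r s (euclid_dot u v) = K (r *: u) (s *: v).
Proof.
move=> r0 s0 u1 v1; rewrite kr.2 !euclid_normZ /euclid_norm u1 v1 sqrtr1 !mulr1 !ger0_norm//.
by rewrite euclid_dotZl euclid_dotZr mulrA.
Qed.

Lemma kappa_domain_profile (r s t : R) : 0 <= r -> 0 <= s -> -1 <= t <= 1 ->
  kappa_domain (r, s, r * s * t).
Proof.
move=> r0 s0 t1; split => //=; rewrite normrM ger0_norm ?mulr_ge0//.
by rewrite ler_piMr ?mulr_ge0// ler_norml.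
Qed.

Lemma profile_continuous r s : 0 <= r -> 0 <= s -> {within I11, continuous (profile r s)}.
Proof.
move=> r0 s0; have I11E (t : R) : I11 t = (-1 <= t <= 1) :> Prop by rewrite /= in_itv.
apply/subspace_continuousP => t; rewrite I11E => t1.
have /subspace_continuousP/(_ _ (kappa_domain_profile r0 s0 t1)) := kr.1.
pose g (x : R) := (r, s, r * s * x).
have cg : g @ t --> g t.
  have h : (fun x : R => r * s * x) @ t --> r * s * t by apply: cvgMl_tmp; exact: cvg_id.
  exact: (cvg_pair (cvg_cst (r, s) : (fun _ : R => (r, s)) @ t --> (r, s)) h).
apply: (@cvg_comp _ _ _ g (fun p => kappa p.1.1 p.1.2 p.2)) => A h; have := cg _ h; apply: (@filterS _ (nbhs t)) => x /= gA.
by move=> Ix; apply: gA; apply: kappa_domain_profile; rewrite -?I11E.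
Qed.

Lemma unit_pair_dot (t : R) : -1 <= t <= 1 -> exists u v : E,
  [/\ euclid_dot u u = 1, euclid_dot v v = 1 & euclid_dot u v = t].
Proof.
move=> t1; have [e [f [e1 f1 ef]]] := euclid_orthonormal_pair R d2.
have sq : Num.sqrt (1 - t ^+ 2) ^+ 2 = 1 - t ^+ 2.
  by rewrite sqr_sqrtr// expr2; case/andP: t1 => *; nra.
exists e, (t *: e + Num.sqrt (1 - t ^+ 2) *: f).
rewrite !(euclid_dotDl, euclid_dotDr, euclid_dotZl, euclid_dotZr) e1 f1 (euclid_dotC f) ef.
split=> //; last by ring.
by transitivity (t ^+ 2 + Num.sqrt (1 - t ^+ 2) ^+ 2); [ring|rewrite sq addrC subrK].
Qed.

Lemma profile_exists r s t : 0 <= r -> 0 <= s -> -1 <= t <= 1 ->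
  exists x y : E, profile r s t = K x y.
Proof.
move=> r0 s0 /unit_pair_dot[u [v [u1 v1 <-]]].
by exists (r *: u), (s *: v); rewrite profile_dot.
Qed.

Hypothesis pK : posdef_on setT K.

Section quadratic.
Variables (k : nat) (r : 'I_k -> R) (c : 'I_k -> R[i]).
Hypothesis r0 : forall i, 0 <= r i.

Let G t := \sum_(i < k) \sum_(j < k) c i * (c j)^* * profile (r i) (r j) t.

(** This is the quadratic form of K at the points r_i u_p with coefficients c_i w_p, indexed by
    pairs (i, p). *)
Let G_ge0 (s : seq (R * E)) : all (fun p => euclid_dot p.2 p.2 == 1) s ->
  0 <= \sum_(p <- s) \sum_(q <- s) (p.1 * q.1)%:C * G (euclid_dot p.2 q.2).
Proof.
move=> s1; pose p0 : R * E := (0, 0).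
pose x (ip : 'I_k * 'I_(size s)) : E := r ip.1 *: (nth p0 s ip.2).2.
pose b (ip : 'I_k * 'I_(size s)) := c ip.1 * ((nth p0 s ip.2).1)%:C.
have := @posdef_finType _ _ _ K _ x b pK (fun _ => I).
move=> h; apply: le_trans h _; rewrite le_eqVlt; apply/orP; left; apply/eqP.
rewrite (big_nth p0) big_mkord.
under [RHS]eq_bigr do rewrite (big_nth p0) big_mkord.
rewrite -(pair_bigA _ (fun i p => \sum_jq b (i, p) * (b jq)^* * K (x (i, p)) (x jq)))/=.
rewrite exchange_big; apply: eq_bigr => p _.
under eq_bigr => i _ do rewrite -(pair_bigA _ (fun j q => b (i, p) * (b (j, q))^* * K (x (i, p)) (x (j, q))))/= exchange_big.
rewrite exchange_big; apply: eq_bigr => q _; rewrite mulr_sumr; apply: eq_bigr => i _.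
rewrite mulr_sumr; apply: eq_bigr => j _; rewrite profile_dot//.
- by rewrite /b/= !rmorphM/= conj_real; ring.
- by apply/eqP/(allP s1)/mem_nth.
- by apply/eqP/(allP s1)/mem_nth.
Qed.

(** For unit u, v with <u, v> = t, symmetry of the inner product makes the form at u and v with
    weights 1 equal to 2 G(1) + 2 G(t); it is real, and so is G(1). *)
Let G_real t : -1 <= t <= 1 -> complex.Im (G t) = 0.
Proof.
move=> /unit_pair_dot[u [v [u1 v1 uv]]].
have /complex_le0[_ h1] : 0 <= \sum_(p <- [:: (1, u)]) \sum_(q <- [:: (1, u)]) (p.1 * q.1)%:C * G (euclid_dot p.2 q.2).
  by apply: G_ge0; rewrite /= u1 eqxx.
have /complex_le0[_ h2] : 0 <= \sum_(p <- [:: (1, u); (1, v)]) \sum_(q <- [:: (1, u); (1, v)]) (p.1 * q.1)%:C * G (euclid_dot p.2 q.2).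
  by apply: G_ge0; rewrite /= u1 v1 eqxx.
move: h1 h2; rewrite !big_cons !big_nil /= !mulr1 !mul1r !addr0 u1 v1 (euclid_dotC v u) uv !raddfD/= => h1 h2.
lra.
Qed.

Lemma profile_quadratic : exists2 a : nat -> R[i], (forall n, 0 <= a n) & hat_coef d G a.
Proof.
have cG : {within I11, continuous G}.
  move=> t; apply: (@cvg_sumr _ _ _ _ (nbhs t)) => i.
  apply: (@cvg_sumr _ _ _ _ (nbhs t)) => j.
  by apply: cvgMl_tmp; exact: profile_continuous.
have /within_complexP[cR _] := cG.
have [|a a0 ha] := nonneg_hat_coef d2 cR.
  move=> s /G_ge0/complex_le0[+ _]; rewrite raddf_sum => h.
  apply: le_trans h _; rewrite le_eqVlt; apply/orP; left; apply/eqP.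
  apply: eq_bigr => p _; rewrite raddf_sum; apply: eq_bigr => q _.
  transitivity (complex.Re (G (euclid_dot p.2 q.2) * (p.1 * q.1)%:C)); first by rewrite mulrC.
  by rewrite complex_ReMr mulrC.
exists (fun n => (a n)%:C) => [n|]; first by rewrite lecR.
apply: eq_hat_coef ha => // t t1; apply/complex_eqP => /=; split => //.
by rewrite G_real.
Qed.

End quadratic.
End profile.

Lemma cvg_within_comp (T U V : topologicalType) (A : set T) (B : set U) (g : T -> U)
    (f : U -> V) x : g @ x --> g x -> (forall y, A y -> B (g y)) -> A x ->
  {within B, continuous f} -> (fun y => f (g y)) @ within A (nbhs x) --> f (g x).
Proof.
move=> cg AB Ax /subspace_continuousP/(_ _ (AB x Ax)).
apply: (@cvg_comp _ _ _ g f) => C h; have := cg _ h.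
by apply: (@filterS _ (nbhs x)) => y /= gC Ay; exact/gC/AB.
Qed.

Lemma dini (R : realType) (X : topologicalType) (A : set X) (T : nat -> X -> R) (e : R) :
  compact A -> (forall N, {within A, continuous (T N)}) ->
  (forall N x, A x -> T N.+1 x <= T N x) ->
  (forall x, A x -> T N x @[N --> \oo] --> (0 : R)) -> 0 < e ->
  \forall N \near \oo, forall x, A x -> T N x <= e.
Proof.
move=> cA cT dT T0 e0; move/compact_near_coveringP/near_covering_withinP : cA.
move=> /(_ _ \oo (fun N x => T N x <= e)); apply => x Ax.
have e2 : 0 < e / 2 by rewrite divr_gt0.
have /cvgrPdist_le/(_ _ e2)[N _ hN] := T0 x Ax.
have TN : T N x <= e / 2.
  by have := hN N (leqnn N); rewrite sub0r normrN; exact: le_trans (ler_norm _).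
have /subspace_continuousP/(_ x Ax)/cvgrPdist_le/(_ _ e2) := cT N.
rewrite near_withinE => hx.
exists ([set y | A y -> `|T N x - T N y| <= e / 2], [set n | (N <= n)%N]).
  by split => //; exists N.
move=> [y n] /= [hy Nn] Ay.
have mono : T n y <= T N y.
  elim: n Nn => [|n IH]; first by rewrite leqn0 => /eqP ->.
  by rewrite leq_eqVlt => /predU1P[->//|/IH]; exact: le_trans (dT _ _ Ay).
have := hy Ay; rewrite distrC => /(le_trans (ler_norm _)) h.
by rewrite (le_trans mono)// [e]splitr; lra.
Qed.

Section profile_coefficients.
Variables (R : realType) (d : dimension).
Hypothesis d2 : dim_ge2 d.
Local Notation E := (euclidean R d).
Variables (K : E -> E -> R[i]) (kappa : R -> R -> R -> R[i]).
Hypotheses (kr : kappa_representation K kappa) (pK : posdef_on setT K).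
Local Notation F := (profile kappa).

(** Polarisation: with G_z the form for radii r, s and coefficients 1, z, one has 4 F r s = G_1 -
    G_{-1} + i G_i - i G_{-i}. *)
Lemma profile_hat_coef r s : 0 <= r -> 0 <= s -> exists a, hat_coef d (F r s) a.
Proof.
move=> r0 s0; pose G (z : R[i]) t := \sum_(i < 2) \sum_(j < 2)
  (if i == ord0 then 1 else z) * (if j == ord0 then 1 else z)^* *
  F (if i == ord0 then r else s) (if j == ord0 then r else s) t.
have coefG z : exists a, hat_coef d (G z) a.
  have [|a _ ha] := @profile_quadratic R d d2 K kappa kr pK 2 (fun i => if i == ord0 then r else s) (fun i => if i == ord0 then 1 else z).
    by move=> i; case: ifP.
  by exists a.
have [a1 h1] := coefG 1; have [a2 h2] := coefG (-1).
pose I : R[i] := Complex 0 1.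
have I2 : I * I = -1 by apply/complex_eqP; rewrite complex_ReM complex_ImM /=; split; ring.
have Ic : (I)^*%R = - I by apply/complex_eqP; split; rewrite /= ?oppr0.
have Inc : (- I)^*%R = I by apply/complex_eqP; split; rewrite /= ?oppr0 ?opprK.
have N1c : (- 1 : R[i])^*%R = - 1 by rewrite rmorphN rmorph1.
have [a3 h3] := coefG I; have [a4 h4] := coefG (- I).
have := hat_coefD (hat_coefD (hat_coefZ 4^-1 h1) (hat_coefZ (- 4^-1) h2))
  (hat_coefD (hat_coefZ (4^-1 * I) h3) (hat_coefZ (- 4^-1 * I) h4)).
move=> h; exists (fun n => 4^-1 * a1 n + - 4^-1 * a2 n +
  (4^-1 * I * a3 n + - 4^-1 * I * a4 n)).
apply: eq_hat_coef h => // t _; rewrite /G !big_ord_recl !big_ord0 /= Ic Inc N1c rmorph1.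
transitivity (F r s t + 2^-1 * (1 + I * I) * (F s r t - F r s t)); first by field.
by rewrite I2; ring.
Qed.

Lemma profile_hat_coefs : exists alpha : nat -> R -> R -> R[i],
  forall r s, 0 <= r -> 0 <= s -> hat_coef d (F r s) (fun n => alpha n r s).
Proof.
have H (p : R * R) : exists a, 0 <= p.1 -> 0 <= p.2 -> hat_coef d (F p.1 p.2) a.
  have [[p1 p2]|] := pselect (0 <= p.1 /\ 0 <= p.2).
    by have [a ha] := profile_hat_coef p1 p2; exists a.
  by move=> np; exists (fun=> 0) => p1 p2; case: np.
have [a ha] := boolp.choice H.
by exists (fun n r s => a (r, s) n) => r s r0 s0; exact: (ha (r, s) r0 s0).
Qed.

End profile_coefficients.

Lemma halflineE (R : realType) (r : R) : @halfline R r = (0 <= r) :> Prop.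
Proof. by rewrite /halfline/= in_itv/= andbT. Qed.

Lemma halflineP (R : realType) (r : R) : 0 <= r -> halfline r.
Proof. by rewrite halflineE. Qed.

Lemma cvg_complex_distP (R : realType) (T : Type) (W : set_system T) (FW : Filter W)
    (f : T -> R[i]) (l : R[i]) :
  f @ W --> l <-> forall e : R, 0 < e -> \forall x \near W, complex.Re `|f x - l| <= e.
Proof.
split=> [/cvgrPdist_le fl e e0|fl].
  have e0' : 0 < e%:C :> R[i] by rewrite ltcR.
  by apply: filterS (fl _ e0') => x; rewrite distrC [X in X <= _]normc_ReE lecR.
apply/cvg_complexP; split; apply/cvgrPdist_le => e e0; apply: filterS (fl e e0) => x h;
  rewrite distrC -raddfB.
  exact: le_trans (Re_le_norm _) h.
exact: le_trans (Im_le_norm _) h.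
Qed.

Lemma cvg_complex_squeeze (R : realType) (T : Type) (W : set_system T) (FW : Filter W)
    (f : T -> R[i]) (l : R[i]) (B : T -> R) :
  B @ W --> (0 : R) -> (\forall x \near W, complex.Re `|f x - l| <= B x) -> f @ W --> l.
Proof.
move=> /cvgrPdist_le B0 fB; apply/cvg_complex_distP => e e0.
apply: filterS2 (B0 e e0) fB => x h1 /le_trans; apply; apply: le_trans h1.
by rewrite sub0r normrN ler_norm.
Qed.

(** * Positive definiteness and continuity of the coefficient kernels *)

Section coefficient_kernels.
Variables (R : realType) (d : dimension).
Hypothesis d2 : dim_ge2 d.
Local Notation E := (euclidean R d).
Local Notation H n t := (gegenbauer_hat (dim_index R d) n (t : R)).
Variables (K : E -> E -> R[i]) (kappa : R -> R -> R -> R[i]).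
Hypotheses (kr : kappa_representation K kappa) (pK : posdef_on setT K).
Local Notation F := (profile kappa).
Variable alpha : nat -> R -> R -> R[i].
Hypothesis Fa : forall r s, 0 <= r -> 0 <= s -> hat_coef d (F r s) (fun n => alpha n r s).

(** K along a ray; as the polynomials are 1 at 1, it is the sum of all alpha_n. *)
Let diag x y := kappa x y (x * y).

Let diagE x y : F x y 1 = diag x y.
Proof. by rewrite /profile mulr1. Qed.

(** By uniqueness of coefficients the quadratic form of alpha_n is the n-th coefficient of the form
    in [profile_quadratic], which is nonnegative. *)
Lemma coefficient_posdef n : posdef_on halfline (alpha n).
Proof.
move=> k r c r0; have {}r0 i : 0 <= r i by have := r0 i; rewrite halflineE.
have [a a0 ha] := profile_quadratic d2 kr pK c r0.
have := hat_coef_sum (index_enum 'I_k) (fun i => hat_coef_sum (index_enum 'I_k)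
  (fun j => hat_coefZ (c i * (c j)^*) (Fa (r0 i) (r0 j)))).
by move=> /(hat_coef_unique d2 ha)/(_ n) <-.
Qed.

Lemma coefficient_sum r s : 0 <= r -> 0 <= s -> series (fun n => alpha n r s) @ \oo --> diag r s.
Proof.
move=> r0 s0; have [_ h] := Fa r0 s0; rewrite -diagE.
have one : -1 <= (1 : R) <= 1 by apply/andP; split; lra.
have := h _ one; rewrite (_ : (fun n => alpha n r s * _) = (fun n => alpha n r s))//.
by apply/funext => n; rewrite hat1// mulr1.
Qed.

Lemma nonneg_term_le (u : nat -> R) l n : (forall k, 0 <= u k) -> series u @ \oo --> l -> u n <= l.
Proof.
move=> u0 ul; have nd : nondecreasing_seq (series u).
  by apply/nondecreasing_seqP => k; rewrite /series/= big_nat_recr//= lerDl.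
rewrite -(cvg_lim _ ul)//; apply: le_trans (nondecreasing_cvgn_le nd (cvgP _ ul) n.+1).
by rewrite /series/= big_nat_recr//= lerDr sumr_ge0.
Qed.

Lemma coefficient_diag_le n s : 0 <= s -> complex.Re (alpha n s s) <= complex.Re (diag s s).
Proof.
move=> s0; have /cvg_series_complexP[h _] := coefficient_sum s0 s0.
apply: (nonneg_term_le _ _ h) => k.
by have /complex_le0[] := posdef_diag (@coefficient_posdef k) (halflineP s0).
Qed.

(** The gaps of the alpha_k are nonnegative and sum over k to the gap of [diag], so each is at most
    that sum. *)
Lemma coefficient_gap_le n x y : 0 <= x -> 0 <= y ->
  0 <= complex.Re (kernel_gap (alpha n) x y) <= complex.Re (kernel_gap diag x y).
Proof.
move=> x0 y0; have gap0 k : 0 <= complex.Re (kernel_gap (alpha k) x y).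
  have [/complex_le0[]//] := posdef_gap (@coefficient_posdef k) (halflineP x0) (halflineP y0) (halflineP x0).
rewrite gap0 /=; have h := cvgD (cvgB (cvgB (coefficient_sum x0 x0) (coefficient_sum x0 y0))
  (coefficient_sum y0 x0)) (coefficient_sum y0 y0).
have /cvg_series_complexP[h' _] :
    series (fun k => kernel_gap (alpha k) x y) @ \oo --> kernel_gap diag x y.
  rewrite (_ : series _ = (fun N => series (fun k => alpha k x x) N - series (fun k => alpha k x y) N -
    series (fun k => alpha k y x) N + series (fun k => alpha k y y) N)); first exact: h.
  by apply/funext => N; rewrite /series/= /kernel_gap big_split !sumrB.
by apply: (nonneg_term_le _ _ h') => k.
Qed.

Local Notation H2 := (@halfline R `*` @halfline R).

Lemma diag_continuous : {within H2, continuous (fun p => diag p.1 p.2)}.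
Proof.
apply/subspace_continuousP => p Hp.
apply: (@cvg_within_comp _ _ _ _ (@kappa_domain R) (fun p : R * R => (p.1, p.2, p.1 * p.2)) (fun p => kappa p.1.1 p.1.2 p.2)) => //.
- have h1 : (fun p : R * R => p.1) @ p --> p.1 by exact: cvg_fst.
  have h2 : (fun p : R * R => p.2) @ p --> p.2 by exact: cvg_snd.
  exact: (cvg_pair (cvg_pair h1 h2) (cvgM h1 h2)).
- move=> [x y] /= [/=]; rewrite !halflineE => x0 y0; split=> //=.
  by rewrite ger0_norm// mulr_ge0.
- exact: kr.1.
Qed.

(** Varying one argument at a time, [posdef_gap] bounds the increments of alpha_n by gaps of [diag],
    which tend to 0 since [diag] is continuous. *)
Lemma coefficient_continuous n : {within H2, continuous (fun p => alpha n p.1 p.2)}.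
Proof.
apply/subspace_continuousP => -[r s] [/=]; rewrite !halflineE => r0 s0.
set W := within _ _.
have Hrs : H2 (r, s) by split; exact: halflineP.
have dcvg (g : R * R -> R * R) : g @ (r, s) --> g (r, s) -> (forall p, H2 p -> H2 (g p)) ->
    (fun p => complex.Re (diag (g p).1 (g p).2)) @ W --> complex.Re (diag (g (r, s)).1 (g (r, s)).2).
  move=> cg gH; have := cvg_within_comp cg gH Hrs diag_continuous.
  by move=> /cvg_complexP[].
have c1 : (fun p : R * R => p.1) @ (r, s) --> r by exact: cvg_fst.
have c2 : (fun p : R * R => p.2) @ (r, s) --> s by exact: cvg_snd.
have cc (a : R) : (fun p : R * R => a) @ (r, s) --> a by exact: cvg_cst.
have gap0 (g : R * R -> R) a : g @ (r, s) --> a -> g (r, s) = a -> 0 <= a ->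
    (forall p, H2 p -> 0 <= g p) ->
    (fun p => complex.Re (kernel_gap diag (g p) a)) @ W --> (0 : R).
  move=> cg ga a0 gH.
  have h1 := dcvg (fun p => (g p, g p)); have h2 := dcvg (fun p => (g p, a)).
  have h3 := dcvg (fun p => (a, g p)); have h4 := dcvg (fun p => (a, a)).
  have -> : 0 = complex.Re (diag a a) - complex.Re (diag a a) - complex.Re (diag a a) + complex.Re (diag a a) by ring.
  rewrite /kernel_gap; under eq_fun do rewrite raddfD/= !raddfB/=.
  apply: cvgD; [apply: cvgB; [apply: cvgB|]|].
  - by rewrite /= ga in h1; apply: h1 => [|p /gH h]; [exact: (cvg_pair cg cg)|split; exact: halflineP].
  - by rewrite /= ga in h2; apply: h2 => [|p /gH h]; [exact: (cvg_pair cg (cc a))|split; exact: halflineP].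
  - by rewrite /= ga in h3; apply: h3 => [|p /gH h]; [exact: (cvg_pair (cc a) cg)|split; exact: halflineP].
  - exact: cvg_cst.
pose B (p : R * R) := Num.sqrt (complex.Re (kernel_gap diag p.1 r) * complex.Re (diag p.2 p.2)) +
  Num.sqrt (complex.Re (kernel_gap diag p.2 s) * complex.Re (diag r r)).
have HP (p : R * R) : H2 p -> 0 <= p.1 /\ 0 <= p.2 by case: p => x y [/=]; rewrite !halflineE.
apply: (@cvg_complex_squeeze _ _ _ _ _ _ B).
  have -> : (0 : R) = Num.sqrt (0 * complex.Re (diag s s)) + Num.sqrt (0 * complex.Re (diag r r)).
    by rewrite !mul0r sqrtr0 addr0.
  apply: cvgD; (apply: (cvg_comp (fun p => _ * _) Num.sqrt); last exact: sqrt_continuous); apply: cvgM.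
  - by apply: gap0 => // p /HP[].
  - apply: (dcvg (fun p => (p.2, p.2))); first exact: (cvg_pair c2 c2).
    by move=> p /HP[_ h]; split; exact: halflineP.
  - by apply: gap0 => // p /HP[].
  - exact: cvg_cst.
rewrite near_withinE; apply: nearW => -[x y] /HP[/= x0 y0].
have pa := @coefficient_posdef n.
have key u v w : 0 <= u -> 0 <= v -> 0 <= w -> complex.Re `|alpha n u w - alpha n v w| <=
    Num.sqrt (complex.Re (kernel_gap diag u v) * complex.Re (diag w w)).
  move=> u0 v0 w0; have [_ h] := posdef_gap pa (halflineP u0) (halflineP v0) (halflineP w0).
  rewrite -[leLHS]ger0_norm; last by rewrite -lecR -normc_ReE; exact: normr_ge0.
  rewrite -sqrtr_sqr ler_wsqrtr// (le_trans h)//.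
  have /andP[g1 g2] := coefficient_gap_le n u0 v0.
  have /complex_le0[w1 _] := posdef_diag pa (halflineP w0).
  by rewrite ler_pM// coefficient_diag_le.
have tri (a b c : R[i]) : complex.Re `|a - c| <= complex.Re `|a - b| + complex.Re `|b - c|.
  by rewrite -lecR rmorphD/= -!normc_ReE ler_distD.
apply: (le_trans (tri _ (alpha n r y) _)); apply: lerD; first exact: key.
have -> : alpha n r y - alpha n r s = (alpha n y r - alpha n s r)^*%R.
  by rewrite rmorphB/= -!(posdef_herm pa)//; exact: halflineP.
by rewrite norm_conjC; exact: key.
Qed.

End coefficient_kernels.

(** * Existence of the Schoenberg kernels *)

Section schoenberg_exists.
Variables (R : realType) (d : dimension).
Hypothesis d2 : dim_ge2 d.
Local Notation E := (euclidean R d).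
Local Notation H n t := (gegenbauer_hat (dim_index R d) n (t : R)).

Lemma hat_coef_cst (z : R[i]) : hat_coef d (fun=> z) (fun n => if n == 0%N then z else 0).
Proof.
split=> [|t t1].
  exists (fun n => if n == 0%N then complex.Re `|z| else 0) => [n|].
    by case: eqP => _; rewrite ?normr0// -normc_ReE.
  apply/cvg_ex; exists (complex.Re `|z|); apply: cvg_near_cst; exists 1%N => // -[//|n] _.
  by rewrite /series/= big_nat_recl//= big1 ?addr0.
apply: cvg_near_cst; exists 1%N => // -[//|n] _.
by rewrite /series/= big_nat_recl//= big1 ?addr0 ?hat0 ?mulr1// => i _; rewrite mul0r.
Qed.

Variables (K : E -> E -> R[i]) (kappa : R -> R -> R -> R[i]).
Hypotheses (kr : kappa_representation K kappa) (pK : posdef_on setT K).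
Local Notation F := (profile kappa).
Variable alpha : nat -> R -> R -> R[i].
Hypothesis Fa : forall r s : R, 0 <= r -> 0 <= s -> hat_coef d (F r s) (fun n => alpha n r s).

Lemma coefficient_zero r s : 0 <= r -> 0 <= s -> r * s = 0 -> forall n,
  alpha n r s = if n == 0%N then kappa r s 0 else 0.
Proof.
move=> r0 s0 rs; apply: (hat_coef_unique d2 (Fa r0 s0)).
apply: eq_hat_coef (hat_coef_cst (kappa r s 0)) => // t _.
by rewrite /profile rs mul0r.
Qed.

Lemma coefficient_series : series_representation K alpha.
Proof.
split=> x y.
  move=> x0 y0; have [_ h] := Fa (euclid_norm_ge0 x) (euclid_norm_ge0 y).
  have ux := euclid_unit x0; have uy := euclid_unit y0.
  have e := profile_dot kr (euclid_norm_ge0 x) (euclid_norm_ge0 y) ux uy.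
  rewrite !scalerA !divff ?scale1r ?euclid_norm_eq0// in e.
  by rewrite -e; exact: (h _ (euclid_unit_dot ux uy)).
move=> xy; rewrite coefficient_zero ?euclid_norm_ge0//; last first.
  by case: xy => ->; rewrite euclid_norm0 ?mulr0 ?mul0r.
by rewrite /= kr.2; case: xy => ->; rewrite ?euclid_dot0l ?euclid_dot0r.
Qed.

Let tail N s := complex.Re (kappa s s (s * s)) - complex.Re (series (fun n => alpha n s s) N).

Let diag_ge0 n s : 0 <= s -> 0 <= complex.Re (alpha n s s).
Proof.
move=> s0.
by have /complex_le0[] := posdef_diag (coefficient_posdef d2 kr pK Fa n) (halflineP s0).
Qed.

Let tail_cvg s : 0 <= s -> tail N s @[N --> \oo] --> (0 : R).
Proof.
move=> s0; have /cvg_complexP[h _] := coefficient_sum d2 Fa s0 s0.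
by rewrite -[X in _ --> X](subrr (complex.Re (kappa s s (s * s)))); apply: cvgB => //; exact: cvg_cst.
Qed.

Let tail_decr N s : 0 <= s -> tail N.+1 s <= tail N s.
Proof.
move=> s0; rewrite /tail /series/= big_nat_recr//= raddfD/= opprD addrA lerBlDr lerDl.
exact: diag_ge0.
Qed.

Let tail_ge0 N s : 0 <= s -> 0 <= tail N s.
Proof.
move=> s0; apply: (ler_cvg_to (tail_cvg s0) (cvg_cst (tail N s))).
exists N => // n /= ; elim: n => [|n IH]; first by rewrite leqn0 => /eqP ->.
by rewrite leq_eqVlt => /predU1P[->//|/IH]; exact: le_trans (tail_decr _ s0).
Qed.

Let tail_sum N s : 0 <= s ->
  (\sum_(N <= n <oo) (complex.Re (alpha n s s))%:E)%E = (tail N s)%:E.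
Proof.
move=> s0; apply: cvg_lim => //.
have /cvg_complexP[h _] := coefficient_sum d2 Fa s0 s0.
have {h} : (fun m => complex.Re (series (fun n => alpha n s s) m) -
    complex.Re (series (fun n => alpha n s s) N)) @ \oo --> tail N s.
  by apply: cvgB; [exact: h|exact: cvg_cst].
move=> h; apply: cvg_EFin; first by apply: nearW => m; rewrite sumEFin.
apply: cvg_trans h; apply: near_eq_cvg; exists N => // m /= Nm.
rewrite sumEFin/= /series/= (big_cat_nat (n := N) (m := 0%N) (p := m))//= raddfD/= addrAC subrr add0r.
by rewrite raddf_sum.
Qed.

Let within_diag (f : R * R -> R[i]) (A : set R) : A `<=` halfline ->
  {within (@halfline R `*` @halfline R), continuous f} ->
  {within A, continuous (fun s => complex.Re (f (s, s)))}.
Proof.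
move=> AH cf; apply/subspace_continuousP => s As.
have := @cvg_within_comp _ _ _ A _ (fun s : R => (s, s)) f s _ _ As cf.
case/(_ _ _)/cvg_complexP => //; first exact: (cvg_pair cvg_id cvg_id).
by move=> t /AH.
Qed.

(** On a compact neighbourhood of r the tails of the diagonal series are continuous and decrease to
    0, so Dini's theorem makes the convergence uniform. *)
Lemma coefficient_tails : locally_uniform_tails alpha.
Proof.
move=> r r0; pose U : set R := `[Num.max 0 (r - 1), r + 1]%classic.
have UE s : U s -> 0 <= s.
  by rewrite /U /= in_itv/= => /andP[+ _]; rewrite ge_max => /andP[].
have UH : U `<=` halfline by move=> s /UE/halflineP.
exists U; split => //.
  have /cvgrPdist_le/(_ _ ltr01) : (fun x : R => x) @ r --> r by exact: cvg_id.
  rewrite /within/=; apply: (@filterS _ (nbhs r)) => s; rewrite ler_norml => /andP[h1 h2].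
  by rewrite halflineE => s0; rewrite /U /= in_itv/= ge_max s0; apply/andP; split; lra.
have cU : compact U by exact: segment_compact.
have cT N : {within U, continuous (tail N)}.
  have -> : tail N = (fun s => complex.Re (kappa s s (s * s)) -
      \sum_(0 <= n < N) complex.Re (alpha n s s)).
    by apply/funext => s; rewrite /tail /series/= raddf_sum.
  move=> s; apply: cvgB.
    exact: (within_diag UH (diag_continuous kr)).
  apply: (@cvg_sumr _ _ _ _ (nbhs s)) => n.
  have c := @coefficient_continuous R d d2 K kappa kr pK alpha Fa n.
  have h := within_diag UH c.
  exact: (h s).
have unif e : 0 < e -> \forall N \near \oo, forall s, U s -> tail N s <= e.
  by apply: dini => // [N s /UE|s /UE]; [exact: tail_decr|exact: tail_cvg].
have Ur : U r by rewrite /U /= in_itv/= ge_max r0; apply/andP; split; lra.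
have sup_le N (e : R) : (forall s, U s -> tail N s <= e) ->
   (0 <= ereal_sup [set (\sum_(N <= n <oo) (complex.Re (alpha n s s))%:E)%E | s in U] <= e%:E)%E.
  move=> h; apply/andP; split.
    apply: (@le_trans _ _ (tail N r)%:E); first by rewrite lee_fin tail_ge0.
    by apply: ereal_sup_ubound; exists r => //; rewrite tail_sum.
  by apply: ge_ereal_sup => _ [s Us <-]; rewrite tail_sum ?lee_fin ?h//; exact: UE.
apply: cvg_EFin.
  apply: filterS (unif 1 ltr01) => N /sup_le/andP[h1 h2].
  by rewrite fin_numE; apply/andP; split; [rewrite gt_eqF// (lt_le_trans _ h1)|rewrite lt_eqF// (le_lt_trans h2)// ltry].
apply/cvgrPdist_le => e e0; apply: filterS (unif e e0) => N /sup_le/andP[h1 h2].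
rewrite sub0r normrN /=; move: h1 h2; case: ereal_sup => [x|//|//]; rewrite !lee_fin /= => h1 h2.
by rewrite ger0_norm.
Qed.

Lemma coefficient_schoenberg : schoenberg_kernels K alpha.
Proof.
split.
- exact: (coefficient_continuous d2 kr pK Fa).
- exact: (coefficient_posdef d2 kr pK Fa).
- exact: coefficient_series.
- exact: coefficient_tails.
- by move=> [//|n] r _ r0; rewrite !coefficient_zero ?mulr0 ?mul0r.
Qed.

End schoenberg_exists.

(** * From the series back to the kernel *)

Section schoenberg.
Variables (R : realType) (d : dimension).
Hypothesis d2 : dim_ge2 d.
Local Notation E := (euclidean R d).
Local Notation H n t := (gegenbauer_hat (dim_index R d) n (t : R)).
Variables (K : E -> E -> R[i]) (alpha : nat -> R -> R -> R[i]).
Hypothesis sk : schoenberg_kernels K alpha.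

Let pa n : posdef_on halfline (alpha n). Proof. by case: sk. Qed.

Lemma schoenberg_diag_ge0 n r : 0 <= r -> 0 <= complex.Re (alpha n r r).
Proof. by move=> r0; have /complex_le0[] := posdef_diag (@pa n) (halflineP r0). Qed.

(** Condition (a) in terms of finite sums of reals, free of the extended-valued supremum. *)
Lemma schoenberg_tail (r e : R) : 0 <= r -> 0 < e -> exists N : nat, within halfline (nbhs r)
  [set s | forall m, (N <= m)%N -> \sum_(N <= n < m) complex.Re (alpha n s s) <= e].
Proof.
move=> r0 e0; have [_ _ _ tails _] := sk.
have [U [UH Ur /fine_cvgP[fU /cvgrPdist_le/(_ e e0) cU]]] := tails r r0.
have [N _ /(_ N (leqnn N)) [/= fN hN]] := filterI fU cU.
exists N; apply: (filterS _ Ur) => s Us m Nm.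
have s0 : 0 <= s by rewrite -halflineE; exact: UH.
rewrite -lee_fin -sumEFin.
have h : (\sum_(N <= n < m) (complex.Re (alpha n s s))%:E <= \sum_(N <= n <oo) (complex.Re (alpha n s s))%:E)%E.
  by apply: nneseries_lim_ge => n _; rewrite lee_fin schoenberg_diag_ge0.
apply: (le_trans h); apply: (@le_trans _ _ (ereal_sup [set (\sum_(N <= n <oo) (complex.Re (alpha n s s))%:E)%E | s in U])).
  by apply: ereal_sup_ubound; exists s.
rewrite -(fineK fN) lee_fin; move: hN; rewrite sub0r normrN; exact: le_trans (ler_norm _).
Qed.

Lemma schoenberg_summable r : 0 <= r -> cvgn (series (fun n => complex.Re (alpha n r r))).
Proof.
move=> r0; have [N /nbhs_singleton/(_ (halflineP r0))/= hN] := schoenberg_tail r0 ltr01.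
apply: (series_nneg_cvg (M := series (fun n => complex.Re (alpha n r r)) N + 1)) => n.
  exact: schoenberg_diag_ge0.
have [Nn|nN] := leqP N n.
  by rewrite /series/= (big_cat_nat (n := N) (m := 0%N) (p := n))//= lerD2l hN.
rewrite /series/= (big_cat_nat (n := n) (m := 0%N) (p := N))//= ?(ltnW nN)// -addrA lerDl addr_ge0//.
by apply: sumr_ge0 => i _; exact: schoenberg_diag_ge0.
Qed.

Let bound n r s : R := 2^-1 * (complex.Re (alpha n r r) + complex.Re (alpha n s s)).

Lemma schoenberg_bound n r s : 0 <= r -> 0 <= s -> `|alpha n r s| <= (bound n r s)%:C.
Proof.
move=> r0 s0; rewrite normc_ReE lecR.
exact: (posdef_norm_le (@pa n) (halflineP r0) (halflineP s0)).
Qed.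

Let zero n r s : (1 <= n)%N -> 0 <= r -> 0 <= s -> r * s = 0 -> alpha n r s = 0.
Proof.
move=> n1 r0 s0 /eqP; have [_ _ _ _ z] := sk; rewrite mulf_eq0 => /orP[/eqP ->|/eqP ->].
  by case: (z n s n1 s0).
by case: (z n r n1 r0).
Qed.

(** Every admissible family is thereby the coefficient sequence of the profile, which yields
    uniqueness. If r s = 0, condition (b) leaves the constant term only. *)
Lemma schoenberg_hat_coef kappa r s : kappa_representation K kappa -> 0 <= r -> 0 <= s ->
  hat_coef d (profile kappa r s) (fun n => alpha n r s).
Proof.
move=> kr r0 s0; have [_ _ [rep rep0] _ _] := sk.
have [rs|rs] := eqVneq (r * s) 0.
  apply: eq_hat_coef (hat_coef_cst d2 (alpha 0%N r s)) => [t t1|n].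
    have [u [v [u1 v1 <-]]] := unit_pair_dot d2 t1.
    rewrite (profile_dot kr)// rep0.
      by rewrite !euclid_normZ /euclid_norm u1 v1 sqrtr1 !mulr1 !ger0_norm.
    by move/eqP: rs; rewrite mulf_eq0 => /orP[]/eqP ->; rewrite scale0r; [left|right].
  by case: n => [|n] //=; rewrite zero.
move: rs; rewrite mulf_eq0 negb_or => /andP[rn sn]; split.
  exists (fun n => bound n r s) => [n|]; first exact: schoenberg_bound.
  rewrite (_ : (fun n => bound n r s) = 2^-1 *: ((fun n => complex.Re (alpha n r r)) +
    (fun n => complex.Re (alpha n s s))))//.
  by apply: is_cvg_seriesZ; apply: is_cvg_seriesD; exact: schoenberg_summable.
move=> t t1; have [u [v [u1 v1 uv]]] := unit_pair_dot d2 t1.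
have nu (a : R) (w : E) : 0 <= a -> euclid_dot w w = 1 -> euclid_norm (a *: w) = a.
  by move=> a0 w1; rewrite euclid_normZ /euclid_norm w1 sqrtr1 mulr1 ger0_norm.
have ru : r *: u != 0 by rewrite -euclid_norm_eq0 nu.
have sv : s *: v != 0 by rewrite -euclid_norm_eq0 nu.
have ur : (euclid_norm (r *: u))^-1 *: (r *: u) = u by rewrite nu// scalerA mulVf// scale1r.
have us : (euclid_norm (s *: v))^-1 *: (s *: v) = v by rewrite nu// scalerA mulVf// scale1r.
have := rep _ _ ru sv; rewrite ur us (nu r u r0 u1) (nu s v s0 v1) uv.
by rewrite -(profile_dot kr r0 s0 u1 v1) uv.
Qed.

Let cosine (x y : E) : R := euclid_dot ((euclid_norm x)^-1 *: x) ((euclid_norm y)^-1 *: y).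

Let cosine_le1 x y : -1 <= cosine x y <= 1.
Proof.
have [->|x0] := eqVneq x 0; first by rewrite /cosine scaler0 euclid_dot0l lerN10 ler01.
have [->|y0] := eqVneq y 0; first by rewrite /cosine scaler0 euclid_dot0r lerN10 ler01.
by apply: euclid_unit_dot; exact: euclid_unit.
Qed.

Let term n (x y : E) : R[i] := alpha n (euclid_norm x) (euclid_norm y) * (H n (cosine x y))%:C.

Lemma schoenberg_series x y : series (fun n => term n x y) @ \oo --> K x y.
Proof.
have [_ _ [rep rep0] _ _] := sk.
have [xy|] := boolP ((x == 0) || (y == 0)); last first.
  by rewrite negb_or => /andP[x0 y0]; exact: rep.
rewrite rep0; last by case/orP: xy => /eqP ->; [left|right].
apply: cvg_near_cst; exists 1%N => // -[//|n] _.
rewrite /series/= big_nat_recl//= /term hat0// mulr1 big1 ?addr0// => i _.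
rewrite zero ?euclid_norm_ge0 ?mul0r//.
by case/orP: xy => /eqP ->; rewrite euclid_norm0 ?mul0r ?mulr0.
Qed.

Lemma schoenberg_posdef : posdef_on setT K.
Proof.
move=> m x c _; have [e [f [e1 _ _]]] := euclid_orthonormal_pair R d2.
(* [hat_psd] asks for unit vectors. The direction given to 0 is immaterial: the terms with n >= 1
   vanish there by (b), and the polynomial of degree 0 is 1. *)
pose u (x : E) := if x == 0 then e else (euclid_norm x)^-1 *: x.
have u1 z : euclid_dot (u z) (u z) = 1 by rewrite /u; case: eqVneq => // z0; exact: euclid_unit.
have termE n y z : alpha n (euclid_norm y) (euclid_norm z) * (H n (euclid_dot (u y) (u z)))%:C = term n y z.
  have [yz|] := boolP ((y == 0) || (z == 0)); last first.
    by rewrite negb_or /term /u => /andP[/negbTE -> /negbTE ->].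
  case: n => [|n]; first by rewrite /term !hat0//; exact: euclid_unit_dot.
  rewrite /term zero ?euclid_norm_ge0 ?mul0r//.
  by case/orP: yz => /eqP ->; rewrite euclid_norm0 ?mul0r ?mulr0.
apply: (@psd_cvg _ _ (fun N i j => series (fun n => term n (x i) (x j)) N) (fun i j => K (x i) (x j))) => [N b|i j].
  rewrite (_ : \sum_i _ = \sum_(0 <= n < N) \sum_i \sum_j b i * (b j)^* * term n (x i) (x j)).
    apply: sumr_ge0 => n _.
    have := @hat_psd R d d2 m (fun i j => alpha n (euclid_norm (x i)) (euclid_norm (x j))) (fun i => u (x i)) n.
    move=> /(_ _ _ b); under [X in _ -> _ -> 0 <= X]eq_bigr do under eq_bigr do rewrite termE.
    apply => // c'; apply: pa => i; exact/halflineP/euclid_norm_ge0.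
  under eq_bigr do under eq_bigr do rewrite /series/= mulr_sumr.
  under eq_bigr do rewrite exchange_big.
  by rewrite exchange_big.
exact: schoenberg_series.
Qed.

Lemma schoenberg_isotropic : isotropic K.
Proof.
move=> U bU nU x y; have h := @schoenberg_series x y; have h' := @schoenberg_series (U x) (U y).
have dU : euclid_dot (U x) (U y) = euclid_dot x y.
  by rewrite !euclid_dot_polar -!raddfD -!raddfB !nU.
have tE : (fun n => term n x y) = (fun n => term n (U x) (U y)).
  by apply/funext => n; rewrite /term /cosine !nU !euclid_dotZl !euclid_dotZr dU.
by rewrite tE in h; exact: (cvg_unique _ h h').
Qed.

(** The cosine may be discontinuous where an argument vanishes. There the term tends to 0 for n >=
    1, since alpha_n does by (b) and the polynomial is bounded by 1; for n = 0 the polynomial is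
    constant. *)
Let term_continuous n x0 y0 : (fun p : E * E => term n p.1 p.2) @ (x0, y0) --> term n x0 y0.
Proof.
have n1 : (fun p : E * E => euclid_norm p.1) @ (x0, y0) --> euclid_norm x0.
  by apply: (cvg_comp fst); [exact: cvg_fst|exact: euclid_norm_continuous].
have n2 : (fun p : E * E => euclid_norm p.2) @ (x0, y0) --> euclid_norm y0.
  by apply: (cvg_comp snd); [exact: cvg_snd|exact: euclid_norm_continuous].
have ca : (fun p : E * E => alpha n (euclid_norm p.1) (euclid_norm p.2)) @ (x0, y0) -->
    alpha n (euclid_norm x0) (euclid_norm y0).
  have [cal _ _ _ _] := sk.
  have := @cvg_within_comp _ _ _ setT _ (fun p : E * E => (euclid_norm p.1, euclid_norm p.2))
    _ (x0, y0) (cvg_pair n1 n2) _ Logic.I (cal n).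
  rewrite withinET; apply => p _.
  by split; exact/halflineP/euclid_norm_ge0.
have [xy|] := boolP ((x0 == 0) || (y0 == 0)).
  case: n ca => [|n] ca.
    have t0 x y : term 0 x y = alpha 0%N (euclid_norm x) (euclid_norm y).
      by rewrite /term (hat0 d2 (cosine_le1 x y)) mulr1.
    by rewrite t0; under eq_fun do rewrite t0.
  have z : alpha n.+1 (euclid_norm x0) (euclid_norm y0) = 0.
    apply: zero => //; try exact: euclid_norm_ge0.
    by case/orP: xy => /eqP ->; rewrite euclid_norm0 ?mul0r ?mulr0.
  rewrite {2}/term z mul0r.
  apply: (@cvg_complex_squeeze _ _ _ _ _ _ (fun p : E * E => complex.Re `|alpha n.+1 (euclid_norm p.1) (euclid_norm p.2)|)).
    have : (fun p : E * E => `|alpha n.+1 (euclid_norm p.1) (euclid_norm p.2)|) @ (x0, y0) -->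
        `|alpha n.+1 (euclid_norm x0) (euclid_norm y0)| by exact: cvg_norm ca.
    by rewrite z normr0 => /cvg_complexP[].
  apply: nearW => p; rewrite subr0 -lecR -!normc_ReE /term normrM ler_piMr//.
  by rewrite normc_ReE/= expr0n addr0 sqrtr_sqr lecR hat_le1.
rewrite negb_or => /andP[x00 y00]; apply: (cvgM ca).
have cc : (fun p : E * E => cosine p.1 p.2) @ (x0, y0) --> cosine x0 y0.
  rewrite /cosine; under eq_fun do rewrite euclid_dotZl euclid_dotZr mulrA.
  rewrite euclid_dotZl euclid_dotZr mulrA.
  apply: cvgM; last exact: (@euclid_dot_continuous R d (x0, y0)).
  by apply: cvgM; apply: cvgV; rewrite ?euclid_norm_eq0.
have := @cvg_within_comp _ _ _ setT _ (fun p : E * E => cosine p.1 p.2) _ (x0, y0) cc _ Logic.I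
   (@hat_continuous R d d2 n).
rewrite withinET => h; apply/cvg_complexP; split; last exact: cvg_cst.
by apply: h => p _; rewrite /= in_itv/= cosine_le1.
Qed.

Let partial_close N (e : R) (x y : E) :
  (forall m, (N <= m)%N -> \sum_(N <= n < m) complex.Re (alpha n (euclid_norm x) (euclid_norm x)) <= e) ->
  (forall m, (N <= m)%N -> \sum_(N <= n < m) complex.Re (alpha n (euclid_norm y) (euclid_norm y)) <= e) ->
  complex.Re `|K x y - series (fun n => term n x y) N| <= e.
Proof.
move=> hx hy; have h := @schoenberg_series x y.
have /cvg_complexP[h' _] : (fun m => `|series (fun n => term n x y) m - series (fun n => term n x y) N|) @ \oo -->
    `|K x y - series (fun n => term n x y) N|.
  by apply: cvg_norm; apply: cvgB h _; exact: cvg_cst.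
apply: (ler_cvg_to h' (cvg_cst e)); exists N => // m /= Nm.
have -> : series (fun n => term n x y) m - series (fun n => term n x y) N =
    \sum_(N <= n < m) term n x y.
  by rewrite /series/= (big_cat_nat (n := N) (m := 0%N) (p := m))//= addrAC subrr add0r.
rewrite -lecR -normc_ReE (le_trans (ler_norm_sum _ _ _))//.
apply: (@le_trans _ _ (\sum_(N <= n < m) (bound n (euclid_norm x) (euclid_norm y))%:C)).
  apply: ler_sum => n _; apply: le_trans (schoenberg_bound n (euclid_norm_ge0 x) (euclid_norm_ge0 y)).
  rewrite /term normrM ler_piMr// normc_ReE/= expr0n addr0 sqrtr_sqr lecR hat_le1//.
rewrite -rmorph_sum lecR /bound -mulr_sumr big_split/=.
by have := hx m Nm; have := hy m Nm; lra.
Qed.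

(** An e / 3 argument: near (x0, y0) the partial sum of order N is uniformly within e / 3 of K, and
    it is continuous. *)
Lemma schoenberg_continuous : continuous (fun p : E * E => K p.1 p.2).
Proof.
move=> [x0 y0]; apply/cvg_complex_distP => e e0.
have e3 : 0 < e / 3 by rewrite divr_gt0.
have [N1 h1] := schoenberg_tail (euclid_norm_ge0 x0) e3.
have [N2 h2] := schoenberg_tail (euclid_norm_ge0 y0) e3.
pose N := maxn N1 N2.
pose small (x : E) := forall m, (N <= m)%N ->
  \sum_(N <= n < m) complex.Re (alpha n (euclid_norm x) (euclid_norm x)) <= e / 3.
have mono N' (x : E) : (N' <= N)%N ->
    (forall m, (N' <= m)%N -> \sum_(N' <= n < m) complex.Re (alpha n (euclid_norm x) (euclid_norm x)) <= e / 3) ->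
    small x.
  move=> N'N hx m Nm; apply: le_trans (hx m (leq_trans N'N Nm)).
  rewrite [leRHS](big_cat_nat (n := N))//= lerDr sumr_ge0// => n _.
  exact: schoenberg_diag_ge0 (euclid_norm_ge0 x).
have near_small (x : E) N' : (N' <= N)%N -> within halfline (nbhs (euclid_norm x))
    [set s | forall m, (N' <= m)%N -> \sum_(N' <= n < m) complex.Re (alpha n s s) <= e / 3] ->
    \forall z \near x, small z.
  move=> N'N; rewrite /within/= => /(euclid_norm_continuous (x := x)).
  by apply: (@filterS _ (nbhs x)) => z /= /(_ (halflineP (euclid_norm_ge0 z))); exact: mono.
have s1 := near_small _ _ (leq_maxl N1 N2) h1.
have s2 := near_small _ _ (leq_maxr N1 N2) h2.
have cS : (fun p : E * E => series (fun n => term n p.1 p.2) N) @ (x0, y0) -->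
    series (fun n => term n x0 y0) N.
  by apply: (@cvg_sumr _ _ _ _ (nbhs (x0, y0))) => n; exact: term_continuous.
have s1' : \forall p \near (x0, y0), small p.1 by exact: (cvg_fst s1).
have s2' : \forall p \near (x0, y0), small p.2 by exact: (cvg_snd s2).
have c0 := partial_close (nbhs_singleton s1) (nbhs_singleton s2).
move/cvg_complex_distP : cS => /(_ _ e3); apply: filterS3 s1' s2' => p p1 p2 h3.
have c := partial_close p1 p2.
have tri (a b c' d' : R[i]) : complex.Re `|a - d'| <= complex.Re `|a - b| + complex.Re `|b - c'| + complex.Re `|d' - c'|.
  rewrite -lecR !rmorphD/= -!normc_ReE [`|d' - c'|]distrC.
  by rewrite (le_trans (ler_distD c' _ _))// lerD2r ler_distD.
apply: le_trans (tri _ (series (fun n => term n p.1 p.2) N) (series (fun n => term n x0 y0) N) _) _.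
by apply: le_trans (lerD (lerD c h3) c0) _; lra.
Qed.

Lemma schoenberg_isotropic_pd : isotropic_pd_kernel K.
Proof.
split; [exact: schoenberg_continuous|exact: schoenberg_posdef|exact: schoenberg_isotropic].
Qed.

End schoenberg.

(** * The integral formula and the assembled equivalences *)

(** Termwise integration ([zonal_coef_series]) of the real and imaginary parts; the normalisation by
    the integral of the weight cancels in the quotient. *)
Lemma hat_coef_integral (R : realType) (m n : nat) (G : R -> R[i]) (a : nat -> R[i]) :
  hat_coef (Fin m.+2) G a ->
  let l : R := m%:R / 2 in
  let C := fun rho : R => (gegenbauer_hat l%:E n rho)%:C in
  a n = cintegral `[-1, 1] (fun rho => G rho * C rho * (gegenbauer_weight l rho)%:C) /
        gegenbauer_inner l C C.
Proof.
move=> [[b ab cb] aG] l C; pose p := ultraspherical (m%:R : R) n.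
have l0 : l = 0 \/ 2^-1 <= l.
  by rewrite /l; case: (m) => [|k]; [left; rewrite mul0r|right; rewrite ler_pdivlMr// mulVf// ler1n].
have CE (t : R) : -1 <= t <= 1 -> gegenbauer_hat l%:E n t = p.[t].
  have <- : dim_index R (Fin m.+2) = l%:E by rewrite /= -[m.+2]addn2 natrD addrK.
  exact: gegenbauer_hat_fin.
have aG' (t : R) : -1 <= t <= 1 ->
    series (fun k => a k * ((ultraspherical (m%:R : R) k).[t])%:C) @ \oo --> G t.
  move=> t1; have := aG t t1.
  rewrite (_ : (fun k => a k * (gegenbauer_hat _ k t)%:C) = (fun k => a k * ((ultraspherical (m%:R : R) k).[t])%:C))//.
  by apply/funext => k; rewrite gegenbauer_hat_fin.
have J1 : 0 < weighted_integral l (horner 1) by exact: weighted_integral1_gt0.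
pose h := weighted_integral l (horner (p * p)).
have h0 : h != 0.
  have := sphere_mean_sqr_gt0 R m n; rewrite -zonal_integral_horner /zonal_integral -/l => hp.
  by apply: contraTneq hp => e; rewrite -/p -/h e mul0r ltxx.
have part (f : R[i] -> R) : (forall z, `|f z| <= complex.Re `|z|) ->
    (forall t : R, -1 <= t <= 1 -> series (fun k => f (a k) * (ultraspherical (m%:R : R) k).[t]) @ \oo --> f (G t)) ->
    weighted_integral l (fun t => f (G t) * gegenbauer_hat l%:E n t) = f (a n) * h.
  move=> fz fG; have [|_] := zonal_coef_series (a := f \o a) (g := f \o G) n _ cb fG.
    by move=> k; rewrite (le_trans (fz _))//; have := ab k; rewrite normc_ReE lecR.
  rewrite /zonal_integral -zonal_integral_horner /zonal_integral -/l mulrA => /(mulIf (invr_neq0 (lt0r_neq0 J1))) <-.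
  by apply: eq_weighted_integral => t t1; rewrite CE.
have ReI : weighted_integral l (fun t => complex.Re (G t) * gegenbauer_hat l%:E n t) = complex.Re (a n) * h.
  by apply: (part (@complex.Re R)) => [z|t t1]; [exact: Re_le_norm|have /cvg_series_scaleP[] := aG' t t1].
have ImI : weighted_integral l (fun t => complex.Im (G t) * gegenbauer_hat l%:E n t) = complex.Im (a n) * h.
  by apply: (part (@complex.Im R)) => [z|t t1]; [exact: Im_le_norm|have /cvg_series_scaleP[] := aG' t t1].
have -> : gegenbauer_inner l C C = h%:C.
  rewrite /gegenbauer_inner (_ : (fun rho => _) = (fun rho =>
      (gegenbauer_hat l%:E n rho * gegenbauer_hat l%:E n rho * gegenbauer_weight l rho)%:C)); last first.
    by apply/funext => t; rewrite /C conj_real !rmorphM.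
  apply/complex_eqP; split=> /=.
    apply: (eq_weighted_integral l (f := fun t => gegenbauer_hat l%:E n t * gegenbauer_hat l%:E n t)).
    by move=> t t1; rewrite CE// hornerM.
  transitivity (weighted_integral l (fun t => 0 * horner 1 t)).
    by apply: eq_Rintegral => t _; rewrite !mul0r.
  by rewrite weighted_integralZ ?mul0r//; exact: within_horner.
have -> : cintegral `[-1, 1] (fun rho => G rho * C rho * (gegenbauer_weight l rho)%:C) = a n * h%:C.
  apply/complex_eqP; rewrite complex_ReMr complex_ImMr -ReI -ImI; split=> /=.
    by apply: eq_Rintegral => t _; rewrite !complex_ReMr.
  by apply: eq_Rintegral => t _; rewrite !complex_ImMr.
by rewrite mulfK//; apply/eqP => /complex_eqP[/= e _]; rewrite e eqxx in h0.
Qed.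

Theorem theorem2p2 (R : realType) (d : dimension)
    (K : euclidean R d -> euclidean R d -> R[i]) :
  dim_ge2 d ->
  [/\ isotropic_pd_kernel K <->
        (posdef_on setT K /\ exists kappa, kappa_representation K kappa),
      isotropic_pd_kernel K <-> has_unique_schoenberg_kernels K,
      isotropic_pd_kernel K -> forall alpha, schoenberg_kernels K alpha ->
        ((forall (n : nat) (r s : R), 0 <= r -> 0 <= s -> complex.Im (alpha n r s) = 0) <->
         (forall x y, complex.Im (K x y) = 0)) &
      isotropic_pd_kernel K -> forall m : nat, d = Fin m ->
        forall kappa, kappa_representation K kappa ->
        forall alpha, schoenberg_kernels K alpha ->
        forall (r s : R) (n : nat), 0 <= r -> 0 <= s ->
        let l := (m%:R - 2) / 2 in
        let C := fun rho : R => (gegenbauer_hat l%:E n rho)%:C in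
        alpha n r s =
          cintegral `[-1, 1] (fun rho =>
            kappa r s (r * s * rho) * C rho * (gegenbauer_weight l rho)%:C) /
          gegenbauer_inner l C C].
Proof.
move=> d2; split.
- split=> [iK|[pK [kappa kr]]]; last exact: kappa_representation_isotropic_pd kr.
  by split; [case: iK|exact: isotropic_pd_kappa_representation].
- split=> [iK|[alpha sk _]]; last exact: schoenberg_isotropic_pd sk.
  have [_ pK _] := iK; have [kappa kr] := isotropic_pd_kappa_representation d2 iK.
  have [alpha Fa] := profile_hat_coefs d2 kr pK.
  exists alpha; first exact: (coefficient_schoenberg d2 kr pK Fa).
  move=> beta sk n r s r0 s0.
  exact: (hat_coef_unique d2 (schoenberg_hat_coef d2 sk kr r0 s0) (Fa r s r0 s0) n).
- move=> iK alpha sk; have [_ pK _] := iK.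
  have [kappa kr] := isotropic_pd_kappa_representation d2 iK.
  split=> [a0 x y|K0 n r s r0 s0].
    have /cvg_series_scaleP[_ h] := schoenberg_series d2 sk (x := x) (y := y).
    apply: (cvg_unique _ h) => //.
    rewrite (_ : series _ = fun=> 0); first exact: cvg_cst.
    by apply/funext => k; rewrite /series/= big1// => i _; rewrite a0 ?mul0r// euclid_norm_ge0.
  (* The imaginary parts of alpha_n(r, s) are the coefficients of the imaginary part of the profile,
     which is 0 because its values are values of K. *)
  have [[b ab cb] h] := schoenberg_hat_coef d2 sk kr r0 s0.
  apply: (hat_expansion_unique d2 (a := fun n => complex.Im (alpha n r s)) (b := b)) => // [k|t t1].
    by rewrite (le_trans (Im_le_norm _))//; have := ab k; rewrite normc_ReE lecR.
  have /cvg_series_scaleP[_] := h t t1.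
  by have [x [y ->]] := profile_exists d2 kr r0 s0 t1; rewrite K0.
- move=> iK m dm; subst d; case: m d2 K iK => [//|[//|m]] d2 K iK kappa kr alpha sk r s n r0 s0.
  have -> : (m.+2%:R - 2) / 2 = m%:R / 2 :> R by rewrite -[m.+2]addn2 natrD addrK.
  exact: (hat_coef_integral n (schoenberg_hat_coef d2 sk kr r0 s0)).
Qed.
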